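(* Let $\gamma$ be the standard Gaussian measure on $\mathbb{R}^\infty$, let $H=l^2$, let $v=(v_i)$ be a Borel vector field on $\mathbb{R}^\infty$ with values in $H$, and let $\mu$ be a Borel probability measure on $\mathbb{R}^\infty$ with $|v|_H\in L^1(\mu)$ satisfying $$\int L_v\varphi\,d\mu=0\qquad\forall\,\varphi\in\mathcal{F}\mathcal{C}_0 .$$ Then $\mu=f\cdot\gamma$ for some $f\in L^1(\gamma)$, and the following assertions are true. (i) If $|v|_H\in L_{\psi_2}(\mu)$, then $\gamma(f\ge t)\le e^2t^{-\frac{1}{1-\sigma_2}}$ for all $t>0$ and $f\in L^p(\gamma)$ for all $p<\frac{1}{1-\sigma_2}$, where $\sigma_2:=\exp\bigl(-2\pi\|\,|v|_H\|_{L_{\psi_2}(\mu)}\bigr)$. (ii) If $|v|_H\in L_{\psi_m}(\mu)$ with $m>2$, then $$\gamma(f\ge t)\le e^2\exp\bigl(-\sigma_m[\ln t]^{\frac{2}{1+2/m}}\bigr)\qquad\forall\,t>1,$$ and $e^{\varepsilon[\ln\max\{f,1\}]^{\frac{2}{1+2/m}}}\in L^1(\gamma)$ for all $\varepsilon<\sigma_m$, where $$\sigma_m:=\frac{1-2/m}{1+2/m}\Bigl(2\pi\|\,|v|_H\|_{L_{\psi_m}(\mu)}(1-2/m)\Bigr)^{-\frac{2}{1+2/m}}.$$ (iii) If $|v|_H$ is bounded, then $$\gamma(f\ge t)\le e^2e^{-\sigma_\infty[\ln t]^2}\qquad\forall\,t>1,$$ and $e^{\varepsilon[\ln\max\{f,1\}]^2}\in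 L^1(\mu)$ for all $\varepsilon<\sigma_\infty$, where $\sigma_\infty:=(2\pi\|\,|v|_H\|_\infty)^{-2}$.
   Context: $\mathbb{R}^\infty$ is the space of all real sequences with its Borel $\sigma$-algebra generated by the coordinate functions, and $\gamma$ is the countable power of the standard Gaussian measure on the real line. Its Cameron–Martin space is $H=l^2$ with norm $|h|_H=(\sum_nh_n^2)^{1/2}$ and inner product $(\cdot,\cdot)_H$. $\mathcal{F}\mathcal{C}$ is the class of functions $\varphi(x)=\varphi_0(x_1,\dots,x_n)$ with $n\in\mathbb{N}$, $\varphi_0\in C_b^\infty(\mathbb{R}^n)$; $\mathcal{F}\mathcal{C}_0\subset\mathcal{F}\mathcal{C}$ is the (nonlinear) subset of those $\varphi$ for which $\varphi_0$ can be taken with compact support. For such $\varphi$, $$L\varphi(x)=\sum_{i=1}^n[\partial_{x_i}^2\varphi(x)-x_i\partial_{x_i}\varphi(x)],\quad\nabla_H\varphi=(\partial_{x_i}\varphi)_i\in H,\quad L_v\varphi=L\varphi+(v,\nabla_H\varphi)_H.$$ Orlicz norm. For $m\ge1$ let $\psi_m(t):=e^{t^m}-1$, $t>0$. For a probability measure $\nu$, a measurable function $w$ belongs to $L_{\psi_m}(\nu)$ if $\int\psi_m(\lambda^{-1}|w|)\,d\nu<\infty$ for some $\lambda>0$, and $\|w\|_{L_{\psi_m}(\nu)}:=\inf\{\lambda>0:\int\psi_m(\lambda^{-1}|w|)\,d\nu\le1\}$. *)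

(* Defs.v *)
From HB Require Import structures.
From mathcomp Require Import all_boot all_order all_algebra.
From mathcomp Require Import all_classical all_reals all_analysis.

Set Implicit Arguments.
Unset Strict Implicit.
Unset Printing Implicit Defensive.

Import Order.TTheory GRing.Theory Num.Theory.
Import numFieldNormedType.Exports.

Local Open Scope classical_set_scope.
Local Open Scope ring_scope.

(* Coordinates are indexed from 0: x_1, x_2, ... are x 0, x 1, ... *)
Definition Rinf (R : realType) : Type :=
  g_sigma_algebraType
    (\bigcup_(n in [set: nat])
       preimage_set_system setT (fun x : nat -> R => x n) measurable).

(* gamma is the countable power of N(0,1); by the pi-lambda theorem the
   values on cylindrical rectangles determine it. *)
Definition std_gaussian_power (R : realType)
    (gamma : probability (Rinf R) R) : Prop :=
  forall (n : nat) (A : nat -> set R),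
    (forall i, measurable (A i)) ->
    gamma [set x : Rinf R | forall i, (i < n)%N -> A i (x i)] =
    (\prod_(i < n) normal_prob 0 1 (A i))%E.

Definition in_l2 (R : realType) (h : nat -> R) : Prop :=
  cvgn (series (fun n => h n ^+ 2)).

Definition normH (R : realType) (h : nat -> R) : R :=
  Num.sqrt (limn (series (fun n => h n ^+ 2))).

Definition innerH (R : realType) (h k : nat -> R) : R :=
  limn (series (fun n => h n * k n)).

Definition iter_partial (R : realType) (n : nat) (s : seq 'I_n)
    (phi0 : 'rV[R]_n -> R) : 'rV[R]_n -> R :=
  foldr (fun i g => 'D_(delta_mx 0 i) g) phi0 s.

(* C_b^oo(R^n): bounded, with bounded continuous partial derivatives of every
   order; the empty sequence s is phi0 itself. *)
Definition smooth_bounded (R : realType) (n : nat)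
    (phi0 : 'rV[R]_n -> R) : Prop :=
  forall s : seq 'I_n,
    [/\ forall (i : 'I_n) (x : 'rV[R]_n),
          derivable (iter_partial s phi0) x (delta_mx 0 i),
        continuous (iter_partial s phi0)
      & bounded_fun (iter_partial s phi0)].

Definition compact_support (R : realType) (n : nat)
    (phi0 : 'rV[R]_n -> R) : Prop :=
  compact (closure [set x | phi0 x != 0]).

(* phi belongs to FC_0 and depends only on the first n coordinates. *)
Definition FC0 (R : realType) (n : nat) (phi : Rinf R -> R) : Prop :=
  exists phi0 : 'rV[R]_n -> R,
    [/\ smooth_bounded phi0, compact_support phi0
      & forall x : Rinf R, phi x = phi0 (\row_(i < n) x i)].

Definition partial (R : realType) (i : nat) (phi : Rinf R -> R)
    (x : Rinf R) : R :=
  derive1 (fun t : R => phi (fun k : nat => x k + t *+ (k == i))) 0.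

Definition gradH (R : realType) (phi : Rinf R -> R) (x : Rinf R) : nat -> R :=
  fun i => partial i phi x.

(* L phi for phi depending on the first n coordinates. *)
Definition OU (R : realType) (n : nat) (phi : Rinf R -> R) (x : Rinf R) : R :=
  \sum_(i < n) (partial i (partial i phi) x - x i * partial i phi x).

Definition drift_OU (R : realType) (v : Rinf R -> Rinf R) (n : nat)
    (phi : Rinf R -> R) (x : Rinf R) : R :=
  OU n phi x + innerH (v x) (gradH phi x).

Definition psi (R : realType) (m t : R) : R := expR (t `^ m) - 1.

Definition in_Lpsi (d : measure_display) (T : measurableType d) (R : realType)
    (nu : probability T R) (m : R) (w : T -> R) : Prop :=
  measurable_fun setT w /\
  exists2 l : R, 0 < l & (\int[nu]_x (psi m (l^-1 * `|w x|))%:E < +oo)%E.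

Definition Lpsi_norm (d : measure_display) (T : measurableType d)
    (R : realType) (nu : probability T R) (m : R) (w : T -> R) : R :=
  inf [set l : R |
        0 < l /\ (\int[nu]_x (psi m (l^-1 * `|w x|))%:E <= 1)%E].

(* The bounds are stated in \bar R so that the degenerate case |v|_H = 0
   mu-a.e. is read as in the formulas: 1 / 0 = +oo in the ereal inverse,
   giving infinite exponents. *)

(* t ^ a for t > 0; t ^ (-oo) is +oo, 1 or 0 as t < 1, t = 1 or t > 1. *)
Definition epow (R : realType) (t : R) (a : \bar R) : \bar R :=
  expeR (a * (ln t)%:E)%E.

Definition sigma2 (R : realType) (N : R) : R := expR (- (2 * pi * N)).

Definition qexp (R : realType) (m : R) : R := 2 / (1 + 2 / m).

Definition sigma (R : realType) (m N : R) : \bar R :=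
  (((1 - 2 / m) / (1 + 2 / m))%:E
    * (((2 * pi * N * (1 - 2 / m)) `^ qexp m)%:E)^-1)%E.

Definition sigma_oo (R : realType) (N : R) : \bar R :=
  ((((2 * pi * N) ^+ 2)%:E)^-1)%E.

(* Main.v *)
(* Let [P_th] be the Ornstein-Uhlenbeck operator at time [- ln (cos th)], so that
   [P_0] is the identity and [P_(pi/2)] the Gaussian mean, and let [W] be the
   indicator of a finite combination of orthants and [G = P_th W + eps]. As [th]
   varies, the derivative of the integral of [G^al] (0 < al <= 1) against [mu] is,
   by the equation tested on [G^al], at least minus the integral of
   [(tan th) |v| |grad G^al|]; the Gaussian entropy inequality for a barycentre gives
   [(tan th) |grad G| <= G sqrt (2 (2 - ln G))].
   - Letting [al] tend to 0, [mu W] is small as soon as [gamma W] is: [mu] is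
     absolutely continuous.
   - For [al = 1], an Orlicz bound on [|v|] controls the drift by a function of the
     mean [u] of [G] alone, and the resulting differential inequality says that
     [D (gamma A) - D (mu A) <= pi lam] for every Borel [A], where
     [D' u = - 1 / (u (2 - ln u)^(1/2 + 1/m))].
   On [A = {f >= t}] one has [mu A >= t gamma A], and the tail bounds follow. *)

Require Import Defs.
From HB Require Import structures.
From mathcomp Require Import all_boot all_order all_algebra.
From mathcomp Require Import all_classical all_reals all_analysis.
From mathcomp Require Import measurable_realfun ess_sup_inf ring lra.
Set Implicit Arguments.
Unset Strict Implicit.
Unset Printing Implicit Defensive.
Import Order.TTheory GRing.Theory Num.Theory.
Import numFieldNormedType.Exports.
Local Open Scope classical_set_scope.
Local Open Scope ring_scope.

(** * Directional derivatives and smooth bounded functions *)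

(** The change of time contributes the factor [tan th], which cancels the singular [cot th] of the
    gradient estimate: the rate is uniform on an interval of length [pi / 2], the source of
    [pi lam]. Orthants make [G] an explicit sum of products of Gaussian distribution functions,
    smooth with bounded derivatives but without compact support, so the equation has to be extended
    by cutoffs that use no moment of [mu]. The shift [eps] keeps logarithms and negative powers of
    [G] bounded. At angle 0 the semigroup returns [W] only off the faces of the orthants, so these
    have to be shown [mu]-null beforehand. The statement asks for [2 pi] where the argument gives
    [pi]; the spare factor pays for replacing the Orlicz norm, an infimum, by an admissible [lam]
    below twice the norm. *)

Section derive_extra.
Context {R : realType} {V : normedModType R}.
Implicit Types (f g : V -> R) (x v : V).

(** Both difference quotients are the same function of [h], so one-variable rules, in particular the
    chain rule, apply in any direction of [V]. *)
Lemma is_derive_line f x v a :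
  is_derive x v f a <-> is_derive (0 : R) 1 (fun h : R => f (h *: v + x)) a.
Proof.
have E : (fun h : R => h^-1 *: ((f \o shift x) (h *: v) - f x)) =
  (fun h : R => h^-1 *: (((fun k : R => f (k *: v + x)) \o shift 0) (h *: 1)
     - f (0 *: v + x))).
  by apply/funext => h; rewrite /= !scale0r !add0r addr0 [h%:A]mulr1.
split=> -[H1 H2]; split.
- exact: (derivable1P f x v).1.
- by rewrite -H2 /derive E.
- exact: (derivable1P f x v).2.
- by rewrite -H2 /derive E.
Qed.

Lemma is_derive_comp1 (b : R -> R) f x v b' a :
  is_derive (f x) 1 b b' -> is_derive x v f a ->
  is_derive x v (fun y => b (f y)) (b' * a).
Proof.
move=> Hb /is_derive_line Hf; apply/is_derive_line.
have := @is_derive1_comp R b (fun h : R => f (h *: v + x)) 0 b' a.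
by apply; rewrite ?scale0r ?add0r.
Qed.

Lemma is_derive_mulf f g x v a b :
  is_derive x v f a -> is_derive x v g b ->
  is_derive x v (fun y => f y * g y) (f x * b + g x * a).
Proof. by move=> Hf Hg; exact: is_deriveM. Qed.

Lemma is_derive_addf f g x v a b :
  is_derive x v f a -> is_derive x v g b ->
  is_derive x v (fun y => f y + g y) (a + b).
Proof. by move=> Hf Hg; exact: is_deriveD. Qed.

Lemma is_derive_scalef (c : R) f x v a :
  is_derive x v f a -> is_derive x v (fun y => c * f y) (c * a).
Proof. by move=> Hf; exact: is_deriveZ. Qed.

Lemma is_derive_sumf (I : Type) (s : seq I) (f : I -> V -> R) (a : I -> R) x v :
  (forall i, is_derive x v (f i) (a i)) ->
  is_derive x v (fun y => \sum_(i <- s) f i y) (\sum_(i <- s) a i).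
Proof.
move=> H; elim: s => [|i s IH].
  rewrite big_nil; under eq_fun do rewrite big_nil; exact: is_derive_cst.
rewrite big_cons; under eq_fun do rewrite big_cons; exact: is_derive_addf.
Qed.

Lemma is_derive_prodf (I : eqType) (s : seq I) (f : I -> V -> R) (a : I -> R) x v :
  uniq s -> (forall i, is_derive x v (f i) (a i)) ->
  is_derive x v (fun y => \prod_(i <- s) f i y)
    (\sum_(i <- s) a i * \prod_(j <- s | j != i) f j x).
Proof.
move=> + H; elim: s => [_|i s IH /= /andP[ns us]].
  rewrite big_nil; under eq_fun do rewrite big_nil; exact: is_derive_cst.
rewrite big_cons; under eq_fun do rewrite big_cons.
apply: (is_derive_eq (is_derive_mulf (H i) (IH us))).
rewrite big_cons eqxx /= addrC mulrC; congr (_ + _).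
  congr (_ * _); rewrite big_seq [RHS]big_seq_cond; apply: eq_bigl => j.
  by case: (boolP (j \in s)) => //= js; apply/esym; apply: contraNneq ns => <-.
rewrite mulr_sumr [LHS]big_seq [RHS]big_seq; apply: eq_bigr => j js.
rewrite big_cons ifT; last by apply: contraNneq ns => ->.
by rewrite mulrCA.
Qed.

End derive_extra.

Section smooth_classes.
Context {R : realType}.

(* Boundedness of [f] and of all its partial derivatives up to order [k] along
   the directions [e]; with [I] a singleton and [e] equal to [1] this is the class
   C_b^k of the line, with [e] the canonical basis that of R^n. *)
Fixpoint Cb {V : normedModType R} {I : Type} (e : I -> V) (k : nat) (f : V -> R)
    {struct k} : Prop :=
  [/\ continuous f, exists M : R, forall x, `|f x| <= M &
   match k with
   | 0 => True
   | k'.+1 => exists df : I -> V -> R,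
       (forall i x, is_derive x (e i) f (df i x)) /\ forall i, Cb e k' (df i)
   end].

Definition Cbline := @Cb R unit (fun=> 1).

Context {V : normedModType R} {I : Type} (e : I -> V).
Implicit Types (f g : V -> R).

Lemma Cb_SE k f : Cb e k.+1 f <-> Cb e 0 f /\ exists df : I -> V -> R,
  (forall i x, is_derive x (e i) f (df i x)) /\ forall i, Cb e k (df i).
Proof. by split=> [[? ? ?]|[[? ? _] ?]]; split. Qed.

Lemma Cb0 k f : Cb e k f -> Cb e 0 f.
Proof. by case: k => [//|k] /Cb_SE[]. Qed.

Lemma Cb_cont k f : Cb e k f -> continuous f.
Proof. by move=> /Cb0 []. Qed.

Lemma Cb_bound k f : Cb e k f -> exists M : R, forall x, `|f x| <= M.
Proof. by move=> /Cb0 []. Qed.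

Lemma Cb_S k f : Cb e k.+1 f -> Cb e k f.
Proof.
elim: k f => [|k IH] f; first exact: Cb0.
move=> /Cb_SE[bf [df [Hd Hk]]]; apply/Cb_SE; split => //; exists df; split => // i.
exact: IH.
Qed.

Lemma Cb_cst k (c : R) : Cb e k (fun=> c).
Proof.
have H a : Cb e 0 (fun=> a) by split; [exact: cst_continuous|exists `|a| | ].
elim: k c => [//|k IH] c; apply/Cb_SE; split => //.
by exists (fun _ _ => 0); split=> // i x; exact: is_derive_cst.
Qed.

Lemma Cb_add k f g : Cb e k f -> Cb e k g -> Cb e k (fun x => f x + g x).
Proof.
have H f' g' : Cb e 0 f' -> Cb e 0 g' -> Cb e 0 (fun x => f' x + g' x).
  move=> [cf [M bf] _] [cg [N bg] _]; split=> //.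
    by move=> x; apply: continuousD; [exact: cf|exact: cg].
  by exists (M + N) => x; rewrite (le_trans (ler_normD _ _))// lerD.
elim: k f g => [//|k IH] f g /Cb_SE[f0 [df [Hdf Cf]]] /Cb_SE[g0 [dg [Hdg Cg]]].
apply/Cb_SE; split; first exact: H.
exists (fun i x => df i x + dg i x); split => [i x|i]; last exact: IH.
exact: is_derive_addf.
Qed.

Lemma Cb_mul k f g : Cb e k f -> Cb e k g -> Cb e k (fun x => f x * g x).
Proof.
have H f' g' : Cb e 0 f' -> Cb e 0 g' -> Cb e 0 (fun x => f' x * g' x).
  move=> [cf [M bf] _] [cg [N bg] _]; split=> //.
    by move=> x; apply: continuousM; [exact: cf|exact: cg].
  by exists (M * N) => x; rewrite normrM ler_pM.
elim: k f g => [//|k IH] f g Hf Hg.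
move: (Hf) (Hg) => /Cb_SE[f0 [df [Hdf Cf]]] /Cb_SE[g0 [dg [Hdg Cg]]].
apply/Cb_SE; split; first exact: H.
exists (fun i x => f x * dg i x + g x * df i x); split => [i x|i].
  exact: is_derive_mulf.
by apply: Cb_add; apply: IH => //; exact: Cb_S.
Qed.

Lemma Cb_sum k (J : Type) (s : seq J) (f : J -> V -> R) :
  (forall j, Cb e k (f j)) -> Cb e k (fun x => \sum_(j <- s) f j x).
Proof.
move=> H; elim: s => [|j s IH].
  by under eq_fun do rewrite big_nil; exact: Cb_cst.
by under eq_fun do rewrite big_cons; exact: Cb_add.
Qed.

Lemma Cb_prod k (J : Type) (s : seq J) (P : pred J) (f : J -> V -> R) :
  (forall j, Cb e k (f j)) -> Cb e k (fun x => \prod_(j <- s | P j) f j x).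
Proof.
move=> H; elim: s => [|j s IH].
  by under eq_fun do rewrite big_nil; exact: Cb_cst.
under eq_fun do rewrite big_cons.
by case: (P j) => //; exact: Cb_mul.
Qed.

End smooth_classes.

Section smooth_comp.
Context {R : realType} {V : normedModType R} {I : Type} (e : I -> V).
Implicit Types (f g : V -> R).

(** Only the derivatives of [f] have to be bounded: the inner functions are affine maps and
    coordinates, which are unbounded, and boundedness comes from [b]. *)
Lemma Cb_comp k (b : R -> R) f (df : I -> V -> R) :
  Cbline k b -> continuous f -> (forall i x, is_derive x (e i) f (df i x)) ->
  (forall i, Cb e k (df i)) -> Cb e k (fun x => b (f x)).
Proof.
move=> + cf Hd.
have H b' : Cbline 0 b' -> Cb e 0 (fun x => b' (f x)).
  move=> [cb [M bM] _]; split => //; last by exists M.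
  by move=> x; apply: continuous_comp; [exact: cf|exact: cb].
elim: k b => [|k IH] b Hb Hk; first exact: H.
move: Hb => /Cb_SE[b0 [db [Hdb Cdb]]]; apply/Cb_SE; split; first exact: H.
exists (fun i x => db tt (f x) * df i x); split => [i x|i].
  exact: is_derive_comp1.
apply: Cb_mul; last exact: Cb_S.
by apply: IH => // j; exact: Cb_S.
Qed.

(** Each derivative lowers the exponent, so negative powers appear, and the lower bound [eps] keeps
    them bounded. *)
Lemma Cb_powR k f (eps a : R) : 0 < eps -> (forall x, eps <= f x) ->
  Cb e k f -> Cb e k (fun x => f x `^ a).
Proof.
move=> e0 fe; have f0 x : 0 < f x by exact: lt_le_trans e0 (fe x).
have H b : Cb e 0 f -> Cb e 0 (fun x => f x `^ b).
  move=> [cf [M bf] _]; split => //.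
    move=> x; apply: (@continuous_comp _ _ _ f (fun s => s `^ b)); first exact: cf.
    apply: differentiable_continuous; apply/derivable1_diffP.
    by have := is_derive1_powR b (f0 x); case.
  (* One bound for both signs of [b]: the first term serves [b >= 0], the second [b < 0]. *)
  exists (M `^ b + eps `^ b) => x; rewrite ger0_norm ?powR_ge0//.
  have fM : f x <= M by rewrite (le_trans (ler_norm _)).
  have [b0|b0] := leP 0 b.
    rewrite ler_wpDr ?powR_ge0// ge0_ler_powR// ?nnegrE//; first exact: ltW.
    by rewrite (le_trans _ fM)// ltW.
  rewrite ler_wpDl ?powR_ge0// -[b]opprK.
  have : 0 <= - b by rewrite oppr_ge0 ltW.
  move: (- b) => c c0; rewrite !powRN lef_pV2 ?posrE ?powR_gt0//.
  by rewrite ge0_ler_powR// nnegrE; exact: ltW.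
elim: k a => [|k IH] a Hf; first exact: H.
apply/Cb_SE; split; first exact: H (Cb0 Hf).
move: (Hf) => /Cb_SE[_ [df [Hdf Cf]]].
exists (fun i x => a * f x `^ (a - 1) * df i x); split => [i x|i].
  apply: (@is_derive_comp1 _ _ (fun s => s `^ a)) => //.
  exact: is_derive1_powR.
apply: Cb_mul => //; apply: Cb_mul; first exact: Cb_cst.
exact: IH (Cb_S Hf).
Qed.

End smooth_comp.

Section smooth_line.
Context {R : realType}.
Implicit Types (b : R -> R) (p : {poly R}).

(** If a family is stable under differentiation and its members are bounded, it lies in every class,
    and no higher derivative is ever written down. Gaussian and flat functions with polynomial
    factors form such families. *)
Lemma Cbline_closed (F : set (R -> R)) :
  (forall b, F b -> (exists M : R, forall x, `|b x| <= M) /\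
     exists2 db, F db & forall x, is_derive x (1 : R) b (db x)) ->
  forall k b, F b -> Cbline k b.
Proof.
move=> HF; elim=> [|k IH] b Fb; have [[M bM] [db Fdb Hdb]] := HF b Fb;
  have cb : continuous b by
    move=> x; apply: differentiable_continuous; apply/derivable1_diffP; case: (Hdb x).
- by split => //; exists M.
- apply/Cb_SE; split; first by split => //; exists M.
  by exists (fun=> db); split => // _; exact: IH.
Qed.

Lemma Cbline_affine k b (a c : R) : Cbline k b -> Cbline k (fun x => b (a * x + c)).
Proof.
move=> Hb.
have Hd x : is_derive x (1 : R) (fun x : R => a * x + c) a.
  apply: (is_derive_eq (is_derive_addf (is_derive_scalef _ (is_derive_id _ _))
    (is_derive_cst _ _ _))).
  by rewrite addr0 mulr1.
apply: (Cb_comp (df := fun _ _ => a) Hb) => //.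
- move=> x; apply: differentiable_continuous; apply/derivable1_diffP; case: (Hd x) => //.
- by move=> _; exact: Cb_cst.
Qed.

Lemma Cbline_coord n k b (i : 'I_n) : Cbline k b ->
  Cb (fun j : 'I_n => delta_mx 0 j : 'rV[R]_n) k (fun x : 'rV[R]_n => b (x 0 i)).
Proof.
move=> Hb; apply: (Cb_comp (df := fun j _ => (i == j)%:R) Hb).
- by move=> x; exact: (@coord_continuous R 1 n 0 i x).
- move=> j x; apply/is_derive_line.
  under eq_fun do rewrite !mxE eqxx /=.
  apply: (is_derive_eq (is_derive_addf (is_derive_mulf (is_derive_id _ _) (is_derive_cst _ _ _))
    (is_derive_cst _ _ _))).
  by rewrite mul0r add0r mulr1 addr0 .
- by move=> j; exact: Cb_cst.
Qed.

(** Term by term from [y^i <= i! e^y] for [y >= 0]. The bound is used at [y] against Gaussian decay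
    and at [1 / t] against [e^(-1/t)]. *)
Lemma horner_le_expR p : exists2 M : R, 0 <= M &
  forall y, `|p.[y]| <= M * expR `|y|.
Proof.
exists (\sum_(i < size p) `|p`_i| * i`!%:R).
  by apply: sumr_ge0 => i _; rewrite mulr_ge0.
move=> y; rewrite horner_coef (le_trans (ler_norm_sum _ _ _))// mulr_suml.
apply: ler_sum => i _; rewrite normrM normrX -mulrA ler_wpM2l//.
case: (nat_of_ord i) => [|m]; first by rewrite expr0 mul1r -[leLHS]expR0 ler_expR.
have := @expR_ge1Dxn R `|y| m (normr_ge0 _) => H.
rewrite -ler_pdivrMl ?ltr0n ?fact_gt0// mulrC (le_trans _ H)// lerDr ler01//.
Qed.

Lemma is_derive_gauss (x : R) :
  is_derive x (1 : R) (fun y => expR (- (y ^+ 2 / 2))) (- x * expR (- (x ^+ 2 / 2))).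
Proof.
apply: (is_derive_eq (@is_derive_comp1 R _ expR (fun y : R => - (y ^+ 2 / 2)) x 1
   (expR (- (x ^+ 2 / 2))) (- x) _ _)).
- have H : is_derive x (1 : R) (fun y : R => - (2^-1 * (y * y))) (- (2^-1 * (x * 1 + x * 1))).
    by apply: is_deriveN; apply: is_derive_scalef; apply: is_derive_mulf.
  under eq_fun do rewrite mulrC expr2.
  by apply: (is_derive_eq H); field.
- by rewrite mulrC.
Qed.

Lemma is_derive_poly p (x : R) : is_derive x (1 : R) (horner p) p^`().[x].
Proof.
split; first exact: derivable_horner.
by rewrite derivE derive1E.
Qed.

Lemma Cbline_poly_gauss k p : Cbline k (fun y : R => p.[y] * expR (- (y ^+ 2 / 2))).
Proof.
apply: (@Cbline_closed [set b | exists p, b = fun y => p.[y] * expR (- (y ^+ 2 / 2))]);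
  last by exists p.
move=> _ [{}p ->]; split.
  have [M M0 HM] := horner_le_expR p; exists (M * expR 1) => y.
  rewrite normrM [ `|expR _|]ger0_norm ?expR_ge0//.
  rewrite (le_trans (ler_wpM2r (expR_ge0 _) (HM y)))// -mulrA -expRD ler_wpM2l//.
  rewrite ler_expR -[y ^+ 2]real_normK ?num_real//.
  by have := sqr_ge0 (`|y| - 1); nra.
exists (fun y => (p^`() - 'X * p).[y] * expR (- (y ^+ 2 / 2))).
  by exists (p^`() - 'X * p).
move=> x; apply: (is_derive_eq (is_derive_mulf (is_derive_poly p x) (is_derive_gauss x))).
rewrite hornerD hornerN hornerM hornerX; ring.
Qed.

(** The classical flat function [e^(-1/t)], with a polynomial factor in [1 / t] that makes the
    family stable under differentiation, also at 0. *)
Definition expinv p (t : R) : R := if 0 < t then p.[t^-1] * expR (- t^-1) else 0.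

(** The exponential bound applied to [X^2 p] gains the factor [t^2]; this quadratic vanishing yields
    the derivative 0 at 0. *)
Lemma expinv_le_sqr p : exists2 M : R, 0 <= M &
  forall t, `|expinv p t| <= M * t ^+ 2.
Proof.
have [M M0 HM] := horner_le_expR ('X^2 * p).
exists M => // t; rewrite /expinv; case: ifPn => t0; last by rewrite normr0 mulr_ge0 ?sqr_ge0.
have := HM t^-1; rewrite hornerM hornerXn [ `|t^-1|]gtr0_norm ?invr_gt0// => H.
rewrite normrM [ `|expR _|]ger0_norm ?expR_ge0// expRN ler_pdivrMr ?expR_gt0//.
rewrite mulrAC -ler_pdivrMr ?exprn_gt0//; apply: le_trans H.
by rewrite normrM -exprVn [ `|t^-1 ^+ 2|]ger0_norm ?sqr_ge0// mulrC.
Qed.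

Lemma is_derive_expinv p (x : R) :
  is_derive x (1 : R) (expinv p) (expinv ('X^2 * (p - p^`())) x).
Proof.
have [x0|x0|x0] := ltgtP x 0.
- rewrite {2}/expinv ltNge (ltW x0) /=.
  apply: (@near_eq_is_derive _ _ _ (cst 0) (expinv p) x 1 0).
  - near=> y; rewrite /expinv ltNge ltW//=.
    by near: y; exact: lt_nbhsl.
- rewrite {2}/expinv x0.
  have : is_derive x (1 : R) (fun t : R => p.[t^-1] * expR (- t^-1)) (('X^2 * (p - p^`())).[x^-1] * expR (- x^-1)); last first.
    apply: near_eq_is_derive.
    near=> y; rewrite /expinv ifT//.
    by near: y; exact: lt_nbhsr.
  have xn0 : x != 0 by rewrite gt_eqF.
  have Hinv : is_derive x (1 : R) (fun t : R => t^-1) (- x ^- 2).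
    apply: (is_derive_eq (@is_deriveV _ id x 1 1 xn0 (is_derive_id _ _))).
    by rewrite [_ *: _]mulr1.
  have H1 := @is_derive_comp1 R _ _ _ x 1 _ _ (is_derive_poly p x^-1) Hinv.
  have H2 := @is_derive_comp1 R _ expR (fun t : R => - t^-1) x 1 _ _
     (is_derive_expR _) (is_deriveN Hinv).
  apply: (is_derive_eq (is_derive_mulf H1 H2)).
  by rewrite hornerM hornerXn hornerD hornerN exprVn; ring.
- subst x; rewrite {2}/expinv ltxx.
  have [M M0 HM] := expinv_le_sqr p.
  have E0 : expinv p 0 = 0 by rewrite /expinv ltxx.
  have H : (fun h : R => h^-1 *: ((expinv p \o shift 0) (h *: 1) - expinv p 0)) @ 0^' --> (0 : R).
    apply/cvgr0Pnorm_le => e e0.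
    near=> h; rewrite E0 subr0 /= addr0 [h%:A]mulr1 normrM.
    have hn0 : h != 0 by near: h; exact: nbhs_dnbhs_neq.
    rewrite (le_trans (ler_wpM2l (normr_ge0 _) (HM h)))//.
    rewrite -[h ^+ 2]real_normK ?num_real// normfV expr2 mulrCA mulKf ?normr_eq0//.
    have : `|h| <= e / (M + 1).
      near: h; apply: dnbhs0_le; rewrite divr_gt0// ltr_wpDl//.
    rewrite ler_pdivlMr ?ltr_wpDl// => h1; apply: le_trans h1.
    by rewrite mulrC ler_wpM2l// lerDl.
  split; first by apply/cvg_ex; exists 0.
  exact/cvg_lim.
Unshelve. all: by end_near. Qed.

Lemma Cbline_expinv k p : Cbline k (expinv p).
Proof.
apply: (@Cbline_closed [set b | exists p, b = expinv p]); last by exists p.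
move=> _ [{}p ->]; split; last first.
  exists (expinv ('X^2 * (p - p^`()))); first by eexists.
  exact: is_derive_expinv.
have [M M0 HM] := horner_le_expR p; exists M => t; rewrite /expinv.
case: ifPn => t0; last by rewrite normr0.
rewrite normrM [ `|expR _|]ger0_norm ?expR_ge0// expRN ler_pdivrMr ?expR_gt0//.
by have := HM t^-1; rewrite [ `|t^-1|]gtr0_norm ?invr_gt0.
Qed.

(** A smooth cutoff supported in [[-1, 1]]; the factor [expR 2] normalises its value at 0 to 1. *)
Definition bump (y : R) : R := expinv (expR 2)%:P (1 - y) * expinv 1 (1 + y).

Lemma Cbline_bump k : Cbline k bump.
Proof.
apply: Cb_mul.
- have := @Cbline_affine k _ (-1) 1 (Cbline_expinv k (expR 2)%:P).
  by congr Cbline; apply/funext => x; rewrite mulN1r addrC.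
- have := @Cbline_affine k _ 1 1 (Cbline_expinv k 1).
  by congr Cbline; apply/funext => x; rewrite mul1r addrC.
Qed.

Lemma bump0 : bump 0 = 1.
Proof.
rewrite /bump /expinv subr0 addr0 ltr01 invr1 !hornerC mul1r -!expRD -expR0.
congr expR; lra.
Qed.

Lemma bump_supp y : 1 <= `|y| -> bump y = 0.
Proof.
rewrite ler_normr => /orP[] H; rewrite /bump /expinv.
  by rewrite subr_gt0 ltNge H mul0r.
by rewrite [in X in _ * X]ifF ?mulr0//; apply/negbTE; rewrite -leNgt; lra.
Qed.

End smooth_line.

(** * Coordinates under the Gaussian product measure *)

Section density_pushforward.
Context d d' (T : measurableType d) (T' : measurableType d') (R : realType).
Variables (P : {measure set T -> \bar R}) (N : {measure set T' -> \bar R}).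
Variables (Y : T -> T') (Z : T -> R) (c : R).
Hypotheses (mY : measurable_fun setT Y) (mZ : measurable_fun setT Z).
Hypothesis Z0 : forall x, 0 <= Z x.
Hypothesis YZ : forall A, measurable A ->
  (\int[P]_(x in Y @^-1` A) (Z x)%:E = c%:E * N A)%E.

Import HBNNSimple.
Local Open Scope ereal_scope.

(** [YZ] says that [c] times [N] is the image under [Y] of the measure with density [Z] for [P];
    simple functions carry this from sets to integrands. With [Z] a product of other coordinates it
    expresses independence, with [Y] the identity it expresses a density. *)
Lemma ge0_integral_density_pushforward (f : T' -> \bar R) :
  measurable_fun setT f -> (forall y, 0 <= f y) ->
  \int[P]_x ((Z x)%:E * f (Y x)) = c%:E * \int[N]_y f y.
Proof.
move=> mf f0; pose h := nnsfun_approx measurableT mf.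
have mpre A : measurable A -> measurable (Y @^-1` A).
  by move=> mA; rewrite -[_ @^-1` _]setTI; exact: mY.
have -> : \int[N]_y f y = lim (\int[N]_y (EFin \o h n) y @[n --> \oo]).
  have fE x : f x = lim ((EFin \o h n) x @[n --> \oo]).
    by apply/esym/cvg_lim => //; apply: cvg_nnsfun_approx => //= y _; exact: f0.
  under eq_integral do rewrite fE.
  apply: monotone_convergence => //.
  - by move=> n; exact/measurable_EFinP.
  - by move=> n x Ex //=; rewrite lee_fin.
  - by move=> x Ex a b ab; rewrite lee_fin; exact/lefP/nd_nnsfun_approx.
have -> : \int[P]_x ((Z x)%:E * f (Y x)) =
    lim (\int[P]_x ((Z x)%:E * (h n (Y x))%:E) @[n --> \oo]).
  have fE x : (Z x)%:E * f (Y x) = lim ((Z x)%:E * (h n (Y x))%:E @[n --> \oo]).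
    apply/esym/cvg_lim => //; apply: cvgeZl => //.
    by apply: cvg_nnsfun_approx => //= y _; exact: f0.
  under eq_integral do rewrite fE.
  apply: monotone_convergence => //.
  - move=> n; apply: emeasurable_funM; apply/measurable_EFinP => //.
    exact: measurableT_comp.
  - by move=> n x Ex //=; rewrite mule_ge0 ?lee_fin.
  - move=> x Ex a b ab; rewrite lee_wpmul2l ?lee_fin//.
    exact/lefP/nd_nnsfun_approx.
rewrite -limeMl//; last first.
  apply: ereal_nondecreasing_is_cvgn => a b ab; apply: ge0_le_integral => //=.
  - by move=> x _; rewrite lee_fin.
  - exact/measurable_EFinP.
  - exact/measurable_EFinP.
  - by move=> x _; rewrite lee_fin; exact/lefP/nd_nnsfun_approx.
congr (limn _); apply/funext => n.
rewrite integralT_nnsfun sintegralE ge0_mule_fsumr; last first.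
  by move=> r; have [r0|r0] := leP 0%R r; [rewrite mule_ge0|rewrite preimage_nnfun0 ?measure0 ?mule0].
under eq_integral.
  move=> x _; rewrite fimfunE -fsumEFin// ge0_mule_fsumr; last first.
    by move=> r; exact: nnfun_muleindic_ge0.
  over.
rewrite ge0_integral_fsum//; last 2 first.
- move=> r; apply: emeasurable_funM; apply/measurable_EFinP => //.
  apply: measurable_funM => //; apply: measurableT_comp => //.
- by move=> r x _; rewrite mule_ge0 ?lee_fin//; exact: nnfun_muleindic_ge0.
apply: eq_fsbigr => r _.
have [r0|r0] := leP 0%R r; last first.
  rewrite preimage_nnfun0 ?measure0 ?mule0//.
  by rewrite integral0_eq// => x _; rewrite indic0 mulr0 mule0.
under eq_integral do rewrite EFinM muleCA.
rewrite ge0_integralZl//; last 2 first.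
- apply: emeasurable_funM; apply/measurable_EFinP => //.
  by apply: measurableT_comp.
- by move=> x _; rewrite mule_ge0 ?lee_fin.
rewrite muleCA -YZ//; congr (_ * _).
rewrite [RHS]integral_mkcond; apply: eq_integral => x _.
rewrite /patch indicE.
rewrite (_ : x \in _ = (Y x \in h n @^-1` [set r])); last by apply/idP/idP; rewrite !inE.
by case: ifP => _; rewrite ?mule1 ?mule0.
Qed.

End density_pushforward.

Section coordinates.
Context {R : realType}.

Lemma measurable_coord i : measurable_fun setT (fun x : Rinf R => x i).
Proof.
move=> _ A mA; rewrite setTI; apply: sub_gen_smallest; exists i => //.
by exists A => //; rewrite setTI.
Qed.

Lemma measurable_Rinf d (T : measurableType d) (g : T -> Rinf R) :
  (forall i, measurable_fun setT (fun x => g x i)) -> measurable_fun setT g.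
Proof.
move=> H; apply: measurability => //.
move=> _ [_ [n _ [A mA <-]] <-]; rewrite [X in g @^-1` X]setTI.
exact: H.
Qed.

End coordinates.

Section gaussian_products.
Context {R : realType} (gamma : probability (Rinf R) R).
Hypothesis hgamma : std_gaussian_power gamma.

Local Notation N := (@normal_prob R 0 1).

(** The hypothesis on [gamma] speaks of rectangles. Their indicators are exchanged for the functions
    [f i] one coordinate at a time, which takes the place of Fubini's theorem. *)
Lemma gamma_integral_prod n (f : nat -> R -> R) (a : nat -> R) :
  (forall i, measurable_fun setT (f i)) -> (forall i y, 0 <= f i y) ->
  (forall i, \int[N]_y (f i y)%:E = (a i)%:E)%E ->
  (\int[gamma]_x (\prod_(i < n) f i (x i))%:E = (\prod_(i < n) a i)%:E)%E.
Proof.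
move=> mf f0 fa.
have a0 i : 0 <= a i by rewrite -lee_fin -fa integral_ge0// => y _; rewrite lee_fin.
(* Stage [k]: the first [k] factors are the functions, the others still indicators. *)
pose F k (A : nat -> set R) i y : R := if (i < k)%N then f i y else \1_(A i) y.
pose b k (A : nat -> set R) i := if (i < k)%N then a i else fine (N (A i)).
have NA (B : set R) : measurable B -> N B \is a fin_num.
  by move=> mB; exact: fin_num_measure.
have mF k A i : (forall i, measurable (A i)) -> measurable_fun setT (F k A i).
  by move=> mA; rewrite /F; case: (i < k)%N; [exact: mf|exact: measurable_indic].
have F0 k A i y : 0 <= F k A i y by rewrite /F; case: ifP.
have b0 k A i : 0 <= b k A i by rewrite /b; case: ifP => // _; rewrite fine_ge0.
suff H k : (k <= n)%N -> forall A, (forall i, measurable (A i)) ->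
    (\int[gamma]_x (\prod_(i < n) F k A i (x i))%:E = (\prod_(i < n) b k A i)%:E)%E.
  have := H n (leqnn n) (fun=> setT) (fun=> measurableT).
  under eq_integral do under eq_bigr => i _ do rewrite /F ltn_ord.
  by move=> ->; congr EFin; apply: eq_bigr => i _; rewrite /b ltn_ord.
elim: k => [_ A mA|k IH kn A mA].
  transitivity (gamma [set x : Rinf R | forall i, (i < n)%N -> A i (x i)]).
    rewrite -(setIT [set _ | _]) -integral_indic//; last first.
      rewrite (_ : [set _ | _] = \bigcap_(i in [set i | (i < n)%N])
        ((fun x : Rinf R => x i) @^-1` A i)).
        apply: bigcap_measurableType => i _; rewrite -[_ @^-1` _]setTI.
        exact: measurable_coord.
      by apply/seteqP; split => x /=.
    apply: eq_integral => x _; congr EFin; rewrite /F /=.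
    rewrite indicE; case: (boolP (x \in _)) => [/set_mem H|/negP H].
      by rewrite big1// => i _; rewrite indicE mem_set//; exact: H.
    have [i /negP Hi] : exists i : 'I_n, ~~ (x i \in A i).
      apply: contrapT => /forallNP Hx; apply: H; apply/mem_set => i ni.
      by have /negP := Hx (Ordinal ni); rewrite negbK => /set_mem.
    by rewrite (bigD1 i)//= indicE; case: (_ \in _) Hi => // _; rewrite mul0r.
  rewrite hgamma// -prodEFin; apply: eq_bigr => i _.
  rewrite /b ltn0 fineK; first reflexivity.
  exact: NA.
have kE : (Ordinal kn : nat) = k by [].
under eq_integral do rewrite (bigD1 (Ordinal kn))//= {1}/F ltnSn mulrC EFinM.
(* Stage [k] with an arbitrary set [A'] at coordinate [k] gives the law of that coordinate weighted
   by the other factors. *)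
pose B (A' : set R) i := if i == k then A' else A i.
have mB A' : measurable A' -> forall i, measurable (B A' i).
  by move=> mA' i; rewrite /B; case: eqP.
have FB A' (i : 'I_n) x : i != Ordinal kn -> F k.+1 A i x = F k (B A') i x.
  rewrite -val_eqE /= /F /B ltnS leq_eqVlt => /negbTE ik.
  by rewrite ik.
have bB A' (i : 'I_n) : i != Ordinal kn -> b k.+1 A i = b k (B A') i.
  rewrite -val_eqE /= /b /B ltnS leq_eqVlt => /negbTE ik.
  by rewrite ik.
have FBk A' y : F k (B A') k y = \1_A' y by rewrite /F ltnn /B eqxx.
have bBk A' : b k (B A') k = fine (N A') by rewrite /b ltnn /B eqxx.
rewrite (@ge0_integral_density_pushforward _ _ _ _ R gamma N (fun x : Rinf R => x k)
  (fun x => \prod_(i < n | i != Ordinal kn) F k.+1 A i (x i))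
  (\prod_(i < n | i != Ordinal kn) b k.+1 A i) _ _ _ _ (fun y => (f k y)%:E)).
- rewrite fa [in RHS](bigD1 (Ordinal kn))//= (_ : b k.+1 A k = a k).
    by rewrite mulrC.
  by rewrite /b ltnSn.
- exact: measurable_coord.
- rewrite (_ : (fun x : Rinf R => _) = (fun x : Rinf R => \prod_(i < n)
      if i != Ordinal kn then F k.+1 A i (x i) else 1)); last first.
    by apply/funext => x; rewrite big_mkcond.
  apply: measurable_prod => i _; case: (i != _); last exact: measurable_cst.
  by apply: (measurableT_comp (mF _ _ _ mA)); exact: measurable_coord.
- by move=> x; apply: prodr_ge0.
- move=> A' mA'; have := IH (ltnW kn) _ (mB _ mA').
  rewrite [in X in _ = X -> _](bigD1 (Ordinal kn))//= bBk -(eq_bigr _ (bB A')).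
  rewrite EFinM fineK ?NA// muleC => <-.
  rewrite integral_mkcond; apply: eq_integral => x _.
  rewrite [in RHS](bigD1 (Ordinal kn))//= FBk.
  rewrite -(eq_bigr _ (fun i => FB A' i _)) /patch indicE.
  rewrite (_ : x \in _ = (x k \in A')); last by apply/idP/idP; rewrite !inE.
  by case: ifP => _; rewrite ?mul1r ?mul0r.
- by apply/measurable_EFinP; exact: mf.
- by move=> y; rewrite lee_fin.
Qed.

End gaussian_products.

(** * The standard Gaussian distribution function *)

Section gaussian_line.
Context {R : realType}.
Implicit Types (x y z w : R).

Local Notation N := (@normal_prob R 0 1).
Local Notation pdf := (@normal_pdf R 0 1).
Local Notation leb := (@lebesgue_measure R).

Lemma normal01_pdfE y : pdf y = normal_peak 1 * expR (- (y ^+ 2 / 2)).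
Proof.
rewrite normal_pdfE ?oner_neq0// /normal_fun subr0 expr1n.
by congr (_ * expR _); rewrite mulNr.
Qed.

Lemma ge0_integral_normal01 (f : R -> \bar R) :
  measurable_fun setT f -> (forall y, 0 <= f y)%E ->
  (\int[N]_y f y = \int[leb]_y ((pdf y)%:E * f y))%E.
Proof.
move=> mf f0; rewrite -[LHS]mul1e.
rewrite -(@ge0_integral_density_pushforward _ _ _ _ R leb N id pdf 1)//.
- exact: measurable_normal_pdf.
- by move=> y; exact: normal_pdf_ge0.
- by move=> A mA; rewrite mul1e.
Qed.

(** Completing the square turns the integrand into [e^(w^2/2)] times the normal density of mean
    [w]. *)
Lemma integral_normal01_expR w : (\int[N]_y (expR (w * y))%:E = (expR (w ^+ 2 / 2))%:E)%E.
Proof.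
rewrite ge0_integral_normal01; last by move=> y; rewrite lee_fin expR_ge0.
  transitivity (\int[leb]_y ((expR (w ^+ 2 / 2))%:E * (normal_pdf w 1 y)%:E))%E.
    apply: eq_integral => y _; rewrite -!EFinM; congr EFin.
    rewrite normal01_pdfE normal_pdfE ?oner_neq0// /normal_fun expr1n.
    rewrite mulrCA -!mulrA -!expRD; congr (_ * expR _); by field.
  rewrite ge0_integralZl//.
  - by rewrite integral_normal_pdf mule1.
  - by apply/measurable_EFinP; exact: measurable_normal_pdf.
  - by move=> y _; rewrite lee_fin normal_pdf_ge0.
apply/measurable_EFinP; apply: measurableT_comp => //; exact: measurable_funM.
Qed.

Definition Phi z : R := \int[leb]_(t in `]-oo, z]) pdf t.

Lemma PhiE z : N `]-oo, z] = (Phi z)%:E.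
Proof.
rewrite /Phi /Rintegral fineK//.
by apply: (@fin_num_measure _ _ R N).
Qed.

Lemma Phi_ge0 z : 0 <= Phi z.
Proof. by rewrite -lee_fin -PhiE. Qed.

Lemma Phi_le1 z : Phi z <= 1.
Proof. by rewrite -lee_fin -PhiE; apply: (@probability_le1 _ _ R N). Qed.

Lemma is_derive_Phi z : is_derive z (1 : R) Phi (pdf z).
Proof.
have [] := @continuous_FTC1 R pdf -oo%O z (z + 1) _ _ _ _.
- by rewrite ltrDl.
- apply: (integrableS measurableT) => //; exact: integrable_normal_pdf.
- by rewrite ltNyr.
- by apply: continuous_normal_pdf; rewrite oner_neq0.
by move=> dP <-; split; [exact: dP|rewrite derive1E].
Qed.

(** The identity is made a random variable under the normal law, so that the limits of distribution
    functions apply to [Phi]. *)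
Let idR : measurableTypeR R -> R := idfun.

#[local] HB.instance Definition _ :=
  @isMeasurableFun.Build _ _ _ _ idR (@measurable_id _ _ setT).

Let NP : probability (measurableTypeR R) R := N.

Lemma cvg_PhiNy : Phi z @[z --> -oo] --> 0.
Proof.
have := @cvg_cdfNy0 _ _ _ NP idR.
rewrite (_ : cdf (P := NP) idR = EFin \o Phi); first by move=> /fine_cvgP[].
by apply/funext => z /=; rewrite -PhiE.
Qed.

Lemma cvg_Phiy : Phi z @[z --> +oo] --> (1 : R).
Proof.
have := @cvg_cdfy1 _ _ _ NP idR.
rewrite (_ : cdf (P := NP) idR = EFin \o Phi); first by move=> /fine_cvgP[].
by apply/funext => z /=; rewrite -PhiE.
Qed.

Lemma normr_le_expR y : `|y| <= expR y + expR (- y).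
Proof.
have := expR_ge1Dx y; have := expR_ge1Dx (- y).
have := expR_gt0 y; have := expR_gt0 (- y).
by case: (ger0P y) => ? ? ? ? ?; lra.
Qed.

Lemma integrable_expR_pdf w : leb.-integrable setT (fun y => (expR (w * y) * pdf y)%:E).
Proof.
apply/integrableP; split.
  apply/measurable_EFinP; apply: measurable_funM; last exact: measurable_normal_pdf.
  by apply: measurableT_comp => //; exact: measurable_funM.
under eq_integral do rewrite gee0_abs ?lee_fin ?mulr_ge0 ?expR_ge0 ?normal_pdf_ge0// mulrC EFinM.
rewrite -ge0_integral_normal01; first by rewrite integral_normal01_expR ltry.
- apply/measurable_EFinP; apply: measurableT_comp => //; exact: measurable_funM.
- by move=> y; rewrite lee_fin expR_ge0.
Qed.

Lemma integrable_id_pdf : leb.-integrable setT (fun y => (y * pdf y)%:E).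
Proof.
apply: (@le_integrable _ _ R leb setT measurableT _
  (fun y => (expR (1 * y) * pdf y)%:E + (expR ((-1) * y) * pdf y)%:E)%E).
- apply/measurable_EFinP; apply: measurable_funM => //; exact: measurable_normal_pdf.
- move=> y _; rewrite -EFinD !abse_EFin lee_fin mul1r mulN1r -mulrDl.
  rewrite [leRHS]ger0_norm ?mulr_ge0 ?addr_ge0 ?expR_ge0 ?normal_pdf_ge0//.
  by rewrite normrM [ `|pdf y|]ger0_norm ?normal_pdf_ge0// ler_wpM2r ?normal_pdf_ge0// normr_le_expR.
- apply: integrableD => //; exact: integrable_expR_pdf.
Qed.

(** The density has derivative [- t * pdf t], so the integral plus the density is constant in [z];
    the constant is 0 because both terms decay like [e^x] at [-oo]. *)
Lemma Rintegral_id_pdf z : \int[leb]_(t in `]-oo, z]) (t * pdf t) = - pdf z.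
Proof.
pose M z := \int[leb]_(t in `]-oo, z]) (t * pdf t).
have dM x : is_derive x (1 : R) M (x * pdf x).
  have [] := @continuous_FTC1 R (fun t => t * pdf t) -oo%O x (x + 1) _ _ _ _.
  - by rewrite ltrDl.
  - apply: (integrableS measurableT) => //; exact: integrable_id_pdf.
  - by rewrite ltNyr.
  - apply: continuousM; first exact: cvg_id.
    by apply: continuous_normal_pdf; rewrite oner_neq0.
  by move=> dP <-; split; [exact: dP|rewrite derive1E].
have dpdf x : is_derive x (1 : R) pdf (- (x * pdf x)).
  rewrite (_ : pdf = (fun y => normal_peak 1 * expR (- (y ^+ 2 / 2)))); last first.
    by apply/funext => y; exact: normal01_pdfE.
  apply: (is_derive_eq (is_derive_scalef _ (is_derive_gauss x))).
  by rewrite mulNr mulrN mulrCA.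
have cst x : M x + pdf x = M z + pdf z.
  apply: (is_derive_0_is_cst (f := fun x => M x + pdf x)) => t.
  by apply: (is_derive_eq (is_derive_addf (dM t) (dpdf t))); rewrite subrr.
(* For [t <= x <= 0] one has [|t| <= e^(-t) <= e^x e^(-2t)], and the Gaussian integral of [e^(-2t)]
   is [e^2]. *)
have bM x : x <= 0 -> `|M x| <= expR x * expR 2.
  move=> x0; rewrite /M.
  have mI : measurable (`]-oo, x]%classic : set (measurableTypeR R)) by [].
  have I1 : leb.-integrable `]-oo, x] (fun y => (y * pdf y)%:E).
    apply: (integrableS measurableT) => //; exact: integrable_id_pdf.
  have I2 : leb.-integrable `]-oo, x] (fun y => (expR x * (expR ((-2) * y) * pdf y))%:E).
    apply: (integrableS measurableT) => //; under eq_fun do rewrite EFinM.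
    apply: integrableZl => //; exact: integrable_expR_pdf.
  rewrite (le_trans (le_normr_Rintegral mI I1))//.
  rewrite (le_trans (@le_Rintegral _ _ R leb _ _
    (fun y => expR x * (expR ((-2) * y) * pdf y)) mI _ I2 _))//.
  - exact: (integrable_norm I1).
  - move=> t /=; rewrite in_itv /= => tx.
    rewrite normrM [ `|pdf t|]ger0_norm ?normal_pdf_ge0// mulrA ler_wpM2r ?normal_pdf_ge0//.
    have t0 : t <= 0 by exact: le_trans x0.
    rewrite ler0_norm// -expRD.
    apply: (@le_trans _ _ (expR (- t))); first by have := expR_ge1Dx (- t); lra.
    rewrite ler_expR; lra.
  - rewrite RintegralZl//; last first.
      apply: (integrableS measurableT) => //; exact: integrable_expR_pdf.
    rewrite ler_wpM2l ?expR_ge0//.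
    have E2 : (\int[leb]_t (expR (-2 * t) * pdf t)%:E = (expR 2)%:E)%E.
      transitivity (\int[N]_y (expR ((-2) * y))%:E)%E.
        rewrite ge0_integral_normal01.
        - by apply: eq_integral => y _; rewrite mulrC EFinM.
        - apply/measurable_EFinP; apply: measurableT_comp => //; exact: measurable_funM.
        - by move=> y; rewrite lee_fin expR_ge0.
      by rewrite integral_normal01_expR; congr (expR _)%:E; field.
    rewrite -lee_fin -E2 /Rintegral fineK; last first.
      apply: integrable_fin_num => //.
      apply: (integrableS measurableT) => //; exact: integrable_expR_pdf.
    apply: ge0_subset_integral => //.
    + apply/measurable_EFinP; apply: measurable_funM; last exact: measurable_normal_pdf.
      by apply: measurableT_comp => //; exact: measurable_funM.
    + by move=> y _; rewrite lee_fin mulr_ge0 ?expR_ge0 ?normal_pdf_ge0.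
have bpdf x : pdf x <= expR x * (normal_peak 1 * expR 1).
  rewrite normal01_pdfE mulrCA ler_wpM2l ?normal_peak_ge0// -expRD ler_expR.
  by have := sqr_ge0 (x + 1); nra.
set K := M z + pdf z in cst.
suff K0 : K = 0 by apply/eqP; rewrite -addr_eq0; apply/eqP.
pose C : R := expR 2 + normal_peak 1 * expR 1.
have C0 : 0 < C by rewrite ltr_wpDr ?expR_gt0// mulr_ge0 ?expR_ge0 ?normal_peak_ge0.
apply/eqP; rewrite -normr_le0; apply/ler_addgt0Pl => e e0; rewrite addr0.
(* Far enough to the left that [C e^x <= e]. *)
pose x := Num.min 0 (ln (e / C)).
have x0 : x <= 0 by rewrite ge_min lexx.
rewrite -(cst x) (le_trans (ler_normD _ _))//.
rewrite [ `|pdf x|]ger0_norm ?normal_pdf_ge0//.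
rewrite (le_trans (lerD (bM x x0) (bpdf x)))// -mulrDr -/C -ler_pdivlMr//.
rewrite -[leRHS]lnK ?posrE ?divr_gt0// ler_expR ge_min lexx orbT//.
Qed.


(** The first moment over a half-line is kept as two nonnegative integrals because product
    integration under [gamma] takes nonnegative factors. *)
Lemma integral_lower_moment z : exists a b : R,
  [/\ (\int[N]_y (Num.max y 0 * (y <= z)%R%:R)%:E = a%:E)%E,
      (\int[N]_y (Num.max (- y) 0 * (y <= z)%R%:R)%:E = b%:E)%E & a - b = - pdf z].
Proof.
have mle : measurable_fun setT (fun y : R => (y <= z)%R%:R : R).
  rewrite (_ : (fun y => _) = \1_(`]-oo, z]%classic)).
    by apply: measurable_indic.
  by apply/funext => y; rewrite indicE mem_setE in_itv.
have mf (s : R) : measurable_fun setT (fun y => (Num.max (s * y) 0 * (y <= z)%R%:R)).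
  apply: measurable_funM => //; apply: measurable_maxr => //.
have f0 (s : R) y : 0 <= Num.max (s * y) 0 * (y <= z)%R%:R.
  by rewrite mulr_ge0// le_max lexx orbT.
have If (s : R) : `|s| = 1 ->
    leb.-integrable setT (fun y => (pdf y * (Num.max (s * y) 0 * (y <= z)%R%:R))%:E).
  move=> s1; apply: (le_integrable _ _ _ integrable_id_pdf) => //.
    apply/measurable_EFinP; apply: measurable_funM; [exact: measurable_normal_pdf|exact: mf].
  move=> y _; rewrite !abse_EFin lee_fin mulrC !normrM ler_wpM2r//.
  rewrite -[leRHS]mulr1 ler_pM//; last by case: (y <= z); rewrite ?normr1 ?normr0.
  rewrite ger0_norm ?le_max ?lexx ?orbT// ge_max normr_ge0 andbT.
  by rewrite (le_trans (ler_norm _))// normrM s1 mul1r.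
have IE (s : R) : `|s| = 1 -> (\int[N]_y (Num.max (s * y) 0 * (y <= z)%R%:R)%:E =
    (\int[leb]_y (pdf y * (Num.max (s * y) 0 * (y <= z)%R%:R)))%:E)%E.
  move=> s1; rewrite ge0_integral_normal01; last by move=> y; rewrite lee_fin.
    rewrite /Rintegral fineK//; exact: integrable_fin_num (If _ s1).
  exact/measurable_EFinP.
have n1 : `|1 : R| = 1 by rewrite normr1.
have nN1 : `|-1 : R| = 1 by rewrite normrN1.
exists (\int[leb]_y (pdf y * (Num.max (1 * y) 0 * (y <= z)%R%:R))).
exists (\int[leb]_y (pdf y * (Num.max (-1 * y) 0 * (y <= z)%R%:R))); split.
- by rewrite -IE//; apply: eq_integral => y _; rewrite mul1r.
- by rewrite -IE//; apply: eq_integral => y _; rewrite mulN1r.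
rewrite -RintegralB//; [|exact: If..].
rewrite -Rintegral_id_pdf [RHS]Rintegral_mkcond; apply: eq_Rintegral => y _.
rewrite /patch mem_setE in_itv /= mul1r mulN1r; case: (y <= z).
  by rewrite !mulr1 -mulrBr mulrC; congr (_ * _); case: (ltrgtP y 0) => H;
    rewrite /Num.max ?H; case: ifPn; lra.
by rewrite !mulr0 subrr.
Qed.

End gaussian_line.

(** * Integration by parts for cylindrical functions *)

Section finite_sums.
Context {R : realType}.

Lemma cauchy_schwarz_sum n (a b : 'I_n -> R) :
  (\sum_i a i * b i) ^+ 2 <= (\sum_i a i ^+ 2) * (\sum_i b i ^+ 2).
Proof.
set S := \sum_i a i * b i; set A := \sum_i a i ^+ 2; set D := \sum_i b i ^+ 2.
have D0 : 0 <= D by apply: sumr_ge0 => i _; exact: sqr_ge0.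
have [DE|Dn0] := eqVneq D 0.
  have b0 i : b i = 0.
    move: (DE) => /eqP; rewrite psumr_eq0; last by move=> j _; exact: sqr_ge0.
    by move=> /allP /(_ i (mem_index_enum _)); rewrite sqrf_eq0 => /eqP.
  by rewrite DE mulr0 /S big1 ?expr0n// => i _; rewrite b0 mulr0.
have Dp : 0 < D by rewrite lt_neqAle eq_sym Dn0.
have : 0 <= \sum_i (D * a i - S * b i) ^+ 2 by apply: sumr_ge0 => i _; exact: sqr_ge0.
have -> : \sum_i (D * a i - S * b i) ^+ 2 = D * (A * D - S ^+ 2).
  transitivity (\sum_i (D ^+ 2 * a i ^+ 2 + (- (2 * D * S)) * (a i * b i) + S ^+ 2 * b i ^+ 2)).
    by apply: eq_bigr => i _; ring.
  rewrite !big_split /= -!mulr_sumr -/A -/S -/D; ring.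
by rewrite pmulr_rge0// subr_ge0.
Qed.

Lemma normH_ge0 (h : nat -> R) : 0 <= normH h.
Proof. exact: sqrtr_ge0. Qed.

Lemma sum_sqr_le_normH (h : nat -> R) n : in_l2 h ->
  \sum_(i < n) h i ^+ 2 <= normH h ^+ 2.
Proof.
move=> hl; rewrite /normH sqr_sqrtr; last first.
  apply: limr_ge => //; apply: nearW => m; rewrite /series /=.
  by apply: sumr_ge0 => i _; exact: sqr_ge0.
rewrite -(big_mkord xpredT (fun i => h i ^+ 2)).
apply: (nondecreasing_cvgn_le _ hl n).
by apply: nondecreasing_series => k _ _; exact: sqr_ge0.
Qed.

Lemma inner_le_normH (h : nat -> R) n (d : 'I_n -> R) B : in_l2 h -> 0 <= B ->
  \sum_i d i ^+ 2 <= B ^+ 2 -> `|\sum_(i < n) h i * d i| <= normH h * B.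
Proof.
move=> hl B0 dB; rewrite -(ler_pXn2r (n := 2))// ?nnegrE ?mulr_ge0 ?normH_ge0//.
rewrite real_normK ?num_real// exprMn (le_trans (cauchy_schwarz_sum _ _))//.
apply: ler_pM => //; try by apply: sumr_ge0 => i _; exact: sqr_ge0.
exact: sum_sqr_le_normH.
Qed.

Lemma coord_le_normH (h : nat -> R) i : in_l2 h -> `|h i| <= normH h.
Proof.
move=> hl; rewrite -(ler_pXn2r (n := 2))// ?nnegrE ?normH_ge0//.
rewrite real_normK ?num_real// (le_trans _ (sum_sqr_le_normH i.+1 hl))//.
by rewrite big_ord_recr /= lerDr sumr_ge0// => j _; exact: sqr_ge0.
Qed.

Lemma innerH_fin (h k : nat -> R) n : (forall i, (n <= i)%N -> k i = 0) ->
  innerH h k = \sum_(i < n) h i * k i.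
Proof.
move=> k0; rewrite /innerH; apply/cvg_lim => //.
apply: (@cvg_near_cst _ _ _ _ \oo).
near=> m; have nm : (n <= m)%N by near: m; exact: nbhs_infty_ge.
rewrite /series /= (big_cat_nat _ nm)//=.
rewrite [X in _ + X](_ : _ = 0) ?addr0 ?big_mkord//.
rewrite big_nat_cond big1// => i.
by rewrite andbT => /andP[ni _]; rewrite k0 ?mulr0.
Unshelve. all: by end_near. Qed.

End finite_sums.

Section cylinder.
Context {R : realType} {n : nat}.
Implicit Types (f : 'rV[R]_n -> R).

Definition rowof (x : Rinf R) : 'rV[R]_n := \row_(i < n) x i.
Definition basis (i : 'I_n) : 'rV[R]_n := delta_mx 0 i.

Lemma rowof_shift (x : Rinf R) (t : R) (i : nat) (ni : (i < n)%N) :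
  rowof (fun k : nat => x k + t *+ (k == i)) = t *: basis (Ordinal ni) + rowof x.
Proof.
apply/rowP => j; rewrite !mxE eqxx /= -val_eqE /= addrC.
by case: (_ == _); rewrite ?mulr1n ?mulr0n ?mulr1 ?mulr0.
Qed.

Lemma partialE f (df : 'rV[R]_n -> R) (i : 'I_n) x :
  (forall y, is_derive y (basis i) f (df y)) ->
  partial i (fun x => f (rowof x)) x = df (rowof x).
Proof.
move=> /(_ (rowof x)) /is_derive_line Hd; rewrite /partial derive1E.
rewrite (_ : (fun t => _) = (fun h : R => f (h *: basis i + rowof x))).
  by case: Hd.
apply/funext => t; rewrite (rowof_shift x t (ltn_ord i)).
by rewrite (_ : Ordinal _ = i)//; exact: val_inj.
Qed.

Lemma partial_out f i x : (n <= i)%N -> partial i (fun x => f (rowof x)) x = 0.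
Proof.
move=> ni; rewrite /partial derive1E (_ : (fun t : R => _) = cst (f (rowof x))).
  by rewrite derive_cst.
apply/funext => t; congr f; apply/rowP => j; rewrite !mxE.
by rewrite ltn_eqF ?mulr0n ?addr0// (leq_trans (ltn_ord j)).
Qed.

Lemma smooth_bounded_Cb f : (forall k, Cb basis k f) -> smooth_bounded f.
Proof.
(* [foldr] differentiates along the last index first, hence the induction from the end of the
   list. *)
move=> + s; elim/last_ind: s f => [|s i IH] f Hf.
  split => /=.
  - by move=> i x; have /Cb_SE[_ [df [Hd _]]] := Hf 1%N; case: (Hd i x).
  - exact: Cb_cont (Hf 0%N).
  - have [M HM] := Cb_bound (Hf 0%N).
    exists M; split; first exact: num_real.
    by move=> y My x _; exact: le_trans (HM x) (ltW My).
have -> : iter_partial (rcons s i) f = iter_partial s ('D_(basis i) f).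
  by rewrite /iter_partial foldr_rcons.
apply: IH => k; have /Cb_SE[_ [df [Hd Hk]]] := Hf k.+1.
rewrite (_ : 'D_(basis i) f = df i)//.
by apply/funext => x; case: (Hd i x).
Qed.

Lemma is_derive_prod_coord (B dB : R -> R) (F : 'I_n -> R -> R)
    (i : 'I_n) (x : 'rV[R]_n) :
  is_derive (x 0 i) (1 : R) B (dB (x 0 i)) ->
  is_derive x (basis i) (fun y => B (y 0 i) * \prod_(j < n | j != i) F j (y 0 j))
    (dB (x 0 i) * \prod_(j < n | j != i) F j (x 0 j)).
Proof.
move=> HB; apply/is_derive_line.
have -> : (fun h : R => B ((h *: basis i + x) 0 i) *
     \prod_(j < n | j != i) F j ((h *: basis i + x) 0 j)) =
   (fun h : R => (\prod_(j < n | j != i) F j (x 0 j)) * B (h + x 0 i)).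
  apply/funext => h; rewrite !mxE !eqxx mulr1 mulrC; congr (_ * _).
  by apply: eq_bigr => j ji; rewrite !mxE (negbTE ji) andbF mulr0 add0r.
rewrite mulrC; apply: is_derive_scalef.
have := @is_derive1_comp R B (fun h : R => h + x 0 i) 0 (dB (x 0 i)) 1.
rewrite add0r mulr1; apply => //.
apply: (is_derive_eq (is_derive_addf (is_derive_id _ _) (is_derive_cst _ _ _))).
by rewrite addr0.
Qed.

(** The derivative is a limit of difference quotients along [1 / (k + 1)]. The shift of a coordinate
    is performed in [Rinf R], so measurability on row vectors never enters. *)
Lemma measurable_derive_rowof f (df : 'rV[R]_n -> R) (i : 'I_n) :
  (forall y, is_derive y (basis i) f (df y)) ->
  measurable_fun setT (fun x : Rinf R => f (rowof x)) ->
  measurable_fun setT (fun x : Rinf R => df (rowof x)).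
Proof.
move=> Hd mf; pose t (k : nat) : R := k.+1%:R^-1.
pose D k (x : Rinf R) := (t k)^-1 * (f (t k *: basis i + rowof x) - f (rowof x)).
apply: (measurable_fun_cvg (h := D)).
  move=> k; apply: measurable_funM; first exact: measurable_cst.
  apply: measurable_funB => //.
  rewrite (_ : (fun x => _) = (fun x : Rinf R => f (rowof x)) \o
    (fun x : Rinf R => ((fun l : nat => x l + t k *+ (l == i)) : Rinf R))).
    apply: measurableT_comp => //; apply: measurable_Rinf => l.
    by apply: measurable_funD; [exact: measurable_coord|exact: measurable_cst].
  apply/funext => x /=; rewrite (rowof_shift x (t k) (ltn_ord i)).
  by rewrite (_ : Ordinal _ = i)//; exact: val_inj.
move=> x _; case: (Hd (rowof x)) => dx dE.
have : (fun h : R => h^-1 *: ((f \o shift (rowof x)) (h *: basis i) - f (rowof x))) @ 0^'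
   --> df (rowof x) by rewrite -dE; exact: dx.
move=> /cvgr_dnbhsP; apply; split; last exact: cvg_harmonic.
by move=> k; rewrite gt_eqF// invr_gt0 ltr0n.
Qed.

End cylinder.

Section bump_derivatives.
Context {R : realType}.

(** The last bound holds because [db] vanishes off [[-1, 1]]; being invariant under scaling of the
    cutoff, it will absorb the unbounded coefficient [x i] of the Ornstein-Uhlenbeck operator. *)
Lemma bump_bounds : exists (db ddb : R -> R) (K : R),
  [/\ forall y, is_derive y (1 : R) bump (db y),
      forall y, is_derive y (1 : R) db (ddb y),
      1 <= K & forall y : R, [/\ `|bump y| <= K, `|db y| <= K, `|ddb y| <= K
        & `|y * db y| <= K]].
Proof.
have := @Cbline_bump R 2; rewrite /Cbline => /Cb_SE[b0 [db0 [Hdb Cdb]]].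
have /Cb_SE[d0 [ddb0 [Hddb Cddb]]] := Cdb tt; have dd0 := Cddb tt.
have [M0 HM0] := Cb_bound b0; have [M1 HM1] := Cb_bound d0; have [M2 HM2] := Cb_bound dd0.
pose K := 1 + `|M0| + `|M1| + `|M2|.
have KM : [/\ 1 <= K, M0 <= K, M1 <= K & M2 <= K].
  have := ler_norm M0; have := ler_norm M1; have := ler_norm M2.
  have := normr_ge0 M0; have := normr_ge0 M1; have := normr_ge0 M2.
  by rewrite /K => *; split; lra.
case: KM => K1 K2 K3 K4; exists (db0 tt), (ddb0 tt), K; split => //.
move=> y; split; try exact: le_trans (HM0 y) _; try exact: le_trans (HM1 y) _;
  try exact: le_trans (HM2 y) _.
have [y1|y1] := leP `|y| 1.
  rewrite normrM (le_trans (ler_wpM2r (normr_ge0 _) y1))// mul1r.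
  exact: le_trans (HM1 y) _.
suff -> : db0 tt y = 0 by rewrite mulr0 normr0 (le_trans ler01).
have [_ <-] := Hdb tt y.
have H0 : is_derive y (1 : R) (cst (0 : R)) 0 by exact: is_derive_cst.
suff [_ ->] : is_derive y (1 : R) (bump : R -> R) 0 by [].
apply: near_eq_is_derive H0; near=> z; rewrite /= bump_supp//.
have : 1 < `|z|; last exact: ltW.
near: z; apply: (@cvgr_norm_gt _ _ _ (nbhs y) _ id y) => //; exact: cvg_id.
Unshelve. all: by end_near. Qed.

End bump_derivatives.

Section integration_by_parts.
Context {R : realType} (v : Rinf R -> Rinf R) (mu : probability (Rinf R) R).
Hypotheses (hv_meas : measurable_fun setT v) (hv_l2 : forall x, in_l2 (v x)).
Hypothesis hv_L1 : mu.-integrable setT (fun x => (normH (v x))%:E).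
Hypothesis hmu : forall (n : nat) (phi : Rinf R -> R), FC0 n phi ->
  (\int[mu]_x (drift_OU v n phi x)%:E = 0)%E.
Context {n : nat}.
Local Notation basis := (@basis R n).
Local Notation rowof := (@rowof R n).

Lemma measurable_v i : measurable_fun setT (fun x => v x i).
Proof.
rewrite (_ : (fun x => _) = (fun y : Rinf R => y i) \o v)//.
by apply: measurableT_comp => //; exact: measurable_coord.
Qed.

Lemma drift_eq_compact_support (f : 'rV[R]_n -> R) (df : 'I_n -> 'rV[R]_n -> R)
    (ddf : 'I_n -> 'rV[R]_n -> R) :
  (forall k, Cb basis k f) -> compact_support f ->
  (forall i x, is_derive x (basis i) f (df i x)) ->
  (forall i x, is_derive x (basis i) (df i) (ddf i x)) ->
  (\int[mu]_x (\sum_(i < n) (ddf i (rowof x) - x i * df i (rowof x))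
      + \sum_(i < n) v x i * df i (rowof x))%:E = 0)%E.
Proof.
move=> Hf cf Hd Hdd; rewrite -(hmu (n := n) (phi := fun x => f (rowof x))).
  apply: eq_integral => x _; congr EFin; rewrite /drift_OU /OU; congr (_ + _).
    apply: eq_bigr => i _; rewrite (partialE x (Hd i)).
    rewrite (_ : partial i (fun x => f (rowof x)) = (fun x => df i (rowof x))); last first.
      by apply/funext => y; exact: partialE.
    by rewrite (partialE x (Hdd i)).
  rewrite (@innerH_fin _ _ _ n).
    by apply: eq_bigr => i _; rewrite /gradH (partialE x (Hd i)).
  by move=> i ni; rewrite /gradH partial_out.
by exists f; split => //; exact: smooth_bounded_Cb.
Qed.

Lemma compact_support_box (f : 'rV[R]_n -> R) (M : R) :
  (forall x, f x != 0 -> forall i, `|x 0 i| <= M) -> compact_support f.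
Proof.
move=> H; pose box := [set x : 'rV[R]_n | forall i, `|x 0 i| <= M].
have cl : closed box.
  rewrite (_ : box = \bigcap_(i in [set: 'I_n])
    ((fun x : 'rV[R]_n => x 0 i) @^-1` [set y | `|y| <= M])); last first.
    by apply/seteqP; split => x /= Hx; [move=> i _; exact: Hx|move=> i; exact: Hx].
  apply: closed_bigI => i _; apply: preimage_closed.
    by move=> x _; exact: coord_continuous.
  rewrite (_ : [set y | `|y| <= M] = (fun y : R => `|y|) @^-1` [set z | z <= M])//.
  apply: preimage_closed; last exact: closed_le.
  by move=> x _; exact: norm_continuous.
have co : compact [set x : 'rV[R]_n | forall i, `[-M, M]%classic (x ord0 i)].
  exact: (rV_compact (fun=> @segment_compact R (- M) M)).
rewrite /compact_support; apply: (subclosed_compact _ co); first exact: closed_closure.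
move=> x Hx.
suff : box x by move=> b i; have := b i; rewrite /= in_itv /= ler_norml.
by rewrite ((closure_id _).1 cl); apply: closure_subset Hx => y /= /H.
Qed.

Lemma norm4_le (a b c d A B C D : R) :
  `|a| <= A -> `|b| <= B -> `|c| <= C -> `|d| <= D ->
  `|a + 2 * b - c + d| <= A + 2 * B + C + D.
Proof.
rewrite !ler_norml => /andP[? ?] /andP[? ?] /andP[? ?] /andP[? ?].
by apply/andP; split; lra.
Qed.

Lemma Cb_coord_bound (f : 'rV[R]_n -> R) (df : 'I_n -> 'rV[R]_n -> R) :
  Cb basis 1 f -> (forall i x, is_derive x (basis i) f (df i x)) ->
  exists2 B : R, 0 <= B & forall x, `|f x| <= B /\ forall i, `|df i x| <= B.
Proof.
move=> /Cb_SE[/Cb_bound[M HM] [df' [Hd' Cd]]] Hd.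
have /choice[N HN] : forall i, exists N : R, forall x, `|df i x| <= N.
  move=> i.
  have [N HN] := Cb_bound (Cd i); exists N => x.
  by have [_ <-] := Hd i x; have [_ ->] := Hd' i x.
exists (`|M| + \sum_i `|N i|); first by rewrite addr_ge0 ?sumr_ge0.
move=> x; split.
  by rewrite (le_trans (HM x))// ler_wpDr ?sumr_ge0// ler_norm.
move=> i; rewrite (le_trans (HN i x))// ler_wpDl// (bigD1 i)//= ler_wpDr ?sumr_ge0//.
exact: ler_norm.
Qed.

Lemma prod_norm_le (P : pred 'I_n) (F : 'I_n -> R) K : 1 <= K ->
  (forall i, `|F i| <= K) -> `|\prod_(i | P i) F i| <= K ^+ n.
Proof.
move=> K1 HF; rewrite normr_prod -[X in _ <= _ ^+ X]card_ord -prodr_const big_mkcond.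
by apply: ler_prod => i _; case: ifP => _; rewrite ?normr_ge0 ?HF ?ler01 ?K1.
Qed.

(** The equation is tested on [f] times the cutoff, the product of the [bump (x_j / (m + 1))], and
    [m] tends to infinity by dominated convergence. Bounding the Ornstein-Uhlenbeck term as a whole
    by [M] spares any moment of [mu]. *)
Lemma drift_eq (f : 'rV[R]_n -> R) (df ddf : 'I_n -> 'rV[R]_n -> R) (M : R) :
  (forall k, Cb basis k f) ->
  (forall i x, is_derive x (basis i) f (df i x)) ->
  (forall i x, is_derive x (basis i) (df i) (ddf i x)) ->
  measurable_fun setT (fun x : Rinf R => f (rowof x)) ->
  (forall x : 'rV[R]_n, `|\sum_i (ddf i x - x 0 i * df i x)| <= M) ->
  mu.-integrable setT (fun x => (\sum_(i < n) (ddf i (rowof x) - x i * df i (rowof x))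
      + \sum_(i < n) v x i * df i (rowof x))%:E) /\
  (\int[mu]_x (\sum_(i < n) (ddf i (rowof x) - x i * df i (rowof x))
      + \sum_(i < n) v x i * df i (rowof x))%:E = 0)%E.
Proof.
move=> Hf Hd Hdd mf bL.
have [db [ddb [K [Hb Hbb K1 bK]]]] := @bump_bounds R.
have [B B0 HB] := Cb_coord_bound (Hf 1%N) Hd.
pose r (m : nat) : R := m.+1%:R^-1.
have r0 m : 0 < r m by rewrite invr_gt0 ltr0n.
have r1 m : r m <= 1 by rewrite invf_le1 ?ltr0n// ler1n.
have K0 : 0 <= K := le_trans ler01 K1.
have Kn0 : 0 <= K ^+ n by rewrite exprn_ge0.
pose be m y : R := bump (r m * y).
pose dbe m y : R := r m * db (r m * y).
pose ddbe m y : R := r m * (r m * ddb (r m * y)).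
have Hr m (y : R) : is_derive y (1 : R) (fun y => r m * y) (r m).
  by apply: (is_derive_eq (is_derive_scalef _ (is_derive_id _ _))); rewrite mulr1.
have Hbe m y : is_derive y (1 : R) (be m) (dbe m y).
  by rewrite /dbe mulrC; exact: (is_derive_comp1 (Hb _) (Hr m y)).
have Hdbe m y : is_derive y (1 : R) (dbe m) (ddbe m y).
  by apply: is_derive_scalef; rewrite mulrC; exact: (is_derive_comp1 (Hbb _) (Hr m y)).
pose chi m (x : 'rV[R]_n) : R := \prod_j be m (x 0 j).
pose P m i (x : 'rV[R]_n) : R := \prod_(j | j != i) be m (x 0 j).
have Hchi m i x : is_derive x (basis i) (chi m) (dbe m (x 0 i) * P m i x).
  rewrite (_ : chi m = (fun y => be m (y 0 i) * P m i y)); last first.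
    by apply/funext => y; rewrite /chi (bigD1 i).
  exact: (is_derive_prod_coord (fun _ => be m) (Hbe m (x 0 i))).
have HchiP m i x : is_derive x (basis i) (fun x : 'rV[R]_n => dbe m (x 0 i) * P m i x)
    (ddbe m (x 0 i) * P m i x).
  exact: (is_derive_prod_coord (fun _ => be m) (Hdbe m (x 0 i))).
pose F m x := f x * chi m x.
pose dF m i (x : 'rV[R]_n) := f x * (dbe m (x 0 i) * P m i x) + chi m x * df i x.
pose ddF m i (x : 'rV[R]_n) := (f x * (ddbe m (x 0 i) * P m i x) + (dbe m (x 0 i) * P m i x) * df i x)
  + (chi m x * ddf i x + df i x * (dbe m (x 0 i) * P m i x)).
have HF m i x : is_derive x (basis i) (F m) (dF m i x) by exact: is_derive_mulf.
have HFF m i x : is_derive x (basis i) (dF m i) (ddF m i x).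
  by apply: is_derive_addf; exact: is_derive_mulf.
have Cbe m k : Cbline k (be m).
  rewrite (_ : be m = fun y => bump (r m * y + 0)); last by apply/funext => y; rewrite addr0.
  exact: Cbline_affine (Cbline_bump k).
have CF m k : Cb basis k (F m).
  by apply: Cb_mul => //; apply: Cb_prod => j; exact: Cbline_coord.
have cF m : compact_support (F m).
  apply: (@compact_support_box _ (m.+1)%:R) => x Fx i; rewrite leNgt; apply/negP => xi.
  move: Fx; rewrite /F /chi (bigD1 i)//= /be bump_supp ?mul0r ?mulr0 ?eqxx//.
  by rewrite normrM gtr0_norm// ler_pdivlMl ?ltr0n// mulr1 ltW.
pose D m x := \sum_(i < n) (ddF m i (rowof x) - x i * dF m i (rowof x))
      + \sum_(i < n) v x i * dF m i (rowof x).
have ID m : (\int[mu]_x (D m x)%:E = 0)%E by exact: drift_eq_compact_support.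
set D0 := fun x : Rinf R => \sum_(i < n) (ddf i (rowof x) - x i * df i (rowof x))
      + \sum_(i < n) v x i * df i (rowof x).
have ri (x : Rinf R) (i : 'I_n) : rowof x 0 i = x i by rewrite mxE.
(* The terms of the product rule in which the cutoff is differentiated. *)
pose E m x := \sum_(i < n) P m i (rowof x) * (f (rowof x) * ddbe m (x i)
   + 2 * df i (rowof x) * dbe m (x i) - x i * f (rowof x) * dbe m (x i)
   + v x i * f (rowof x) * dbe m (x i)).
have DE m x : D m x = chi m (rowof x) * D0 x + E m x.
  rewrite /D /D0 /E mulrDr !mulr_sumr -!big_split /=; apply: eq_bigr => i _.
  rewrite /ddF /dF !ri; ring.
have bbe m y : [/\ `|be m y| <= K, `|dbe m y| <= r m * K, `|ddbe m y| <= r m * K &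
    `|y * dbe m y| <= K].
  have [h1 h2 h3 h4] := bK (r m * y); split => //.
  - by rewrite normrM gtr0_norm// ler_pM2l.
  - rewrite !normrM gtr0_norm// ler_pM2l// -[leRHS]mul1r ler_pM//; exact: ltW.
  - by rewrite /dbe mulrA (mulrC y).
have bP m i x : `|P m i x| <= K ^+ n.
  by apply: prod_norm_le => // j; case: (bbe m (x 0 j)).
have bchi m x : `|chi m x| <= K ^+ n.
  by apply: prod_norm_le => // j; case: (bbe m (x 0 j)).
(* Pointwise decay: every term contains a derivative of the cutoff, hence a factor [r m]. *)
have bE m x : `|E m x| <= r m * \sum_(i < n) K ^+ n * (B * K *+ 3 + `|x i| * B * K + `|v x i| * B * K).
  rewrite mulr_sumr (le_trans (ler_norm_sum _ _ _))//; apply: ler_sum => i _.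
  have [h1 h2 h3 h4] := bbe m (x i); have [g1 /(_ i) g2] := HB (rowof x).
  rewrite normrM [leRHS]mulrCA ler_pM//.
  have q1 : `|f (rowof x) * ddbe m (x i)| <= B * (r m * K) by rewrite normrM ler_pM.
  have q2 : `|df i (rowof x) * dbe m (x i)| <= B * (r m * K) by rewrite normrM ler_pM.
  have q3 : `|x i * f (rowof x) * dbe m (x i)| <= `|x i| * B * (r m * K).
    by rewrite normrM ler_pM//; rewrite normrM ler_wpM2l.
  have q4 : `|v x i * f (rowof x) * dbe m (x i)| <= `|v x i| * B * (r m * K).
    by rewrite normrM ler_pM//; rewrite normrM ler_wpM2l.
  rewrite -[2 * _ * _]mulrA (le_trans (norm4_le q1 q2 q3 q4))// le_eqVlt; apply/orP; left; apply/eqP; ring.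
(* Domination uniform in [m]: the factor [x i] is absorbed by [|y * dbe m y| <= K], and only
   [normH (v x)], which is integrable, remains. *)
have bE2 m x : `|E m x| <= \sum_(i < n) K ^+ n * (B * K *+ 4 + normH (v x) * B * K).
  rewrite (le_trans (ler_norm_sum _ _ _))//; apply: ler_sum => i _.
  have [h1 h2 h3 h4] := bbe m (x i); have [g1 /(_ i) g2] := HB (rowof x).
  rewrite normrM ler_pM//.
  have rK : r m * K <= K by rewrite ler_piMl.
  have q1 : `|f (rowof x) * ddbe m (x i)| <= B * K.
    by rewrite normrM ler_pM//; exact: le_trans h3 rK.
  have q2 : `|df i (rowof x) * dbe m (x i)| <= B * K.
    by rewrite normrM ler_pM//; exact: le_trans h2 rK.
  have q3 : `|x i * f (rowof x) * dbe m (x i)| <= B * K.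
    by rewrite mulrAC mulrC normrM ler_pM.
  have q4 : `|v x i * f (rowof x) * dbe m (x i)| <= normH (v x) * B * K.
    rewrite normrM ler_pM//; last exact: le_trans h2 rK.
    by rewrite normrM ler_pM// coord_le_normH.
  rewrite -[2 * _ * _]mulrA (le_trans (norm4_le q1 q2 q3 q4))// le_eqVlt; apply/orP; left; apply/eqP; ring.
have bD0 x : `|D0 x| <= M + n%:R * (normH (v x) * B).
  rewrite /D0 (le_trans (ler_normD _ _))// lerD//.
    by under eq_bigr do rewrite -ri; exact: bL.
  rewrite (le_trans (ler_norm_sum _ _ _))//.
  rewrite -[n in leRHS]card_ord mulr_natl -sumr_const; apply: ler_sum => i _.
  rewrite normrM ler_pM// ?coord_le_normH//.
  by have [_] := HB (rowof x).
pose G x := K ^+ n * (M + n%:R * (normH (v x) * B)) +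
  \sum_(i < n) K ^+ n * (B * K *+ 4 + normH (v x) * B * K).
have bD m x : `|D m x| <= G x.
  rewrite DE (le_trans (ler_normD _ _))// lerD// normrM ler_pM//.
have mdf i : measurable_fun setT (fun x : Rinf R => df i (rowof x)).
  exact: measurable_derive_rowof (Hd i) mf.
have mddf i : measurable_fun setT (fun x : Rinf R => ddf i (rowof x)).
  exact: measurable_derive_rowof (Hdd i) (mdf i).
have mF m : measurable_fun setT (fun x : Rinf R => F m (rowof x)).
  apply: measurable_funM => //.
  rewrite (_ : (fun x : Rinf R => _) = (fun x : Rinf R => \prod_(j < n) be m (x j))); last first.
    by apply/funext => x; apply: eq_bigr => j _; rewrite ri.
  apply: measurable_prod => j _; apply: (@measurableT_comp _ _ _ _ _ _ (be m)).
    by apply: continuous_measurable_fun; exact: Cb_cont (Cbe m 0%N).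
  exact: measurable_coord.
have mdF m i : measurable_fun setT (fun x : Rinf R => dF m i (rowof x)).
  exact: measurable_derive_rowof (HF m i) (mF m).
have mddF m i : measurable_fun setT (fun x : Rinf R => ddF m i (rowof x)).
  exact: measurable_derive_rowof (HFF m i) (mdF m i).
have mL (a b : 'I_n -> 'rV[R]_n -> R) :
    (forall i, measurable_fun setT (fun x : Rinf R => a i (rowof x))) ->
    (forall i, measurable_fun setT (fun x : Rinf R => b i (rowof x))) ->
    measurable_fun setT (fun x : Rinf R => \sum_(i < n) (b i (rowof x) - x i * a i (rowof x))
      + \sum_(i < n) v x i * a i (rowof x)).
  move=> ma mb; apply: measurable_funD; apply: measurable_sum => i.
    apply: measurable_funB => //; apply: measurable_funM => //; exact: measurable_coord.
  apply: measurable_funM => //; exact: measurable_v.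
have iG : mu.-integrable setT (EFin \o G).
  rewrite (_ : EFin \o G = (fun x => (K ^+ n * M + n%:R * (K ^+ n * (B * K *+ 4)))%:E +
    (K ^+ n * n%:R * B + n%:R * (K ^+ n * B * K))%:E * (normH (v x))%:E)%E).
    apply: integrableD => //; last exact: integrableZl.
    exact: finite_measure_integrable_cst.
  apply/funext => x; rewrite /G /= sumr_const card_ord -EFinM -EFinD; congr EFin.
  by rewrite -[in LHS]mulr_natl; ring.
have cvD x : (D m x)%:E @[m --> \oo] --> (D0 x)%:E.
  apply: cvg_EFin; first exact: nearW.
  rewrite (_ : _ \o _ = fun m => chi m (rowof x) * D0 x + E m x); last first.
    by apply/funext => m; exact: DE.
  have c1 : chi m (rowof x) @[m --> \oo] --> (1 : R).
    pose h (t : R) : R := \prod_(j < n) bump (rowof x 0 j * t + 0).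
    have cj (j : 'I_n) : Cbline 0 (fun t : R => bump (rowof x 0 j * t + 0)).
      exact: Cbline_affine (Cbline_bump 0).
    have ch : Cbline 0 h by apply: Cb_prod => j; exact: cj.
    have h0 : h 0 = 1 by rewrite /h big1// => j _; rewrite mulr0 addr0 bump0.
    have ch1 : continuous h by exact: Cb_cont ch.
    have ch0 : h t @[t --> (0 : R)] --> (1 : R) by rewrite -h0; exact: ch1.
    rewrite (_ : (fun m => _) = h \o r); last first.
      by apply/funext => m; apply: eq_bigr => j _ /=; rewrite /be addr0 mulrC.
    by apply: cvg_comp ch0; exact: cvg_harmonic.
  have c2 : E m x @[m --> \oo] --> (0 : R).
    apply/norm_cvg0P; apply: (squeeze_cvgr (f := fun=> 0) (h := fun m => r m *
       \sum_(i < n) K ^+ n * (B * K *+ 3 + `|x i| * B * K + `|v x i| * B * K))).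
    - by apply: nearW => m; rewrite normr_ge0 bE.
    - exact: cvg_cst.
    - rewrite -[X in _ --> X](mul0r (\sum_(i < n) K ^+ n * (B * K *+ 3 + `|x i| * B * K + `|v x i| * B * K))).
      by apply: cvgMl; exact: cvg_harmonic.
  by rewrite -[X in _ --> X]addr0 -{2}[D0 x]mul1r; apply: cvgD c2; exact: cvgMl.
have [i0 _ lim] := @dominated_convergence _ _ R mu setT measurableT
  (fun m x => (D m x)%:E) (fun x => (D0 x)%:E) (EFin \o G)
  (fun m => (measurable_EFinP _ _).2 (mL _ _ (mdF m) (mddF m)))
  ((measurable_EFinP _ _).2 (mL _ _ mdf mddf))
  (aeW _ (fun x _ => cvD x)) iG (aeW _ (fun x m _ => bD m x)).
split => //; apply: (@cvg_unique _ (@ereal_hausdorff R) _ _ _ _ lim).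
rewrite (_ : [sequence _]_n = cst 0%E); first exact: cvg_cst.
by apply/funext => m; exact: ID.
Qed.

End integration_by_parts.

(** * Orthants and their Gaussian measure *)

Section option_levels.
Context {R : realType}.
Implicit Types (c z : option R) (th x y : R).

Local Notation N := (@normal_prob R 0 1).
Local Notation pdf := (@normal_pdf R 0 1).
Local Notation leb := (@lebesgue_measure R).

(* A level [None] stands for +oo. *)
Definition below z y : R := if z is Some a then (y <= a)%R%:R else 1.
Definition PhiO z : R := if z is Some a then Phi a else 1.
Definition pdfO z : R := if z is Some a then pdf a else 0.
(** For [sin th > 0], the bound on [y] equivalent to [cos th * x + sin th * y <= c], as Mehler's
    formula requires. *)
Definition level c th x : option R := omap (fun a => (a - cos th * x) / sin th) c.

Lemma below_ge0 z y : 0 <= below z y.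
Proof. by case: z => [a|]. Qed.

Lemma measurable_below z : measurable_fun setT (below z).
Proof.
case: z => [a|]; last exact: measurable_cst.
rewrite (_ : below _ = \1_(`]-oo, a]%classic)); first exact: measurable_indic.
by apply/funext => y; rewrite indicE mem_setE in_itv.
Qed.

Lemma below_level c th x y : 0 < sin th ->
  below c (cos th * x + sin th * y) = below (level c th x) y.
Proof.
case: c => [a|] //= s0; congr (nat_of_bool _)%:R.
by rewrite ler_pdivlMr// lerBrDl [y * _]mulrC.
Qed.

Lemma integral_below z : (\int[N]_y (below z y)%:E = (PhiO z)%:E)%E.
Proof.
case: z => [a|] /=; last first.
  by rewrite integral_cst// mul1e; apply: (@probability_setT _ _ R N).
rewrite -PhiE -[in RHS](setIT `]-oo, a]%classic) -integral_indic//.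
apply: eq_integral => y _; congr EFin.
by rewrite indicE mem_setE in_itv.
Qed.

Lemma PhiO_ge0 z : 0 <= PhiO z.
Proof. by case: z => [a|] //=; exact: Phi_ge0. Qed.

Lemma PhiO_le1 z : PhiO z <= 1.
Proof. by case: z => [a|] //=; exact: Phi_le1. Qed.

(** Integrating [1 + w y <= e^(w y)] under the Gaussian law gives [w I <= w^2] for [|w| <= 1] of
    either sign, which forces the mean [I] to vanish. *)
Lemma Rintegral_id_pdfT : \int[leb]_t (t * pdf t) = 0.
Proof.
set m := RHS; set I := LHS.
have H (w : R) : 1 + w * I <= expR (w ^+ 2 / 2).
  rewrite -lee_fin -integral_normal01_expR EFinD EFinM.
  have -> : I%:E = (\int[leb]_t (t * pdf t)%:E)%E.
    by rewrite /I /Rintegral fineK//; exact: integrable_fin_num integrable_id_pdf.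
  rewrite -integralZl//; last exact: integrable_id_pdf.
  rewrite -[in leLHS](@integral_normal_pdf R 0 1) -integralD//; last 2 first.
  - exact: integrable_normal_pdf.
  - by apply: integrableZl => //; exact: integrable_id_pdf.
  rewrite ge0_integral_normal01.
  - apply: le_integral => //.
    + apply: integrableD => //; first exact: integrable_normal_pdf.
      by apply: integrableZl => //; exact: integrable_id_pdf.
    + have := @integrable_expR_pdf R w.
      by congr integrable; apply/funext => y; rewrite EFinM muleC.
    + move=> t _; rewrite -EFinM -EFinD -EFinM lee_fin mulrA -[X in X + _]mul1r -mulrDl mulrC.
      by rewrite ler_wpM2l ?normal_pdf_ge0// expR_ge1Dx.
  - apply/measurable_EFinP; apply: measurableT_comp => //; exact: measurable_funM.
  - by move=> y; rewrite lee_fin expR_ge0.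
have H2 (w : R) : `|w| <= 1 -> w * I <= w ^+ 2.
  move=> w1; have := H w; have w2 : w ^+ 2 <= 1 by rewrite -[w ^+ 2]real_normK ?num_real// expr_le1.
  have := sqr_ge0 w; have := expR_ge1Dx (- (w ^+ 2 / 2)); rewrite expRN.
  set E := expR _; have E0 : 0 < E by exact: expR_gt0.
  move=> h1 h2 h3; have : E * (1 - w ^+ 2 / 2) <= 1.
    by rewrite -ler_pdivlMl// mulr1.
  by nra.
apply/eqP; rewrite -normr_le0; apply/ler_addgt0Pl => e e0; rewrite addr0.
pose w := Num.min 1 e; have w0 : 0 < w by rewrite lt_min ltr01.
have w1 : `|w| <= 1 by rewrite gtr0_norm// ge_min lexx.
have we : w <= e by rewrite ge_min lexx orbT.
have h1 := H2 w w1; have h2 := H2 (- w); rewrite normrN in h2; have {}h2 := h2 w1.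
rewrite (le_trans _ we)// ler_norml; apply/andP; split; nra.
Qed.

Lemma integral_below_moment z : exists a b : R,
  [/\ (\int[N]_y (Num.max y 0 * below z y)%:E = a%:E)%E,
      (\int[N]_y (Num.max (- y) 0 * below z y)%:E = b%:E)%E & a - b = - pdfO z].
Proof.
case: z => [a|]; first exact: integral_lower_moment.
have mf (s : R) : measurable_fun setT (fun y : R => Num.max (s * y) 0).
  by apply: measurable_maxr => //; exact: measurable_funM.
have f0 (s : R) y : 0 <= Num.max (s * y) 0 by rewrite le_max lexx orbT.
have If (s : R) : `|s| = 1 -> leb.-integrable setT (fun y => (pdf y * Num.max (s * y) 0)%:E).
  move=> s1; apply: (le_integrable _ _ _ (@integrable_id_pdf R)) => //.
    by apply/measurable_EFinP; apply: measurable_funM; [exact: measurable_normal_pdf|exact: mf].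
  move=> y _; rewrite !abse_EFin lee_fin mulrC !normrM ler_wpM2r//.
  rewrite ger0_norm// ge_max normr_ge0 andbT.
  by rewrite (le_trans (ler_norm _))// normrM s1 mul1r.
have IE (s : R) : `|s| = 1 -> (\int[N]_y (Num.max (s * y) 0)%:E =
    (\int[leb]_y (pdf y * Num.max (s * y) 0))%:E)%E.
  move=> s1; rewrite ge0_integral_normal01; last by move=> y; rewrite lee_fin.
    rewrite /Rintegral fineK//; exact: integrable_fin_num (If _ s1).
  exact/measurable_EFinP.
have n1 : `|1 : R| = 1 by rewrite normr1.
have nN1 : `|-1 : R| = 1 by rewrite normrN1.
exists (\int[leb]_y (pdf y * Num.max (1 * y) 0)).
exists (\int[leb]_y (pdf y * Num.max (-1 * y) 0)); split.
- by rewrite -IE//; apply: eq_integral => y _; rewrite mul1r /= mulr1.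
- by rewrite -IE//; apply: eq_integral => y _; rewrite mulN1r /= mulr1.
rewrite -RintegralB//; [|exact: If..].
rewrite /= oppr0 -[RHS]Rintegral_id_pdfT; apply: eq_Rintegral => y _.
rewrite mul1r mulN1r -mulrBr mulrC; congr (_ * _).
by rewrite /Num.max; do 2 case: ltP => ?; lra.
Qed.

Lemma is_derive_PhiO_level c th y :
  is_derive y (1 : R) (fun y => PhiO (level c th y))
    (- (cos th / sin th) * pdfO (level c th y)).
Proof.
case: c => [a|] /=; last first.
  by rewrite mulr0; exact: is_derive_cst.
rewrite mulrC.
apply: (@is_derive_comp1 _ _ Phi (fun y => (a - cos th * y) / sin th)).
  exact: is_derive_Phi.
rewrite (_ : (fun y => _) = (fun y => (- (cos th / sin th)) * y + a / sin th)); last first.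
  by apply/funext => x; ring.
apply: (is_derive_eq (is_derive_addf (is_derive_scalef _ (is_derive_id _ _)) (is_derive_cst _ _ _))).
by rewrite mulr1 addr0.
Qed.

(** In derivatives the default 0 at [None] always meets the factor [pdfO None = 0]. *)
Definition zO z : R := if z is Some a then a else 0.

Lemma is_derive_pdf y : is_derive y (1 : R) pdf (- (y * pdf y)).
Proof.
rewrite (_ : pdf = (fun y => normal_peak 1 * expR (- (y ^+ 2 / 2)))); last first.
  by apply/funext => x; exact: normal01_pdfE.
apply: (is_derive_eq (is_derive_scalef _ (is_derive_gauss y))).
by rewrite mulNr mulrN mulrCA.
Qed.

Lemma is_derive_pdfO_level c th y :
  is_derive y (1 : R) (fun y => pdfO (level c th y))
    (cos th / sin th * (zO (level c th y) * pdfO (level c th y))).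
Proof.
case: c => [a|] /=; last first.
  by rewrite !mulr0; exact: is_derive_cst.
rewrite -[X in is_derive _ _ _ X]mulrNN mulrC.
apply: (@is_derive_comp1 _ _ pdf (fun y => (a - cos th * y) / sin th)).
  exact: is_derive_pdf.
rewrite (_ : (fun y => _) = (fun y => (- (cos th / sin th)) * y + a / sin th)); last first.
  by apply/funext => x; ring.
apply: (is_derive_eq (is_derive_addf (is_derive_scalef _ (is_derive_id _ _)) (is_derive_cst _ _ _))).
by rewrite mulr1 addr0.
Qed.

(* [heatL] is (d^2/dy^2 - y d/dy) applied to [PhiO (level c th y)]. *)
Definition heatL c th y : R :=
  - (cos th / sin th) * (cos th / sin th * (zO (level c th y) * pdfO (level c th y)))
  - y * (- (cos th / sin th) * pdfO (level c th y)).

(** The heat equation read in the angle: the time [- ln (cos th)] has derivative [tan th]. *)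
Lemma is_derive_PhiO_angle c th y : 0 < sin th -> 0 < cos th ->
  is_derive th (1 : R) (fun t => PhiO (level c t y)) (sin th / cos th * heatL c th y).
Proof.
move=> s0 c0; case: c => [a|] /=; last first.
  by apply: (is_derive_eq (is_derive_cst _ _ _)); rewrite /heatL /= !mulr0 subrr mulr0.
have sn0 : sin th != 0 by rewrite gt_eqF.
have cn0 : cos th != 0 by rewrite gt_eqF.
have Hz : is_derive th (1 : R) (fun t => (a - cos t * y) / sin t)
   ((a - cos th * y) * (- sin th ^- 2 * cos th) + (sin th)^-1 * (0 + - (cos th * 0 + y * - sin th))).
  exact: is_derive_mulf.
apply: (is_derive_eq (@is_derive_comp1 _ _ Phi _ th 1 _ _ (is_derive_Phi _) Hz)).
rewrite /heatL /=; set p := pdf _.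
by field; rewrite sn0 cn0.
Qed.

Lemma pdf_bounds y : 0 <= pdf y <= 1 /\ `|y * pdf y| <= 1.
Proof.
have pk : normal_peak 1 <= 1 :> R.
  rewrite /normal_peak expr1n mul1r -[leRHS]invr1 lef_pV2 ?posrE ?ltr01//; last first.
    by rewrite sqrtr_gt0 pmulrn_lgt0// pi_gt0.
  rewrite -[leLHS]sqrtr1 ler_wsqrtr// -[leLHS]mulr1n.
  by have := pi_ge2 R; rewrite mulr2n; lra.
have e1 : expR (- (y ^+ 2 / 2)) <= 1 by rewrite expR_le1 oppr_le0 mulr_ge0 ?sqr_ge0.
have e0 := expR_gt0 (- (y ^+ 2 / 2)).
split; first by rewrite normal_pdf_ge0 normal01_pdfE mulr_ile1 ?normal_peak_ge0 ?expR_ge0.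
rewrite normrM normal01_pdfE [ `|_ * expR _|]ger0_norm ?mulr_ge0 ?normal_peak_ge0 ?expR_ge0//.
rewrite mulrCA mulr_ile1 ?normal_peak_ge0 ?mulr_ge0 ?expR_ge0//.
rewrite expRN ler_pdivrMr ?expR_gt0// mul1r.
apply: le_trans (expR_ge1Dx _).
by rewrite -[y ^+ 2]real_normK ?num_real//; have := sqr_ge0 (`|y| - 1); nra.
Qed.

(** In terms of the level [z] the coordinate is [y = (a - z sin th) / cos th], and [z * pdf z] is
    bounded, so the coefficient [y] causes no growth. *)
Lemma heatL_bound c th y : 0 < sin th -> 0 < cos th ->
  `|sin th / cos th * heatL c th y| <= `|zO c| / cos th + (sin th * cos th)^-1.
Proof.
move=> s0 c0; have sn0 : sin th != 0 by rewrite gt_eqF.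
have cn0 : cos th != 0 by rewrite gt_eqF.
case: c => [a|] /=; last first.
  by rewrite /heatL /= !mulr0 subrr mulr0 normr0 mul0r add0r invr_ge0 mulr_ge0// ltW.
rewrite /heatL /=; set z := (a - cos th * y) / sin th; set p := pdf _.
have [/andP[p0 p1] zp] := pdf_bounds z; rewrite -/p in p0 p1 zp.
have -> : sin th / cos th * (- (cos th / sin th) * (cos th / sin th * (z * p)) -
    y * (- (cos th / sin th) * p)) = p * (a / cos th) - (z * p) * (sin th * cos th)^-1.
  have -> : y = (a - z * sin th) / cos th by rewrite /z; field; rewrite sn0 cn0.
  have cs : cos th ^+ 2 = 1 - sin th ^+ 2 by rewrite -(cos2Dsin2 th); ring.
  transitivity (p * (a / cos th) - (z * p) * ((cos th ^+ 2 + sin th ^+ 2) / (sin th * cos th))).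
    by field; rewrite sn0 cn0.
  by rewrite cos2Dsin2 mul1r.
rewrite (le_trans (ler_normB _ _))// lerD//.
  have e1 : `|a / cos th| = `|a| / cos th by rewrite normrM normfV [ `|cos th|]gtr0_norm.
  by rewrite normrM e1 ger0_norm// ler_piMl// divr_ge0// ltW.
have e2 : `|(sin th * cos th)^-1| = (sin th * cos th)^-1 by rewrite gtr0_norm// invr_gt0 mulr_gt0.
by rewrite normrM e2 ler_piMl// invr_ge0 mulr_ge0// ltW.
Qed.

Lemma Cbline_pdf k : Cbline k pdf.
Proof.
rewrite (_ : pdf = (fun y => normal_peak 1 * ((1%:P).[y] * expR (- (y ^+ 2 / 2))))); last first.
  by apply/funext => x; rewrite normal01_pdfE hornerC mul1r.
by apply: Cb_mul; [exact: Cb_cst|exact: Cbline_poly_gauss].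
Qed.

Lemma Cbline_Phi k : Cbline k (@Phi R).
Proof.
have c0 : continuous (@Phi R).
  by move=> x; apply: differentiable_continuous; apply/derivable1_diffP; case: (is_derive_Phi x).
have C0 : Cbline 0 (@Phi R).
  split => //; exists 1 => x; rewrite ger0_norm ?Phi_ge0//; exact: Phi_le1.
case: k => // k; apply/Cb_SE; split => //.
exists (fun=> pdf); split; last by move=> _; exact: Cbline_pdf.
by move=> _ x; exact: is_derive_Phi.
Qed.

Lemma Cbline_PhiO_level k c th : Cbline k (fun y => PhiO (level c th y)).
Proof.
case: c => [a|] /=; last exact: Cb_cst.
rewrite (_ : (fun y => _) = (fun y => Phi ((- (cos th / sin th)) * y + a / sin th))); last first.
  by apply/funext => x; congr Phi; ring.
exact: Cbline_affine (Cbline_Phi k).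
Qed.

End option_levels.

Section has_integral.
Context d (T : measurableType d) (R : realType) (P : {measure set T -> \bar R}).
Implicit Types (f g : T -> R) (a b : R).

(** Integrability and a real value in one relation, so that sums and comparisons of integrals are
    carried out in [R]. *)
Definition has_integral f b :=
  P.-integrable setT (EFin \o f) /\ (\int[P]_x (f x)%:E = b%:E)%E.

Lemma has_integral_ge0 f b : measurable_fun setT f -> (forall x, 0 <= f x) ->
  (\int[P]_x (f x)%:E = b%:E)%E -> has_integral f b.
Proof.
move=> mf f0 fb; split => //; apply/integrableP; split; first exact/measurable_EFinP.
under eq_integral do rewrite /= ger0_norm//.
by rewrite fb ltry.
Qed.

Lemma has_integralD f g a b : has_integral f a -> has_integral g b ->
  has_integral (fun x => f x + g x) (a + b).
Proof.
move=> [fi fa] [gi gb]; split.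
  rewrite (_ : _ \o _ = (fun x => (f x)%:E + (g x)%:E)%E)//; exact: integrableD.
under eq_integral do rewrite EFinD.
by rewrite integralD//= fa gb.
Qed.

Lemma has_integralZ f a (k : R) : has_integral f a ->
  has_integral (fun x => k * f x) (k * a).
Proof.
move=> [fi fa]; split.
  by rewrite (_ : _ \o _ = (fun x => k%:E * (f x)%:E)%E)//; exact: integrableZl.
under eq_integral do rewrite EFinM.
by rewrite integralZl//= fa.
Qed.

Lemma has_integralB f g a b : has_integral f a -> has_integral g b ->
  has_integral (fun x => f x - g x) (a - b).
Proof.
move=> Hf Hg; have := has_integralD Hf (has_integralZ (-1) Hg).
by rewrite mulN1r; under eq_fun do rewrite mulN1r.
Qed.

Lemma has_integral0 : has_integral (fun=> 0) 0.
Proof. by split; [exact: integrable0|rewrite integral0]. Qed.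

Lemma has_integral_sum (I : Type) (s : seq I) (f : I -> T -> R) (a : I -> R) :
  (forall i, has_integral (f i) (a i)) ->
  has_integral (fun x => \sum_(i <- s) f i x) (\sum_(i <- s) a i).
Proof.
move=> H; elim: s => [|i s IH].
  by rewrite big_nil; under eq_fun do rewrite big_nil; exact: has_integral0.
by rewrite big_cons; under eq_fun do rewrite big_cons; exact: has_integralD.
Qed.

Lemma has_integral_le f g a b : has_integral f a -> has_integral g b ->
  (forall x, f x <= g x) -> a <= b.
Proof.
move=> [fi fa] [gi gb] fg; rewrite -lee_fin -fa -gb; apply: le_integral => //.
by move=> x _; rewrite lee_fin.
Qed.

Lemma has_integral_uniq f a b : has_integral f a -> has_integral f b -> a = b.
Proof. by move=> [_ fa] [_]; rewrite fa => -[]. Qed.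

Lemma has_integral_ext f g a : (forall x, f x = g x) -> has_integral f a -> has_integral g a.
Proof. by move=> /funext ->. Qed.

End has_integral.

Section has_integral_probability.
Context d (T : measurableType d) (R : realType) (P : probability T R).

Lemma has_integral_cst (a : R) : has_integral P (fun=> a) a.
Proof.
split; first exact: finite_measure_integrable_cst.
by rewrite integral_cst// [X in (_ * X)%E]probability_setT mule1.
Qed.

Lemma has_integral_bounded (f : T -> R) (M : R) : measurable_fun setT f ->
  (forall x, `|f x| <= M) -> exists a, has_integral P f a.
Proof.
move=> mf fM.
have fi : P.-integrable setT (EFin \o f).
  apply: (le_integrable _ _ _ (has_integral_cst M).1) => //.
    exact/measurable_EFinP.
  by move=> x _ /=; rewrite lee_fin (le_trans (fM x))// ler_norm.
by exists (fine (\int[P]_x (f x)%:E)); split => //; rewrite fineK//; exact: integrable_fin_num.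
Qed.

End has_integral_probability.

Section orthants.
Context {R : realType} (gamma : probability (Rinf R) R).
Hypothesis hgamma : std_gaussian_power gamma.

(* [(a, c)] codes [a] times the indicator of the orthant [x i <= c i]. *)
Definition comb (J : seq (R * (nat -> option R))) n (x : nat -> R) : R :=
  \sum_(j <- J) j.1 * \prod_(i < n) below (j.2 i) (x i).
Definition gcomb (J : seq (R * (nat -> option R))) n : R :=
  \sum_(j <- J) j.1 * \prod_(i < n) PhiO (j.2 i).
(** Coordinate [i] of the Gaussian barycentre of [comb J n]: the first moment of the normal law over
    []-oo, a]] is [- pdf a]. *)
Definition gcomb1 (J : seq (R * (nat -> option R))) n (i : 'I_n) : R :=
  \sum_(j <- J) j.1 * (- pdfO (j.2 i) * \prod_(l < n | l != i) PhiO (j.2 l)).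

Lemma gamma_has_integral_prod n (f : nat -> R -> R) (a : nat -> R) :
  (forall i, measurable_fun setT (f i)) -> (forall i y, 0 <= f i y) ->
  (forall i, \int[@normal_prob R 0 1]_y (f i y)%:E = (a i)%:E)%E ->
  has_integral gamma (fun x : Rinf R => \prod_(i < n) f i (x i)) (\prod_(i < n) a i).
Proof.
move=> mf f0 fa; apply: has_integral_ge0; last exact: gamma_integral_prod.
  apply: measurable_prod => i _; apply: (measurableT_comp (mf i)).
  exact: measurable_coord.
by move=> x; exact: prodr_ge0.
Qed.

Lemma measurable_comb J n : measurable_fun setT (fun x : Rinf R => comb J n x).
Proof.
apply: measurable_sum => j; apply: measurable_funM; first exact: measurable_cst.
apply: measurable_prod => i _; apply: measurableT_comp; first exact: measurable_below.
exact: measurable_coord.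
Qed.

Lemma has_integral_comb J n : has_integral gamma (fun x : Rinf R => comb J n x) (gcomb J n).
Proof.
apply: has_integral_sum => j; apply: has_integralZ.
exact: (gamma_has_integral_prod n (fun i => measurable_below (j.2 i))
  (fun i => below_ge0 (j.2 i)) (fun i => integral_below (j.2 i))).
Qed.

Lemma has_integral_coord_below n (z : nat -> option R) (i : 'I_n) :
  has_integral gamma (fun x : Rinf R => x i * \prod_(l < n) below (z l) (x l))
    (- pdfO (z i) * \prod_(l < n | l != i) PhiO (z l)).
Proof.
have [a [b [Ha Hb ab]]] := integral_below_moment (z i).
pose f (s : R) (l : nat) y : R := if l == i :> nat then Num.max (s * y) 0 * below (z l) y else below (z l) y.
pose c (a : R) (l : nat) : R := if l == i :> nat then a else PhiO (z l).
have mf s l : measurable_fun setT (f s l).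
  rewrite /f; case: (l == i :> nat); last exact: measurable_below.
  apply: measurable_funM; last exact: measurable_below.
  by apply: measurable_maxr => //; exact: measurable_funM.
have f0 s l y : 0 <= f s l y.
  rewrite /f; case: ifP => _; last exact: below_ge0.
  by rewrite mulr_ge0 ?below_ge0// le_max lexx orbT.
have I1 : has_integral gamma (fun x : Rinf R => \prod_(l < n) f 1 l (x l)) (\prod_(l < n) c a l).
  apply: gamma_has_integral_prod => // l; rewrite /f /c.
  case: eqP => [->|_]; last exact: integral_below.
  by rewrite -Ha; apply: eq_integral => y _; rewrite mul1r.
have I2 : has_integral gamma (fun x : Rinf R => \prod_(l < n) f (-1) l (x l)) (\prod_(l < n) c b l).
  apply: gamma_has_integral_prod => // l; rewrite /f /c.
  case: eqP => [->|_]; last exact: integral_below.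
  by rewrite -Hb; apply: eq_integral => y _; rewrite mulN1r.
have := has_integralB I1 I2; rewrite (bigD1 i)//= [in X in _ - X](bigD1 i)//=.
have cE (e : R) : c e i = e by rewrite /c eqxx.
have cP (e : R) : \prod_(l < n | l != i) c e l = \prod_(l < n | l != i) PhiO (z l).
  by apply: eq_bigr => l li; rewrite /c ifF//; apply/negbTE.
rewrite !cE !cP -mulrBl ab; apply: has_integral_ext => x.
rewrite (bigD1 i)//= [in X in _ - X](bigD1 i)//= [in RHS](bigD1 i)//=.
have fP (e : R) : \prod_(l < n | l != i) f e l (x l) = \prod_(l < n | l != i) below (z l) (x l).
  by apply: eq_bigr => l li; rewrite /f ifF//; apply/negbTE.
rewrite !fP -mulrBl mulrA; congr (_ * _); rewrite /f eqxx -mulrBl; congr (_ * _).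
by rewrite mul1r mulN1r /Num.max; do 2 case: ltP => ?; lra.
Qed.

Lemma has_integral_coord_comb J n (i : 'I_n) :
  has_integral gamma (fun x : Rinf R => x i * comb J n x) (gcomb1 J i).
Proof.
apply: (has_integral_ext (f := fun x : Rinf R => \sum_(j <- J) j.1 *
    (x i * \prod_(l < n) below (j.2 l) (x l)))).
  by move=> x; rewrite mulr_sumr; apply: eq_bigr => j _; rewrite mulrCA.
apply: has_integral_sum => j; apply: has_integralZ; exact: has_integral_coord_below.
Qed.

Lemma has_integral_expR_linear n (w : 'I_n -> R) :
  has_integral gamma (fun x : Rinf R => expR (\sum_i w i * x i))
    (expR ((\sum_i w i ^+ 2) / 2)).
Proof.
pose w' (i : nat) : R := if insub i is Some j then w j else 0.
have w'E (i : 'I_n) : w' i = w i by rewrite /w' valK.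
have := @gamma_has_integral_prod n (fun i y => expR (w' i * y)) (fun i => expR (w' i ^+ 2 / 2)).
rewrite (_ : \prod_(i < n) _ = expR ((\sum_i w i ^+ 2) / 2)); last first.
  rewrite -expR_sum; congr expR; rewrite mulr_suml.
  by apply: eq_bigr => i _; rewrite w'E.
move=> H; apply: has_integral_ext (H _ _ _).
- by move=> x; rewrite -expR_sum; congr expR; apply: eq_bigr => i _; rewrite w'E.
- move=> i; apply: measurableT_comp => //; exact: measurable_funM.
- by move=> i y; exact: expR_ge0.
- by move=> i; exact: integral_normal01_expR.
Qed.

Section unit_interval.
Variables (J : seq (R * (nat -> option R))) (n : nat).
Hypothesis J01 : forall x : nat -> R, 0 <= comb J n x <= 1.

Lemma gcomb_ge0 : 0 <= gcomb J n.
Proof.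
apply: (has_integral_le (has_integral0 gamma) (has_integral_comb J n)) => x.
by have /andP[] := J01 x.
Qed.

Lemma gcomb_le1 : gcomb J n <= 1.
Proof.
apply: (has_integral_le (has_integral_comb J n) (has_integral_cst gamma 1)) => x.
by have /andP[] := J01 x.
Qed.

(* The Gaussian barycentre of a set-like density [comb J n <= 1] is estimated by
   the entropy inequality [t W <= W (K - 1) + e^(t - K)], integrated with
   [t = (w, x) / G] and [w] the barycentre itself. *)
Lemma barycentre_bound (eps : R) : 0 < eps <= 1 ->
  \sum_(i < n) gcomb1 J i ^+ 2 <= 2 * (gcomb J n + eps) ^+ 2 * (2 - ln (gcomb J n + eps)).
Proof.
move=> /andP[e0 e1]; set g := gcomb J n; set G := g + eps.
have g0 : 0 <= g := gcomb_ge0; have g1 : g <= 1 := gcomb_le1.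
have G0 : 0 < G by rewrite ltr_wpDl.
have G2 : G <= 2 by rewrite /G; lra.
set w := @gcomb1 J n; set s := \sum_i w i ^+ 2; set L := 2 - ln G.
have s0 : 0 <= s by apply: sumr_ge0 => i _; exact: sqr_ge0.
have L1 : 1 <= L.
  have : ln G <= G - 1 by have := @le_ln1Dx R (G - 1); rewrite subrKC; apply; lra.
  by rewrite /L; lra.
(* Chosen so that [e^(-K)] times the Gaussian integral of [e^t] equals [e^(-L) = G e^(-2)]. *)
pose K := s / G ^+ 2 / 2 + L.
have K1 : 1 <= K by rewrite /K ler_wpDl// divr_ge0// divr_ge0// sqr_ge0.
have I1 : has_integral gamma (fun x : Rinf R => (\sum_i (w i / G) * x i) * comb J n x) (s / G).
  apply: (has_integral_ext (f := fun x : Rinf R => \sum_i (w i / G) * (x i * comb J n x))).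
    by move=> x; rewrite mulr_suml; apply: eq_bigr => i _; rewrite mulrA.
  rewrite (_ : s / G = \sum_i (w i / G) * w i); last first.
    by rewrite /s mulr_suml; apply: eq_bigr => i _; ring.
  apply: has_integral_sum => i; apply: has_integralZ; exact: has_integral_coord_comb.
have I2 := has_integralD (has_integralZ (K - 1) (has_integral_comb J n))
  (has_integralZ (expR (- K)) (has_integral_expR_linear (fun i => w i / G))).
have := has_integral_le I1 I2.
have -> : expR (- K) * expR ((\sum_(i < n) (w i / G) ^+ 2) / 2) = G * expR (- 2).
  rewrite -expRD (_ : - K + _ = ln G - 2).
    by rewrite expRD lnK// posrE.
  rewrite /K /L (_ : \sum_i _ = s / G ^+ 2); first by ring.
  by rewrite /s mulr_suml; apply: eq_bigr => i _; rewrite exprMn exprVn.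
have e2 : expR (- 2) <= 1 :> R by rewrite expR_le1; lra.
move=> H; have {}H : s / G <= G * K.
  apply: (le_trans (H _)).
    move=> x; have /andP[W0 W1] := J01 x.
    set W := comb J n x in W0 W1 *; set t := \sum_i _.
    rewrite -expRD [- K + _]addrC.
    have := expR_ge1Dx (t - K); set E := expR _ => HE.
    have E0 : 0 < E by exact: expR_gt0.
    (* [1 + (t - K) <= E] is multiplied by [W], which lies in [[0, 1]]. *)
    have : W * (t - K + 1) <= E by nra.
    lra.
  rewrite -/g; have : (K - 1) * g <= (K - 1) * G by rewrite ler_wpM2l ?subr_ge0// /G lerDl ltW.
  have : G * expR (-2) <= G * 1 by rewrite ler_pM2l.
  lra.
have {}H : s <= G ^+ 2 * K by rewrite expr2 -mulrA -ler_pdivrMl// mulrC.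
(* Half of [s] is absorbed on the left, whence the factor 2 of the statement. *)
move: H; rewrite /K mulrDr.
rewrite (_ : G ^+ 2 * (s / G ^+ 2 / 2) = s / 2); last by field; rewrite gt_eqF.
lra.
Qed.

End unit_interval.
End orthants.

(** * The Mehler semigroup on combinations of orthants *)

Section mehler.
Context {R : realType} (gamma : probability (Rinf R) R).
Hypothesis hgamma : std_gaussian_power gamma.
Variables (n : nat) (J : seq (R * (nat -> option R))).
Local Notation basis := (@basis R n).
Local Notation rowof := (@rowof R n).
Implicit Types (th eps al : R).

(* [mehler th] is the Ornstein-Uhlenbeck semigroup at time [- ln (cos th)] applied
   to [comb J n]. *)
Definition mehler th (x : 'rV[R]_n) : R :=
  \sum_(j <- J) j.1 * \prod_(i < n) PhiO (level (j.2 i) th (x 0 i)).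

Definition dmehler th (i : 'I_n) (x : 'rV[R]_n) : R :=
  \sum_(j <- J) j.1 * (- (cos th / sin th) * pdfO (level (j.2 i) th (x 0 i)) *
    \prod_(l < n | l != i) PhiO (level (j.2 l) th (x 0 l))).

Definition ddmehler th (i : 'I_n) (x : 'rV[R]_n) : R :=
  \sum_(j <- J) j.1 * (- (cos th / sin th) * (cos th / sin th *
     (zO (level (j.2 i) th (x 0 i)) * pdfO (level (j.2 i) th (x 0 i)))) *
    \prod_(l < n | l != i) PhiO (level (j.2 l) th (x 0 l))).

Definition Lmehler th (x : 'rV[R]_n) : R :=
  \sum_i (ddmehler th i x - x 0 i * dmehler th i x).

Lemma Cb_mehler k th : Cb basis k (mehler th).
Proof.
apply: Cb_sum => j; apply: Cb_mul; first exact: Cb_cst.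
by apply: Cb_prod => i; exact: (Cbline_coord i (Cbline_PhiO_level k (j.2 i) th)).
Qed.

Lemma is_derive_mehler th i x : is_derive x (basis i) (mehler th) (dmehler th i x).
Proof.
apply: is_derive_sumf => j; apply: is_derive_scalef.
rewrite (_ : (fun y : 'rV[R]_n => _) = (fun y : 'rV[R]_n => PhiO (level (j.2 i) th (y 0 i)) *
   \prod_(l < n | l != i) PhiO (level (j.2 l) th (y 0 l)))); last first.
  by apply/funext => y; rewrite (bigD1 i).
exact: (@is_derive_prod_coord _ _ (fun y => PhiO (level (j.2 i) th y))
  (fun y => - (cos th / sin th) * pdfO (level (j.2 i) th y))
  (fun l y => PhiO (level (j.2 l) th y)) i x (is_derive_PhiO_level (j.2 i) th (x 0 i))).
Qed.

Lemma is_derive_dmehler th i x : is_derive x (basis i) (dmehler th i) (ddmehler th i x).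
Proof.
apply: is_derive_sumf => j; apply: is_derive_scalef.
have H := is_derive_scalef (- (cos th / sin th)) (is_derive_pdfO_level (j.2 i) th (x 0 i)).
exact: (@is_derive_prod_coord _ _
  (fun y => - (cos th / sin th) * pdfO (level (j.2 i) th y))
  (fun y => - (cos th / sin th) * (cos th / sin th * (zO (level (j.2 i) th y) * pdfO (level (j.2 i) th y))))
  (fun l y => PhiO (level (j.2 l) th y)) i x H).
Qed.

Lemma LmehlerE th x : Lmehler th x = \sum_(j <- J) j.1 * \sum_(i < n)
  heatL (j.2 i) th (x 0 i) * \prod_(l < n | l != i) PhiO (level (j.2 l) th (x 0 l)).
Proof.
rewrite /Lmehler; under [RHS]eq_bigr do rewrite mulr_sumr.
rewrite [RHS]exchange_big /=; apply: eq_bigr => i _.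
rewrite /ddmehler /dmehler mulr_sumr -sumrB; apply: eq_bigr => j _.
rewrite /heatL; ring.
Qed.

Lemma is_derive_mehler_angle th x : 0 < sin th -> 0 < cos th ->
  is_derive th (1 : R) (fun t => mehler t x) (sin th / cos th * Lmehler th x).
Proof.
move=> s0 c0; rewrite LmehlerE mulr_sumr.
have -> : \sum_(j <- J) sin th / cos th * (j.1 * \sum_(i < n)
  heatL (j.2 i) th (x 0 i) * \prod_(l < n | l != i) PhiO (level (j.2 l) th (x 0 l))) =
  \sum_(j <- J) (j.1 * \sum_(i < n)
  (sin th / cos th * heatL (j.2 i) th (x 0 i)) * \prod_(l < n | l != i) PhiO (level (j.2 l) th (x 0 l))).
  apply: eq_bigr => j _; rewrite mulrCA; congr (_ * _); rewrite mulr_sumr.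
  by apply: eq_bigr => i _; rewrite mulrA.
apply: is_derive_sumf => j; apply: is_derive_scalef.
exact: (@is_derive_prodf R _ _ (index_enum 'I_n) (fun i t => PhiO (level (j.2 i) t (x 0 i)))
  (fun i => sin th / cos th * heatL (j.2 i) th (x 0 i)) th 1 (index_enum_uniq _)
  (fun i => is_derive_PhiO_angle (j.2 i) (x 0 i) s0 c0)).
Qed.

(** A bound through [sin th] and [cos th] alone and monotone in both, hence a dominating constant on
    a compact range of angles. *)
Definition Lbound (s c : R) : R :=
  \sum_(j <- J) `|j.1| * \sum_(i < n) (`|zO (j.2 i)| / c + (s * c)^-1).

Lemma Lmehler_bound th x : 0 < sin th -> 0 < cos th ->
  `|sin th / cos th * Lmehler th x| <= Lbound (sin th) (cos th).
Proof.
move=> s0 c0; rewrite LmehlerE mulr_sumr (le_trans (ler_norm_sum _ _ _))//.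
apply: ler_sum => j _; rewrite mulrCA normrM ler_wpM2l// mulr_sumr.
rewrite (le_trans (ler_norm_sum _ _ _))//; apply: ler_sum => i _.
rewrite mulrA normrM (le_trans _ (heatL_bound (j.2 i) (x 0 i) s0 c0))//.
rewrite ler_piMr// -[leRHS](expr1n R n); apply: prod_norm_le => // l.
by rewrite ger0_norm ?PhiO_ge0// PhiO_le1.
Qed.

Lemma Lbound_mono (s c s' c' : R) : 0 < s' <= s -> 0 < c' <= c -> Lbound s c <= Lbound s' c'.
Proof.
move=> /andP[s0 s1] /andP[c0 c1]; apply: ler_sum => j _; apply: ler_wpM2l => //.
have s2 := lt_le_trans s0 s1; have c2 := lt_le_trans c0 c1.
apply: ler_sum => i _; apply: lerD; first by rewrite ler_wpM2l// lef_pV2.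
by rewrite lef_pV2 ?posrE ?mulr_gt0// ler_pM// ltW.
Qed.

(** By Mehler's formula [mehler th x] is the Gaussian mean of
    [y |-> comb J n (cos th x + sin th y)], and as a function of [y] this is again a combination of
    orthants, with moved levels. So [mehler] and [tan th] times its gradient are the mean and the
    barycentre of [shifted th x], and estimates on these transfer. *)
Definition shifted th (x : nat -> R) : seq (R * (nat -> option R)) :=
  [seq (j.1, fun i => level (j.2 i) th (x i)) | j <- J].

Lemma comb_shifted th x y : 0 < sin th ->
  comb (shifted th x) n y = comb J n (fun i => cos th * x i + sin th * y i).
Proof.
move=> s0; rewrite /comb /shifted big_map; apply: eq_bigr => j _ /=; congr (_ * _).
by apply: eq_bigr => i _; rewrite below_level.
Qed.

Lemma mehlerE th (x : Rinf R) : mehler th (rowof x) = gcomb (shifted th x) n.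
Proof.
rewrite /gcomb /shifted big_map; apply: eq_bigr => j _ /=; congr (_ * _).
by apply: eq_bigr => i _; rewrite mxE.
Qed.

Lemma dmehlerE th (x : Rinf R) i : 0 < sin th -> 0 < cos th ->
  sin th / cos th * dmehler th i (rowof x) = gcomb1 (shifted th x) i.
Proof.
move=> s0 c0; rewrite /gcomb1 /shifted big_map mulr_sumr; apply: eq_bigr => j _ /=.
rewrite mulrCA; congr (_ * _); rewrite mulrA mxE.
rewrite (_ : sin th / cos th * _ = - pdfO (level (j.2 i) th (x i))); last first.
  by field; rewrite !gt_eqF.
by congr (_ * _); apply: eq_bigr => l _; rewrite mxE.
Qed.

Hypothesis J01 : forall x : nat -> R, 0 <= comb J n x <= 1.

Lemma shifted01 th x : 0 < sin th -> forall y, 0 <= comb (shifted th x) n y <= 1.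
Proof. by move=> s0 y; rewrite comb_shifted. Qed.

Lemma mehler_row01 th (x : Rinf R) : 0 < sin th -> 0 <= mehler th (rowof x) <= 1.
Proof.
move=> s0; rewrite mehlerE (gcomb_ge0 hgamma (shifted01 x s0)).
by rewrite (gcomb_le1 hgamma (shifted01 x s0)).
Qed.

Lemma rowof_surj (y : 'rV[R]_n) : exists x : Rinf R, rowof x = y.
Proof.
exists (fun i : nat => if insub i is Some k then y 0 k else 0).
by apply/rowP => i; rewrite mxE valK.
Qed.

Lemma mehler01 th y : 0 < sin th -> 0 <= mehler th y <= 1.
Proof. by move=> s0; have [x <-] := rowof_surj y; exact: mehler_row01. Qed.

Lemma measurable_mehler th : measurable_fun setT (fun x : Rinf R => mehler th (rowof x)).
Proof.
rewrite (_ : (fun x : Rinf R => _) = (fun x : Rinf R =>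
  \sum_(j <- J) j.1 * \prod_(i < n) PhiO (level (j.2 i) th (x i)))); last first.
  apply/funext => x; apply: eq_bigr => j _; congr (_ * _).
  by apply: eq_bigr => i _; rewrite mxE.
apply: measurable_sum => j; apply: measurable_funM; first exact: measurable_cst.
apply: measurable_prod => i _.
apply: (@measurableT_comp _ _ _ _ _ _ (fun y => PhiO (level (j.2 i) th y))).
  apply: continuous_measurable_fun; exact: Cb_cont (Cbline_PhiO_level 0 (j.2 i) th).
exact: measurable_coord.
Qed.

Lemma dmehler_bound eps th (x : Rinf R) : 0 < sin th -> 0 < cos th -> 0 < eps <= 1 ->
  let G := mehler th (rowof x) + eps in
  (sin th / cos th) ^+ 2 * \sum_i dmehler th i (rowof x) ^+ 2 <= 2 * G ^+ 2 * (2 - ln G).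
Proof.
move=> s0 c0 e01 /=; rewrite mulr_sumr mehlerE.
rewrite (eq_bigr (fun i => gcomb1 (shifted th x) i ^+ 2)).
  exact: (barycentre_bound hgamma (shifted01 x s0)).
by move=> i _; rewrite -exprMn dmehlerE.
Qed.

Section angle_derivative.
Variables (v : Rinf R -> Rinf R) (mu : probability (Rinf R) R).
Hypotheses (hv_meas : measurable_fun setT v) (hv_l2 : forall x, in_l2 (v x)).
Hypothesis hv_L1 : mu.-integrable setT (fun x => (normH (v x))%:E).
Hypothesis hmu : forall (n : nat) (phi : Rinf R -> R), FC0 n phi ->
  (\int[mu]_x (drift_OU v n phi x)%:E = 0)%E.
Variables (al eps : R).
Hypotheses (al01 : 0 < al <= 1) (eps01 : 0 < eps <= 1).

Let e0 : 0 < eps. Proof. by case/andP: eps01. Qed.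
Let a0 : 0 < al. Proof. by case/andP: al01. Qed.
Let a1 : al <= 1. Proof. by case/andP: al01. Qed.

Definition energy th : R := \int[mu]_x ((mehler th (rowof x) + eps) `^ al).

Lemma sin_cos_gt0 th : 0 < th < pi / 2 -> 0 < sin th /\ 0 < cos th.
Proof.
move=> /andP[t0 t1]; split; last by apply: cos_gt0_pihalf; rewrite t1 andbT; lra.
by apply: sin_gt0_pi; rewrite t0 /=; have := pi_gt0 R; lra.
Qed.

Lemma powR_shift_le (g b : R) : 0 <= g -> b <= 0 -> (g + eps) `^ b <= eps `^ b.
Proof.
move=> g0 b0; rewrite -[b]opprK.
have : 0 <= - b by rewrite oppr_ge0.
move: (- b) => c c0; rewrite !powRN lef_pV2 ?posrE ?powR_gt0//; last by rewrite ltr_wpDl.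
by rewrite ge0_ler_powR// ?nnegrE ?addr_ge0 ?lerDr// ltW.
Qed.

(** The equation tested on [G^al]: since [G >= eps], negative powers are bounded and [drift_eq]
    applies. The middle term comes from the second derivative of the power. *)
Lemma energy_drift th : 0 < th < pi / 2 ->
  let G (x : Rinf R) := mehler th (rowof x) + eps in
  has_integral mu (fun x => al * G x `^ (al - 1) * Lmehler th (rowof x) +
    al * (al - 1) * G x `^ (al - 2) * \sum_i dmehler th i (rowof x) ^+ 2 +
    al * G x `^ (al - 1) * \sum_(i < n) v x i * dmehler th i (rowof x)) 0.
Proof.
have a0' := a0; have a1' := a1.
move=> /sin_cos_gt0[s0 c0] G; pose g (y : 'rV[R]_n) := mehler th y + eps.
have m0 y : 0 <= mehler th y by have /andP[] := mehler01 y s0.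
have g0 y : eps <= g y by rewrite lerDr.
have gp y : 0 < g y by exact: lt_le_trans (g0 y).
have Cg k : Cb basis k g by apply: Cb_add; [exact: Cb_mehler|exact: Cb_cst].
have dg i y : is_derive y (basis i) g (dmehler th i y).
  apply: (is_derive_eq (is_derive_addf (is_derive_mehler th i y) (is_derive_cst _ _ _))).
  by rewrite addr0.
have dpow b i y : is_derive y (basis i) (fun y => g y `^ b) (b * g y `^ (b - 1) * dmehler th i y).
  by apply: (@is_derive_comp1 _ _ (fun s => s `^ b)) => //; exact: is_derive1_powR.
pose df i y := al * g y `^ (al - 1) * dmehler th i y.
pose ddf i y := al * g y `^ (al - 1) * ddmehler th i y +
  dmehler th i y * (al * ((al - 1) * g y `^ (al - 1 - 1) * dmehler th i y)).
have ddP i y : is_derive y (basis i) (df i) (ddf i y).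
  have H1 := is_derive_scalef al (dpow (al - 1) i y).
  exact: (is_derive_mulf H1 (is_derive_dmehler th i y)).
have LE y : \sum_i (ddf i y - y 0 i * df i y) = al * g y `^ (al - 1) * Lmehler th y +
    al * (al - 1) * g y `^ (al - 2) * \sum_i dmehler th i y ^+ 2.
  rewrite /Lmehler !mulr_sumr -big_split /=; apply: eq_bigr => i _.
  rewrite /ddf /df (_ : al - 1 - 1 = al - 2); ring.
have [B B0 HB] := Cb_coord_bound (Cb_mehler 1 th) (is_derive_mehler th).
pose M := eps `^ (al - 1) * (cos th / sin th * Lbound (sin th) (cos th)) +
  eps `^ (al - 2) * (n%:R * B ^+ 2).
have bL y : `|\sum_i (ddf i y - y 0 i * df i y)| <= M.
  rewrite LE (le_trans (ler_normD _ _))// lerD//.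
    rewrite normrM ler_pM//.
      rewrite ger0_norm ?mulr_ge0 ?powR_ge0 ?(ltW a0)// (le_trans (ler_piMl _ a1))//.
        exact: powR_ge0.
      by apply: powR_shift_le => //; rewrite subr_le0.
    have := Lmehler_bound y s0 c0.
    rewrite normrM [ `|sin th / cos th|]gtr0_norm ?divr_gt0// -ler_pdivlMl ?divr_gt0//.
    by rewrite invf_div.
  rewrite normrM ler_pM//.
    rewrite normrM [ `|_ `^ _|]ger0_norm ?powR_ge0//.
    rewrite -[leRHS]mul1r ler_pM ?powR_ge0//.
      by rewrite normrM mulr_ile1// ler_norml; apply/andP; split; lra.
    by apply: powR_shift_le => //; lra.
  rewrite ger0_norm; last by apply: sumr_ge0 => i _; exact: sqr_ge0.
  rewrite -[n in leRHS]card_ord mulr_natl -sumr_const; apply: ler_sum => i _.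
  rewrite -[leLHS]real_normK ?num_real// lerXn2r ?nnegrE//.
  by have [_] := HB y.
have mg : measurable_fun setT (fun x : Rinf R => g (rowof x) `^ al).
  apply: (@measurableT_comp _ _ _ _ _ _ (fun s : R => s `^ al)); first exact: measurable_powR.
  by apply: measurable_funD; [exact: measurable_mehler|exact: measurable_cst].
have [I0 I1] := drift_eq hv_meas hv_l2 hv_L1 hmu
  (fun k => Cb_powR al e0 g0 (Cg k)) (fun i y => dpow al i y) ddP mg bL.
have ri (x : Rinf R) (i : 'I_n) : rowof x 0 i = x i by rewrite mxE.
have E (x : Rinf R) : \sum_(i < n) (ddf i (rowof x) - x i * df i (rowof x)) +
   \sum_(i < n) v x i * df i (rowof x) =
   al * G x `^ (al - 1) * Lmehler th (rowof x) +
    al * (al - 1) * G x `^ (al - 2) * \sum_i dmehler th i (rowof x) ^+ 2 +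
    al * G x `^ (al - 1) * \sum_(i < n) v x i * dmehler th i (rowof x).
  rewrite /G -/(g _) -LE; congr (_ + _); first by apply: eq_bigr => i _; rewrite ri.
  by rewrite mulr_sumr; apply: eq_bigr => i _; rewrite /df; ring.
by apply: (has_integral_ext E).
Qed.

End angle_derivative.
End mehler.

(** * Limits at the angles 0 and [pi / 2] *)

Section limits.
Context {R : realType}.

Lemma cvg_prodr (T : Type) (F : set_system T) (FF : Filter F) (I : Type) (s : seq I)
    (f : I -> T -> R) (a : I -> R) : (forall i, f i x @[x --> F] --> a i) ->
  (\prod_(i <- s) f i x) @[x --> F] --> \prod_(i <- s) a i.
Proof.
move=> H; elim: s => [|i s IH].
  by rewrite big_nil; under eq_fun do rewrite big_nil; exact: cvg_cst.
by rewrite big_cons; under eq_fun do rewrite big_cons; exact: cvgM.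
Qed.

Lemma cvg_sumr (T : Type) (F : set_system T) (FF : Filter F) (I : Type) (s : seq I)
    (f : I -> T -> R) (a : I -> R) : (forall i, f i x @[x --> F] --> a i) ->
  (\sum_(i <- s) f i x) @[x --> F] --> \sum_(i <- s) a i.
Proof.
move=> H; elim: s => [|i s IH].
  by rewrite big_nil; under eq_fun do rewrite big_nil; exact: cvg_cst.
by rewrite big_cons; under eq_fun do rewrite big_cons; exact: cvgD.
Qed.

Lemma bounded_cvg_Rintegral d (T : measurableType d) (P : probability T R)
    (f_ : nat -> T -> R) (f : T -> R) (M : R) :
  (forall k, measurable_fun setT (f_ k)) -> measurable_fun setT f ->
  (forall k x, `|f_ k x| <= M) ->
  {ae P, forall x, f_ k x @[k --> \oo] --> f x} ->
  \int[P]_x f_ k x @[k --> \oo] --> \int[P]_x f x.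
Proof.
move=> mf_ mf bf cf.
have cfE : {ae P, forall x, setT x -> (f_ ^~ x k)%:E @[k --> \oo] --> (f x)%:E}.
  apply: filterS cf => x cx _; apply: cvg_EFin => //; exact: nearW.
have [i0 _ lim] := @dominated_convergence _ _ R P setT measurableT
  (fun m x => (f_ m x)%:E) (fun x => (f x)%:E) (fun=> M%:E)
  (fun m => (measurable_EFinP _ _).2 (mf_ m)) ((measurable_EFinP _ _).2 mf)
  cfE
  (finite_measure_integrable_cst P M measurableT) (aeW _ (fun x m _ => bf m x)).
rewrite /Rintegral; apply: fine_cvg; rewrite fineK//; exact: integrable_fin_num i0.
Qed.

(** The shift by two puts both [small k] and [pi / 2 - small k] strictly between 0 and [pi / 2],
    where sine and cosine are positive. *)
Definition small (k : nat) : R := k.+2%:R^-1.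

Lemma small_gt0 k : 0 < small k.
Proof. by rewrite invr_gt0 ltr0n. Qed.

Lemma small_lt_pihalf k : small k < pi / 2.
Proof.
have p1 := pihalf_ge1 R; apply: lt_le_trans p1.
by rewrite invf_lt1 ?ltr0n// ltr1n.
Qed.

Lemma cvg_small : small k @[k --> \oo] --> (0 : R).
Proof.
have := @cvg_harmonic R; rewrite -(cvg_shiftS (@harmonic R)).
by apply: cvg_trans.
Qed.

Lemma cvg_PhiO_pihalf (c : option R) (y : R) :
  PhiO (level c (pi / 2 - small k) y) @[k --> \oo] --> PhiO c.
Proof.
case: c => [a|] /=; last exact: cvg_cst.
have ck : pi / 2 - small k @[k --> \oo] --> (pi / 2 : R).
  rewrite -[X in _ --> X]subr0; apply: cvgB; [exact: cvg_cst|exact: cvg_small].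
have cc : cos (pi / 2 - small k) @[k --> \oo] --> (0 : R).
  by rewrite -cos_pihalf; apply: continuous_cvg => //; exact: continuous_cos.
have cs : sin (pi / 2 - small k) @[k --> \oo] --> (1 : R).
  rewrite -[X in _ --> X]sin_pihalf; apply: continuous_cvg => //. exact: continuous_sin.
have cP : continuous (@Phi R) by exact: Cb_cont (Cbline_Phi 0).
apply: continuous_cvg; first exact: cP.
rewrite [X in _ --> X](_ : a = (a - 0 * y) / 1); last by rewrite mul0r subr0 divr1.
apply: cvgM; last by apply: cvgV => //; exact: oner_neq0.
by apply: cvgB; [exact: cvg_cst|exact: cvgMl].
Qed.

(** The level tends to [+oo] or [-oo] according to the sign of [c - y]. At [y = c] it is
    [c tan (th / 2)], and [PhiO] would tend to [Phi 0] instead of 1: the boundary is a genuine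
    exception. *)
Lemma cvg_PhiO_0 (c : option R) (y : R) : c <> Some y ->
  PhiO (level c (small k) y) @[k --> \oo] --> below c y.
Proof.
case: c => [a|] /= ay; last exact: cvg_cst.
have {}ay : y != a by apply/eqP => E; apply: ay; rewrite E.
have cc : cos (small k) @[k --> \oo] --> (1 : R).
  rewrite -[X in _ --> X]cos0; apply: continuous_cvg; [exact: continuous_cos|exact: cvg_small].
have cs : sin (small k) @[k --> \oo] --> (0 : R).
  rewrite -[X in _ --> X]sin0; apply: continuous_cvg; [exact: continuous_sin|exact: cvg_small].
have s0 k : 0 < sin (small k).
  by have [] := @sin_cos_gt0 R (small k); rewrite ?small_gt0 ?small_lt_pihalf.
have ch (M : R) : (a - cos (small k) * y) - M * sin (small k) @[k --> \oo] --> (a - y).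
  rewrite [X in _ --> X](_ : a - y = a - 1 * y - M * 0); last by rewrite mul1r mulr0 subr0.
  by apply: cvgB; [apply: cvgB; [exact: cvg_cst|exact: cvgMl]|exact: cvgMr].
case: ltgtP ay => // ya _.
- apply: (cvg_comp _ _ _ cvg_Phiy); apply/cvgryPgt => M.
  near=> k; rewrite ltr_pdivlMr// -subr_gt0.
  near: k; apply: (cvgr_gt (a - y)); first exact: ch.
  by rewrite subr_gt0.
- apply: (cvg_comp _ _ _ cvg_PhiNy); apply/cvgrNyPlt => M.
  near=> k; rewrite ltr_pdivrMr// -subr_lt0.
  near: k; apply: (cvgr_lt (a - y)); first exact: ch.
  by rewrite subr_lt0.
Unshelve. all: by end_near. Qed.

End limits.

(** * The rate of change of the energy in the angle *)

Section energy_derivative.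
Context {R : realType} (gamma : probability (Rinf R) R).
Hypothesis hgamma : std_gaussian_power gamma.
Variables (n : nat) (J : seq (R * (nat -> option R))).
Hypothesis J01 : forall x : nat -> R, 0 <= comb J n x <= 1.
Variables (v : Rinf R -> Rinf R) (mu : probability (Rinf R) R).
Hypotheses (hv_meas : measurable_fun setT v) (hv_l2 : forall x, in_l2 (v x)).
Hypothesis hv_L1 : mu.-integrable setT (fun x => (normH (v x))%:E).
Hypothesis hmu : forall (n : nat) (phi : Rinf R -> R), FC0 n phi ->
  (\int[mu]_x (drift_OU v n phi x)%:E = 0)%E.
Variables (al eps : R).
Hypotheses (al01 : 0 < al <= 1) (eps01 : 0 < eps <= 1).
Local Notation rowof := (@rowof R n).
Local Notation mehler := (@mehler R n J).
Local Notation energy := (@energy R n J mu al eps).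

Lemma shift_bounds th (x : Rinf R) : 0 < sin th -> eps <= mehler th (rowof x) + eps <= 2.
Proof.
move=> s0; have /andP[h0 h1] := mehler_row01 hgamma J01 x s0.
by move: eps01 => /andP[? ?]; apply/andP; split; lra.
Qed.

(** The derivative is the integral of [al G^(al-1) tan th L G]. Comparison with [tan th] times the
    null integral of [energy_drift] leaves the second-order term, of the good sign since [al <= 1],
    and the drift term; any integrable majorant [b] of the latter bounds the rate. *)
Lemma energy_derive th : 0 < th < pi / 2 ->
  exists u', is_derive th (1 : R) energy u' /\
    forall (b : Rinf R -> R) S, has_integral mu b S ->
    (forall x, let G := mehler th (rowof x) + eps in
      al * G `^ al * Num.sqrt (2 * (2 - ln G)) * normH (v x) <= b x) -> - S <= u'.
Proof.
move=> th01; have [s0 c0] := sin_cos_gt0 th01.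
have /andP[a0 a1] := al01; have /andP[e0 e1] := eps01; have /andP[t0 t1] := th01.
(* A range of angles on which [Lbound] is dominated by its value at [sin lo] and [cos hi], for
   differentiation under the integral. *)
pose lo := th / 2; pose hi := (th + pi / 2) / 2.
have lo0 : 0 < lo by rewrite /lo; lra.
have hi1 : hi < pi / 2 by rewrite /hi; lra.
have lohi : lo < th < hi by rewrite /lo /hi; apply/andP; split; lra.
have in01 t : lo < t < hi -> 0 < t < pi / 2.
  by move=> /andP[h1 h2]; apply/andP; split; lra.
have sl : 0 < sin lo by have [] := @sin_cos_gt0 R lo; rewrite ?lo0 /lo//; lra.
have ch : 0 < cos hi.
  have [] // := @sin_cos_gt0 R hi; rewrite hi1 andbT /hi; lra.
pose G t (x : Rinf R) : R := mehler t (rowof x) + eps.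
have Gp t x : lo < t < hi -> 0 < G t x.
  move=> /in01/sin_cos_gt0[st ct].
  by have /andP[h _] := shift_bounds x st; exact: lt_le_trans e0 h.
have dG t x : lo < t < hi -> is_derive t (1 : R) (fun t => G t x `^ al)
    (al * G t x `^ (al - 1) * (sin t / cos t * Lmehler J t (rowof x))).
  move=> tt; have /in01/sin_cos_gt0[st ct] := tt.
  apply: (@is_derive_comp1 _ _ (fun s => s `^ al) (fun t => G t x)).
    by apply: is_derive1_powR; exact: Gp.
  apply: (is_derive_eq (is_derive_addf (is_derive_mehler_angle J (rowof x) st ct) (is_derive_cst _ _ _))).
  by rewrite addr0.
have mG t : measurable_fun setT (fun x => G t x `^ al).
  apply: (@measurableT_comp _ _ _ _ _ _ (fun s : R => s `^ al)); first exact: measurable_powR.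
  by apply: measurable_funD; [exact: measurable_mehler|exact: measurable_cst].
have bG t x : lo < t < hi -> `|G t x `^ al| <= 2 `^ al.
  move=> tt; have /in01/sin_cos_gt0[st ct] := tt.
  rewrite ger0_norm ?powR_ge0// ge0_ler_powR ?nnegrE ?(ltW a0) ?(ltW (Gp _ _ _))//.
  by have /andP[] := shift_bounds x st.
pose B : R := eps `^ (al - 1) * Lbound n J (sin lo) (cos hi).
have d1 t x : lo < t < hi -> partial1of2 (fun t x => G t x `^ al) t x =
   al * G t x `^ (al - 1) * (sin t / cos t * Lmehler J t (rowof x)).
  by move=> tt; rewrite partial1of2E; case: (dG t x tt).
have bA t x : lo < t < hi ->
    `|al * G t x `^ (al - 1) * (sin t / cos t * Lmehler J t (rowof x))| <= B.
  move=> tt; have /andP[tl tr] := tt; have /in01/sin_cos_gt0[st ct] := tt.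
  have /andP[m0 _] := mehler_row01 hgamma J01 x st.
  rewrite normrM ler_pM//.
    rewrite ger0_norm ?mulr_ge0 ?powR_ge0 ?(ltW a0)// (le_trans (ler_piMl (powR_ge0 _ _) a1))//.
    by apply: powR_shift_le => //; rewrite subr_le0.
  apply: (le_trans (Lmehler_bound J (rowof x) st ct)); apply: Lbound_mono.
    rewrite sl /= ltW// ltr_sin ?in_itv /= //; apply/andP; split; lra.
  rewrite ch /= ltW// ltr_cos ?in_itv /= //; apply/andP; split; lra.
have intG t : lo < t < hi -> mu.-integrable setT (EFin \o (fun x => G t x `^ al)).
  by move=> tt; have [a []] := has_integral_bounded mu (mG t) (fun x => bG t x tt).
have B0 : 0 <= B by apply: le_trans (bA th (fun=> 0) lohi).
have inI t : `]lo, hi[%classic t -> lo < t < hi by rewrite /= in_itv.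
have Ith : `]lo, hi[%classic th by rewrite /= in_itv.
have intI t (It : `]lo, hi[%classic t) := intG t (inI t It).
have derI t (x : Rinf R) : `]lo, hi[%classic t -> setT x -> derivable (fun t => G t x `^ al) t 1.
  by move=> It _; case: (dG t x (inI t It)).
have bI t (x : Rinf R) : `]lo, hi[%classic t -> setT x ->
    `|partial1of2 (fun t x => G t x `^ al) t x| <= B.
  move=> It _; rewrite (d1 t x (inI t It)); exact: bA (inI t It).
have iB := finite_measure_integrable_cst mu B measurableT.
have D1 := derivable_under_integral measurableT Ith intI derI (fun=> B0) iB bI.
have D2 := differentiation_under_integral measurableT Ith intI derI (fun=> B0) iB bI.
pose A x := al * G th x `^ (al - 1) * (sin th / cos th * Lmehler J th (rowof x)).
have mdm i : measurable_fun setT (fun x => dmehler J th i (rowof x)).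
  by apply: (measurable_derive_rowof (is_derive_mehler J th i)); exact: measurable_mehler.
have mddm i : measurable_fun setT (fun x => ddmehler J th i (rowof x)).
  by apply: (measurable_derive_rowof (is_derive_dmehler J th i)); exact: mdm.
have mA : measurable_fun setT A.
  apply: measurable_funM.
    apply: measurable_funM; first exact: measurable_cst.
    apply: (@measurableT_comp _ _ _ _ _ _ (fun s : R => s `^ (al - 1))); first exact: measurable_powR.
    by apply: measurable_funD; [exact: measurable_mehler|exact: measurable_cst].
  apply: measurable_funM; first exact: measurable_cst.
  apply: measurable_sum => i; apply: measurable_funB => //; apply: measurable_funM => //.
  rewrite (_ : (fun x : Rinf R => _) = (fun x : Rinf R => x i)); first exact: measurable_coord.
  by apply/funext => x; rewrite mxE.
have [u' Hu'] := has_integral_bounded mu mA (fun x => bA th x lohi).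
exists u'; split.
  split; first exact: D1.
  rewrite -derive1E D2 (_ : (fun x => _) = A); first by case: Hu' => _ E; rewrite /Rintegral E.
  by apply/funext => x; rewrite d1.
move=> b S Hb bb.
have H0 := has_integralZ (sin th / cos th)
  (energy_drift hgamma J01 hv_meas hv_l2 hv_L1 hmu al01 eps01 th01).
have := has_integralB H0 Hb; rewrite mulr0 sub0r => H1.
apply: (has_integral_le H1 Hu') => x.
set t := sin th / cos th; have tp : 0 < t by rewrite divr_gt0.
rewrite /A -/(G th x); set g := G th x; have gp : 0 < g by exact: Gp.
have /andP[ge g2] := shift_bounds x s0; rewrite -/(G th x) -/g in ge g2.
set P1 := g `^ (al - 1); set P2 := g `^ (al - 2).
have P10 : 0 <= P1 by exact: powR_ge0.
have P20 : 0 <= P2 by exact: powR_ge0.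
set Q := \sum_i _ ^+ 2; have Q0 : 0 <= Q by apply: sumr_ge0 => i _; exact: sqr_ge0.
set V := \sum_(i < n) v x i * _.
have L0 : 0 <= 2 * (2 - ln g).
  have : ln g <= g - 1 by have := @le_ln1Dx R (g - 1); rewrite subrKC; apply; lra.
  by move=> h; rewrite mulr_ge0//; lra.
pose q := Num.sqrt (2 * (2 - ln g)); have q0 : 0 <= q by exact: sqrtr_ge0.
have VB : `|V| <= normH (v x) * (t^-1 * (g * q)).
  apply: inner_le_normH => //.
    by rewrite mulr_ge0 ?invr_ge0 ?(ltW tp)// mulr_ge0// ltW.
  have := dmehler_bound hgamma J01 x s0 c0 eps01; rewrite -/(G th x) -/g -/t -/Q => H.
  rewrite !exprMn exprVn -ler_pdivrMl ?invr_gt0 ?exprn_gt0// invrK.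
  by rewrite /q sqr_sqrtr//; apply: (le_trans H); rewrite [leRHS]mulrCA mulrA.
have E1 : P1 * g = g `^ al.
  by rewrite -[X in _ * X](powRr1 (ltW gp)) -powRD ?subrK// (gt_eqF gp) implybT.
have V1 : t * (al * P1 * V) <= b x.
  apply: le_trans (bb x); rewrite -/g -/q /= -E1.
  apply: (@le_trans _ _ (t * (al * P1 * (normH (v x) * (t^-1 * (g * q)))))).
    rewrite ler_pM2l// ler_wpM2l//; first by rewrite mulr_ge0// ltW.
    exact: le_trans (ler_norm _) VB.
  rewrite le_eqVlt; apply/orP; left; apply/eqP; field; by rewrite gt_eqF.
have V2 : t * (al * (al - 1) * P2 * Q) <= 0.
  rewrite pmulr_rle0//; rewrite mulr_le0_ge0// mulr_le0_ge0// mulr_ge0_le0 ?subr_le0//.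
  exact: ltW.
rewrite -/P1.
have -> : t * (al * P1 * Lmehler J th (rowof x) + al * (al - 1) * P2 * Q + al * P1 * V) =
  t * (al * P1 * V) + t * (al * (al - 1) * P2 * Q) + al * P1 * (t * Lmehler J th (rowof x)) by ring.
move: V1 V2; move: (t * (al * P1 * V)) (t * (al * (al - 1) * P2 * Q)).
move: (al * P1 * (t * _)) (b x) => X Y Z W; lra.
Qed.

End energy_derivative.

Section elementary.
Context {R : realType}.
Implicit Types (s u : R).

Lemma ln_le_sub1 s : 0 < s -> ln s <= s - 1.
Proof. by move=> s0; have := @le_ln1Dx R (s - 1); rewrite subrKC; apply; lra. Qed.

Lemma mul_ln_inv_le1 s : 0 < s -> s * - ln s <= 1.
Proof.
move=> s0; have := @ln_le_sub1 s^-1; rewrite invr_gt0 lnV ?posrE// => /(_ s0) h.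
have : s * - ln s <= s * (s^-1 - 1) by rewrite ler_pM2l.
by rewrite mulrBr mulr1 divff ?gt_eqF// => h2; lra.
Qed.

(** The square is at most [18 al]: with [P = g^al <= 2], the inequality [- s ln s <= 1] at [s = P^2]
    bounds [al P^2 (- ln g)], so the logarithm does no harm for small [g]. *)
Lemma powR_entropy_le (al g : R) : 0 < al <= 1 -> 0 < g <= 2 ->
  al * g `^ al * Num.sqrt (2 * (2 - ln g)) <= 5 * Num.sqrt al.
Proof.
move=> /andP[a0 a1] /andP[g0 g2].
set P := g `^ al; have P0 : 0 < P by exact: powR_gt0.
have P2 : P <= 2.
  rewrite (le_trans (ge0_ler_powR (ltW a0) _ _ g2)) ?nnegrE ?(ltW g0)//.
  by rewrite ler1_powR// ler1n.
have L0 : 0 <= 2 * (2 - ln g) by have := ln_le_sub1 g0; lra.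
rewrite -(ler_pXn2r (n := 2))// ?nnegrE ?mulr_ge0 ?sqrtr_ge0 ?(ltW a0) ?(ltW P0)//.
rewrite !exprMn !sqr_sqrtr ?(ltW a0)//.
have h : al * (P ^+ 2 * - ln g) <= 1.
  have := mul_ln_inv_le1 (exprn_gt0 2 P0); rewrite lnXn// ln_powR -mulr_natl => H.
  have : P ^+ 2 * al * - ln g * 2 <= 1 by apply: le_trans H; rewrite le_eqVlt; apply/orP; left; apply/eqP; ring.
  have := exprn_ge0 2 (ltW P0); nra.
have PP : P ^+ 2 <= 4 by rewrite (_ : 4 = 2 ^+ 2 :> R) ?lerXn2r ?nnegrE ?(ltW P0)//; ring.
have -> : al ^+ 2 * P ^+ 2 * (2 * (2 - ln g)) = al * (4 * al * P ^+ 2 + 2 * (al * (P ^+ 2 * - ln g))) by ring.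
rewrite mulrC ler_pM2r//.
have : al * P ^+ 2 <= 1 * 4 by rewrite ler_pM ?exprn_ge0// ltW.
lra.
Qed.

(** The tangent at [u] of the concave function [g (2 - ln g)]. When [u] is the mean of [g], the
    right side has integral [u (2 - ln u)]: a pointwise form of Jensen's inequality. *)
Lemma entropy_tangent g u : 0 < g -> 0 < u -> g * (2 - ln g) <= g * (1 - ln u) + u.
Proof.
move=> g0 u0; have := @ln_le_sub1 (u / g) (divr_gt0 u0 g0); rewrite ln_div ?posrE// => h.
have : g * (ln u - ln g) <= g * (u / g - 1) by rewrite ler_pM2l.
rewrite mulrBr (mulrBr g (u / g)) mulr1 mulrCA divff ?gt_eqF// mulr1 => h2; lra.
Qed.

End elementary.

Lemma ae_cvg_mehler0 {R : realType} (mu : probability (Rinf R) R) n J :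
  (forall i c, mu [set x : Rinf R | x i = c] = 0%E) ->
  {ae mu, forall x : Rinf R, mehler J (small k) (@rowof R n x) @[k --> \oo] --> comb J n x}.
Proof.
move=> na; elim: J => [|j J IH].
  apply: aeW => x; rewrite /mehler /comb big_nil.
  by under eq_fun do rewrite big_nil; exact: cvg_cst.
have H : {ae mu, forall x : Rinf R, forall i : 'I_n, j.2 i <> Some (x i)}.
  apply: (@filter_forall (Rinf R) _ (fun (i : 'I_n) (x : Rinf R) => j.2 i <> Some (x i)) _
    (ae_filter_ringOfSetsType mu)) => i.
  case E : (j.2 i) => [c|]; last by apply: aeW.
  exists [set x : Rinf R | x i = c]; split.
  - have := @measurable_coord R i measurableT [set c] (measurable_set1 c).
    by rewrite setTI.
  - exact: na.
  - by move=> x /= /contrapT[].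
apply: filterS2 IH H => x IH Hx.
rewrite /mehler /comb big_cons; under eq_fun do rewrite big_cons.
apply: cvgD; last exact: IH.
apply: cvgMr; apply: cvg_prodr => i; rewrite mxE; exact: cvg_PhiO_0.
Qed.

(** * Integration of the differential inequalities in the angle *)

Section energy_estimates.
Context {R : realType} (gamma : probability (Rinf R) R).
Hypothesis hgamma : std_gaussian_power gamma.
Variables (n : nat) (J : seq (R * (nat -> option R))).
Hypothesis J01 : forall x : nat -> R, 0 <= comb J n x <= 1.
Variables (v : Rinf R -> Rinf R) (mu : probability (Rinf R) R).
Hypotheses (hv_meas : measurable_fun setT v) (hv_l2 : forall x, in_l2 (v x)).
Hypothesis hv_L1 : mu.-integrable setT (fun x => (normH (v x))%:E).
Hypothesis hmu : forall (n : nat) (phi : Rinf R -> R), FC0 n phi ->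
  (\int[mu]_x (drift_OU v n phi x)%:E = 0)%E.
Local Notation rowof := (@rowof R n).
Local Notation mehler := (@mehler R n J).

Lemma MVT_lower (f : R -> R) (c a b : R) : a < b ->
  (forall t, a <= t <= b -> exists2 f', is_derive t (1 : R) f f' & - c <= f') ->
  f a - f b <= c * (b - a).
Proof.
move=> ab H.
have [df Hdf] : exists df : R -> R, forall t, a <= t <= b -> is_derive t (1 : R) f (df t) /\ - c <= df t.
  have /choice[df Hdf] : forall t, exists d, a <= t <= b -> is_derive t (1 : R) f d /\ - c <= d.
    move=> t; have [tt|nt] := boolP (a <= t <= b).
      by have [d d1 d2] := H t tt; exists d.
    by exists 0.
  by exists df.
have [|x xab|t tab E] := @MVT R f df a b ab.
- move=> x; rewrite in_itv /= => /andP[h1 h2]; have [|//] := Hdf x.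
  by rewrite !ltW.
- by apply: derivable_within_continuous => t; rewrite in_itv /= => /Hdf[[]].
- move: tab; rewrite in_itv /= => /andP[h1 h2].
  have [|_ h] := Hdf t; first by rewrite !ltW.
  rewrite -opprB E -mulNr ler_wpM2r ?subr_ge0 ?(ltW ab)//; lra.
Qed.

Section fixed_exponent.
Variables (al eps : R).
Hypotheses (al01 : 0 < al <= 1) (eps01 : 0 < eps <= 1).
Local Notation energy := (@energy R n J mu al eps).

Let measurable_Gal th : measurable_fun setT (fun x => (mehler th (rowof x) + eps) `^ al).
Proof.
apply: (@measurableT_comp _ _ _ _ _ _ (fun s : R => s `^ al)); first exact: measurable_powR.
by apply: measurable_funD; [exact: measurable_mehler|exact: measurable_cst].
Qed.

Let bounded_Gal th x : 0 < sin th -> `|(mehler th (rowof x) + eps) `^ al| <= 2 `^ al.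
Proof.
move=> s0; have /andP[h1 h2] := shift_bounds hgamma J01 eps01 x s0.
have /andP[a0 a1] := al01; have /andP[e0 e1] := eps01.
rewrite ger0_norm ?powR_ge0// ge0_ler_powR ?nnegrE ?(ltW a0)//.
by rewrite (le_trans (ltW e0)).
Qed.

Lemma pihalf_small k : 0 < (pi / 2 - small k : R) < pi / 2.
Proof.
have := @small_lt_pihalf R k; have := @small_gt0 R k => h1 h2.
by apply/andP; split; lra.
Qed.

Lemma energy_bounds th : 0 < sin th ->
  has_integral mu (fun x => (mehler th (rowof x) + eps) `^ al) (energy th) /\
  eps `^ al <= energy th <= 2 `^ al.
Proof.
move=> s0; have [a Ha] := has_integral_bounded mu (measurable_Gal th) (fun x => bounded_Gal x s0).
have aE : energy th = a by case: Ha => _; rewrite /energy /Rintegral => ->.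
rewrite aE; split => //; have /andP[a0 a1] := al01; have /andP[e0 e1] := eps01.
apply/andP; split.
  apply: (has_integral_le (has_integral_cst mu _) Ha) => x.
  have /andP[h1 h2] := shift_bounds hgamma J01 eps01 x s0.
  by rewrite ge0_ler_powR ?nnegrE ?(ltW a0) ?(ltW e0)// (le_trans (ltW e0)).
apply: (has_integral_le Ha (has_integral_cst mu _)) => x.
exact: le_trans (ler_norm _) (bounded_Gal x s0).
Qed.

Lemma cvg_energy_pihalf :
  energy (pi / 2 - small k) @[k --> \oo] --> (gcomb J n + eps) `^ al.
Proof.
have /andP[a0 a1] := al01; have /andP[e0 e1] := eps01.
have -> : (gcomb J n + eps) `^ al = \int[mu]_x ((fun=> (gcomb J n + eps) `^ al) x).
  by have [_] := has_integral_cst mu ((gcomb J n + eps) `^ al); rewrite /Rintegral => ->.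
apply: (@bounded_cvg_Rintegral _ _ _ mu _ _ (2 `^ al)).
- by move=> k; exact: measurable_Gal.
- exact: measurable_cst.
- by move=> k x; apply: bounded_Gal; have [] := sin_cos_gt0 (pihalf_small k).
- apply: aeW => x.
  have g0 : 0 < gcomb J n + eps by rewrite ltr_wpDl// (gcomb_ge0 hgamma J01).
  have cpow : {for gcomb J n + eps, continuous (fun s => s `^ al)}.
    apply: differentiable_continuous; apply/derivable1_diffP.
    by have := is_derive1_powR al g0; case.
  have cG : mehler (pi / 2 - small k) (rowof x) + eps @[k --> \oo] --> gcomb J n + eps.
    apply: cvgD; last exact: cvg_cst.
    by apply: cvg_sumr => j; apply: cvgMr; apply: cvg_prodr => i; exact: cvg_PhiO_pihalf.
  exact: (continuous_cvg _ cpow cG).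
Qed.

End fixed_exponent.

(** A number in [[0, 1]] is at most its power [al], so the mean is below the energy. The energy
    tends to [(gcomb J n + eps)^al] at [pi / 2] and, going there, decreases at rate at most
    [5 sqrt al V]. *)
Lemma mehler_mean_le (al eps V th : R) : 0 < al <= 1 -> 0 < eps <= 1 ->
  has_integral mu (fun x => normH (v x)) V -> 0 < th < pi / 2 ->
  \int[mu]_x mehler th (rowof x) <= (gcomb J n + eps) `^ al + pi / 2 * (5 * Num.sqrt al * V).
Proof.
move=> al01 eps01 HV th01; have [s0 c0] := sin_cos_gt0 th01.
have /andP[a0 a1] := al01; have /andP[e0 e1] := eps01; have /andP[t0 t1] := th01.
have V0 : 0 <= V.
  by apply: (has_integral_le (has_integral0 mu) HV) => x; exact: normH_ge0.
set S := 5 * Num.sqrt al * V.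
have S0 : 0 <= S by rewrite !mulr_ge0 ?sqrtr_ge0.
have HS : has_integral mu (fun x => 5 * Num.sqrt al * normH (v x)) S by exact: has_integralZ.
apply: (@le_trans _ _ (@energy R n J mu al eps th)).
  have [HE _] := energy_bounds al01 eps01 s0.
  have [a Ha] : exists a, has_integral mu (fun x => mehler th (rowof x)) a.
    apply: (@has_integral_bounded _ _ _ _ _ 1); first exact: measurable_mehler.
    by move=> x; have /andP[h0 h1] := mehler_row01 hgamma J01 x s0; rewrite ger0_norm.
  rewrite (_ : \int[mu]_x _ = a); last by case: Ha => _; rewrite /Rintegral => ->.
  apply: (has_integral_le Ha HE) => x.
  have /andP[h0 h1] := mehler_row01 hgamma J01 x s0.
  move: h0; rewrite le_eqVlt => /predU1P[<-|h0]; first exact: powR_ge0.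
  apply: (@le_trans _ _ (mehler th (rowof x) `^ al)); first by rewrite ger1_powR// h0.
  rewrite ge0_ler_powR ?nnegrE ?(ltW a0) ?(ltW h0)// ?lerDl ?(ltW e0)//.
  by rewrite addr_ge0 ?(ltW h0) ?(ltW e0).
rewrite -lerBlDr.
have -> : (gcomb J n + eps) `^ al = lim (@energy R n J mu al eps (pi / 2 - small k) @[k --> \oo]).
  by apply/esym/cvg_lim => //; exact: cvg_energy_pihalf.
apply: limr_ge; first by apply/cvg_ex; eexists; exact: cvg_energy_pihalf.
near=> k.
have tk : th < pi / 2 - small k.
  rewrite ltrBrDr -ltrBrDl; near: k.
  by apply: (cvgr_lt 0); [exact: cvg_small|rewrite subr_gt0].
have /andP[_ k1] := pihalf_small k.
rewrite lerBlDr -lerBlDl (le_trans (@MVT_lower _ S _ _ tk _))//.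
  move=> t /andP[h1 h2].
  have tt : 0 < t < pi / 2 by apply/andP; split; lra.
  have [u' [Hu HH]] := energy_derive hgamma J01 hv_meas hv_l2 hv_L1 hmu al01 eps01 tt.
  exists u' => //; apply: (HH _ _ HS) => x /=.
  have [st _] := sin_cos_gt0 tt.
  have /andP[g1 g2] := shift_bounds hgamma J01 eps01 x st.
  by rewrite ler_wpM2r ?normH_ge0// powR_entropy_le// g2 (lt_le_trans e0).
have := @small_gt0 R k; rewrite mulrC => h; rewrite ler_wpM2r//; lra.
Unshelve. all: by end_near. Qed.

(** All that the quantitative argument uses of the size of [v]. The exponent [kap] is [1 / m] under
    a [psi_m] bound and 0 under a uniform bound, so one differential inequality serves the three
    cases; [g] stands for the shifted semigroup. *)
Definition drift_moment (lam kap : R) := forall (g : Rinf R -> R) u,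
  measurable_fun setT g -> (forall x, 0 < g x <= 2) -> has_integral mu g u ->
  exists2 I, has_integral mu (fun x => g x * normH (v x) ^+ 2) I
    & I <= 2 * lam ^+ 2 * u * (2 - ln u) `^ (2 * kap).

Lemma le_of_rate_bound (a b c lam s th : R) : 0 < lam -> 0 < th -> 0 < s ->
  - a - - b <= 2 * lam * (c / 2 - s - th) -> b <= c * lam + a.
Proof.
move=> l0 t0 s0; have : 0 < lam * s by exact: mulr_gt0.
have : 0 < lam * th by exact: mulr_gt0.
lra.
Qed.

(** The energy satisfies [U' >= - 2 lam U (2 - ln U)^(1/2 + kap)], that is, [D U] has derivative at
    most [2 lam]; the angles from [th] to [pi / 2] have length below [pi / 2]. *)
Lemma mehler_mean_quant (D : R -> R) (lam kap eps th : R) : 0 < lam ->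
  drift_moment lam kap ->
  (forall s : R, 0 < s <= 2 -> is_derive s (1 : R) D (- (s * (2 - ln s) `^ (2^-1 + kap))^-1)) ->
  0 < eps <= 1 -> 0 < th < pi / 2 ->
  D (gcomb J n + eps) - D (\int[mu]_x mehler th (rowof x) + eps) <= pi * lam.
Proof.
move=> lam0 HM HD eps01 th01; have [s0 c0] := sin_cos_gt0 th01.
have al01 : 0 < (1 : R) <= 1 by rewrite ltr01 lexx.
have /andP[e0 e1] := eps01; have /andP[t0 t1] := th01.
pose U := @energy R n J mu 1 eps.
have UE t : 0 < sin t -> has_integral mu (fun x => mehler t (rowof x) + eps) (U t) /\ eps <= U t <= 2.
  move=> st; have [H] := energy_bounds al01 eps01 st; rewrite !powRr1// ?(ltW e0)// => ->.
  split => //; apply: has_integral_ext H => x; rewrite powRr1//.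
  have /andP[h1 h2] := shift_bounds hgamma J01 eps01 x st.
  by rewrite (le_trans (ltW e0)).
have {1}-> : \int[mu]_x mehler th (rowof x) + eps = U th.
  have [a Ha] : exists a, has_integral mu (fun x => mehler th (rowof x)) a.
    apply: (@has_integral_bounded _ _ _ _ _ 1); first exact: measurable_mehler.
    by move=> x; have /andP[h0 h1] := mehler_row01 hgamma J01 x s0; rewrite ger0_norm.
  rewrite (_ : \int[mu]_x _ = a); last by case: Ha => _; rewrite /Rintegral => ->.
  apply: (has_integral_uniq (has_integralD Ha (has_integral_cst mu eps))).
  by have [] := UE th s0.
have U2 t : 0 < sin t -> 0 < U t <= 2.
  by move=> st; have [_ /andP[h1 h2]] := UE t st; rewrite h2 andbT (lt_le_trans e0).
have dU t : 0 < t < pi / 2 -> exists2 u', is_derive t (1 : R) U u' &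
    - (2 * lam * U t * (2 - ln (U t)) `^ (2^-1 + kap)) <= u'.
  move=> tt; have [st ct] := sin_cos_gt0 tt.
  have [u' [Hu HH]] := energy_derive hgamma J01 hv_meas hv_l2 hv_L1 hmu al01 eps01 tt.
  exists u' => //; have [HU _] := UE t st; have /andP[u0 u2] := U2 t st.
  set u := U t in HU u0 u2 *; set L := 2 - ln u.
  have L1 : 1 <= L by have := ln_le_sub1 u0; rewrite /L; lra.
  have L0 : 0 < L by exact: lt_le_trans L1.
  have gb x : 0 < mehler t (rowof x) + eps <= 2.
    have /andP[h1 h2] := shift_bounds hgamma J01 eps01 x st.
    by rewrite h2 andbT (lt_le_trans e0).
  have mg : measurable_fun setT (fun x : Rinf R => mehler t (rowof x) + eps).
    by apply: measurable_funD; [exact: measurable_mehler|exact: measurable_cst].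
  have [I HI Ile] := HM _ _ mg gb HU.
  (* The weight in Young's inequality. With this value each of the two halves integrates to at most
     [lam u L^(1/2 + kap)]. *)
  pose c := L `^ (2^-1 - kap) / lam.
  have c0' : 0 < c by rewrite divr_gt0// powR_gt0.
  have HB := has_integralD (has_integralZ (c / 2) HI)
    (has_integralZ c^-1 (has_integralD (has_integralZ (1 - ln u) HU) (has_integral_cst mu u))).
  apply: le_trans (HH _ _ HB _).
    rewrite lerN2.
    have -> : (1 - ln u) * u + u = u * L by rewrite /L; ring.
    have cI : c / 2 * I <= lam * u * L `^ (2^-1 + kap).
      apply: (@le_trans _ _ (c / 2 * (2 * lam ^+ 2 * u * L `^ (2 * kap)))).
        by rewrite ler_wpM2l// divr_ge0// ltW.
      rewrite (_ : 2^-1 + kap = (2^-1 - kap) + 2 * kap); last by ring.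
      rewrite powRD; last by rewrite (gt_eqF L0) implybT.
      rewrite /c le_eqVlt; apply/orP; left; apply/eqP; field; by rewrite gt_eqF.
    have cL : c^-1 * (u * L) = lam * u * L `^ (2^-1 + kap).
      have E : L = L `^ (2^-1 + kap) * L `^ (2^-1 - kap).
        rewrite -powRD; last by rewrite (gt_eqF L0) implybT.
        by rewrite (_ : _ + _ = 1) ?powRr1 ?(ltW L0)//; field.
      rewrite {1}E /c; field; by rewrite !gt_eqF ?powR_gt0.
    rewrite cL; lra.
  move=> x /=; have /andP[g0 g2] := gb x; set g := mehler t (rowof x) + eps in g0 g2 *.
  rewrite mul1r powRr1 ?(ltW g0)//; set q := Num.sqrt _; set w := normH _.
  have q2 : q ^+ 2 = 2 * (2 - ln g) by rewrite sqr_sqrtr//; have := ln_le_sub1 g0; lra.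
  have h1 := entropy_tangent g0 u0.
  apply: (@le_trans _ _ (c / 2 * (g * w ^+ 2) + c^-1 * (g * (2 - ln g)))); last first.
    by rewrite lerD2l ler_wpM2l ?invr_ge0 ?(ltW c0')// mulrC [_ * g]mulrC mulrC.
  have -> : g * (2 - ln g) = g * (q ^+ 2 / 2) by rewrite q2; field.
  (* Young's inequality [g q w <= (c / 2) g w^2 + g q^2 / (2 c)] as a square. *)
  have : 0 <= g * (c * w - q) ^+ 2 / (2 * c).
    have g0x := ltW g0; have c0x := ltW c0'.
    rewrite divr_ge0; [by []|by rewrite mulr_ge0 ?sqr_ge0|by rewrite mulr_ge0].
  rewrite (_ : g * (c * w - q) ^+ 2 / (2 * c) =
    c / 2 * (g * w ^+ 2) + c^-1 * (g * (q ^+ 2 / 2)) - g * q * w); first by rewrite subr_ge0.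
  by field; rewrite gt_eqF.
have dDU t : 0 < t < pi / 2 -> exists2 f', is_derive t (1 : R) (fun t => - D (U t)) f' &
    - (2 * lam) <= f'.
  move=> tt; have [st ct] := sin_cos_gt0 tt; have [u' Hu Hb] := dU t tt.
  have /andP[u0 u2] := U2 t st; have HDu := HD _ (U2 t st).
  exists (- (- (U t * (2 - ln (U t)) `^ (2^-1 + kap))^-1 * u')).
    apply: is_deriveN; exact: (is_derive_comp1 HDu Hu).
  rewrite mulNr opprK; set X := U t * _.
  have X0 : 0 < X.
    rewrite mulr_gt0// powR_gt0//; have := ln_le_sub1 u0; lra.
  rewrite [leRHS]mulrC ler_pdivlMr//; apply: le_trans Hb.
  by rewrite /X mulNr !mulrA.
have p0 : 0 < gcomb J n + eps by rewrite ltr_wpDl// (gcomb_ge0 hgamma J01).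
have p2 : gcomb J n + eps <= 2 by have := gcomb_le1 hgamma J01; lra.
have cD : D (U (pi / 2 - small k)) @[k --> \oo] --> D (gcomb J n + eps).
  apply: continuous_cvg.
    apply: differentiable_continuous; apply/derivable1_diffP.
    by have := HD (gcomb J n + eps); rewrite p0 p2 => /(_ isT); case.
  by have := cvg_energy_pihalf al01 eps01; rewrite powRr1// ltW.
rewrite lerBlDr -(cvg_lim (@Rhausdorff R) cD).
apply: limr_le; first by apply/cvg_ex; eexists; exact: cD.
near=> k.
have tk : th < pi / 2 - small k.
  rewrite ltrBrDr -ltrBrDl; near: k.
  by apply: (cvgr_lt 0); [exact: cvg_small|rewrite subr_gt0].
have /andP[_ k1] := pihalf_small k.
have k0 := @small_gt0 R k.
have H : - D (U th) - - D (U (pi / 2 - small k)) <= 2 * lam * (pi / 2 - small k - th).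
  apply: (@MVT_lower (fun t => - D (U t)) (2 * lam) _ _ tk) => t /andP[h1 h2].
  by apply: dDU; apply/andP; split; lra.
exact: (le_of_rate_bound lam0 t0 k0 H).
Unshelve. all: by end_near. Qed.

Lemma cvg_mehler_mean0 : (forall i c, mu [set x : Rinf R | x i = c] = 0%E) ->
  \int[mu]_x mehler (small k) (rowof x) @[k --> \oo] --> \int[mu]_x comb J n x.
Proof.
move=> na; apply: (@bounded_cvg_Rintegral _ _ _ mu _ _ 1).
- by move=> k; exact: measurable_mehler.
- exact: measurable_comb.
- move=> k x; have [|s0 _] := @sin_cos_gt0 R (small k).
    by rewrite small_gt0 small_lt_pihalf.
  by have /andP[h0 h1] := mehler_row01 hgamma J01 x s0; rewrite ger0_norm.
- exact: ae_cvg_mehler0.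
Qed.

End energy_estimates.

(** * From orthants to Borel sets *)

Section approximation.
Context d (T : measurableType d) (R : realType) (P Q : probability T R).
Variable B : set (set T).
Hypotheses (BT : B setT) (BC : forall A, B A -> B (~` A)).
Hypothesis BI : forall A A', B A -> B A' -> B (A `&` A').
Hypothesis Bm : forall A, B A -> measurable A.

Definition symdiff (A A' : set T) := (A `\` A') `|` (A' `\` A).

(** A single [A'] is close to [A] for [P] and for [Q] at once: comparing [gamma A] with [mu A]
    requires the same combination of orthants for both. *)
Definition approximable : set (set T) := [set A | measurable A /\
  forall e : R, 0 < e -> exists A', [/\ B A', (P (symdiff A A') < e%:E)%E
    & (Q (symdiff A A') < e%:E)%E]].

Lemma measurable_symdiff A A' : measurable A -> measurable A' -> measurable (symdiff A A').
Proof. by move=> mA mA'; apply: measurableU; exact: measurableD. Qed.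

Lemma approximable_B A : B A -> approximable A.
Proof.
move=> BA; split; first exact: Bm.
by move=> e e0; exists A; rewrite /symdiff setDv setU0 !measure0 lte_fin.
Qed.

Lemma approximableC A : approximable A -> approximable (~` A).
Proof.
move=> [mA H]; split; first exact: measurableC.
move=> e e0; have [A' [BA' PA' QA']] := H e e0; exists (~` A').
have -> : symdiff (~` A) (~` A') = symdiff A A'.
  by rewrite /symdiff !setDE !setCK [LHS]setUC (setIC (~` A')) (setIC (~` A)).
by split => //; exact: BC.
Qed.

Lemma approximableU A A' : approximable A -> approximable A' -> approximable (A `|` A').
Proof.
move=> [mA H] [mA' H']; split; first exact: measurableU.
move=> e e0; have e20 : 0 < e / 2 by rewrite divr_gt0.
have [C [BC1 PC QC]] := H _ e20; have [C' [BC' PC' QC']] := H' _ e20.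
have sub : symdiff (A `|` A') (C `|` C') `<=` symdiff A C `|` symdiff A' C'.
  move=> x [[[Ax|Ax] /not_orP[Cx Cx']]|[[Cx|Cx] /not_orP[Ax Ax']]].
  - by left; left.
  - by right; left.
  - by left; right.
  - by right; right.
have m1 := measurable_symdiff mA (Bm BC1); have m2 := measurable_symdiff mA' (Bm BC').
have BU : B (C `|` C') by rewrite -[_ `|` _]setCK setCU; apply: BC; apply: BI; exact: BC.
have m3 := measurable_symdiff (measurableU _ _ mA mA') (Bm BU).
exists (C `|` C'); split => //.
- rewrite (le_lt_trans (le_measure _ _ _ sub)) ?inE//; first exact: measurableU.
  rewrite (le_lt_trans (measureU2 _ _ _))// [e]splitr EFinD lteD//.
- rewrite (le_lt_trans (le_measure _ _ _ sub)) ?inE//; first exact: measurableU.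
  rewrite (le_lt_trans (measureU2 _ _ _))// [e]splitr EFinD lteD//.
Qed.

Lemma approximable0 : approximable set0.
Proof. by rewrite -setCT; apply: approximableC; exact: approximable_B. Qed.

Lemma approximable_bigcup (F : (set T)^nat) : (forall k, approximable (F k)) ->
  approximable (\bigcup_k F k).
Proof.
move=> H; have mF k : measurable (F k) by case: (H k).
have mU : measurable (\bigcup_k F k) by exact: bigcup_measurable.
split=> // e e0; have e20 : 0 < e / 2 by rewrite divr_gt0.
pose G k := \big[setU/set0]_(i < k) F i.
have aG k : approximable (G k).
  rewrite /G; elim: k => [|k IH]; first by rewrite big_ord0; exact: approximable0.
  by rewrite big_ord_recr; exact: approximableU.
have mG k : measurable (G k) by case: (aG k).
have subG k : G k `<=` \bigcup_k F k.
  by rewrite /G -bigcup_mkord => x [i ik Fx]; exists i.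
have UG : \bigcup_k G k = \bigcup_k F k.
  apply/seteqP; split => x; first by move=> [k _ /subG].
  move=> [k _ Fx]; exists k.+1 => //; rewrite /G -bigcup_mkord; exists k => //=.
have ndG : nondecreasing_seq G.
  by move=> a b ab; apply/subsetPset; rewrite /G -!bigcup_mkord => x [i ia Fx];
    exists i => //=; exact: leq_trans ia ab.
have small (m : probability T R) : \forall k \near \oo, (m (\bigcup_k F k `\` G k) < (e / 2)%:E)%E.
  have := @nondecreasing_cvg_mu _ _ _ m G mG; rewrite UG => /(_ mU ndG) cG.
  have mUfin : m (\bigcup_k F k) \is a fin_num by exact: fin_num_measure.
  have : \forall k \near \oo, (m (\bigcup_k F k) - (e / 2)%:E < m (G k))%E.
    apply: (cG [set y | (m (\bigcup_k F k) - (e / 2)%:E < y)%E]).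
    apply: open_nbhs_nbhs; split; first exact: open_ereal_gt_ereal.
    by rewrite /= EFinN lteBlDr// lteDl// lte_fin.
  apply: filterS => k.
  rewrite measureD//; last by rewrite ltey_eq mUfin.
  rewrite setIidr; last exact: subG.
  have mGfin : m (G k) \is a fin_num by exact: fin_num_measure.
  by rewrite !lteBlDr// addeC.
near \oo => k.
have kP : (P (\bigcup_k F k `\` G k) < (e / 2)%:E)%E by near: k; exact: small.
have kQ : (Q (\bigcup_k F k `\` G k) < (e / 2)%:E)%E by near: k; exact: small.
have [C [BC1 PC QC]] := (aG k).2 _ e20.
have sub : symdiff (\bigcup_k F k) C `<=` (\bigcup_k F k `\` G k) `|` symdiff (G k) C.
  move=> x [[Fx Cx]|[Cx Fx]].
    by have [Gx|Gx] := pselect (G k x); [right; left|left].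
  by right; right; split => // /subG.
have m1 := measurable_symdiff (mG k) (Bm BC1).
have m2 : measurable (\bigcup_k F k `\` G k) by exact: measurableD.
have m3 := measurable_symdiff mU (Bm BC1).
exists C; split => //.
- rewrite (le_lt_trans (le_measure _ _ _ sub)) ?inE//; first exact: measurableU.
  rewrite (le_lt_trans (measureU2 _ _ _))// [e]splitr EFinD lteD//.
- rewrite (le_lt_trans (le_measure _ _ _ sub)) ?inE//; first exact: measurableU.
  rewrite (le_lt_trans (measureU2 _ _ _))// [e]splitr EFinD lteD//.
Unshelve. all: by end_near. Qed.

Lemma sigma_algebra_approximable : sigma_algebra setT approximable.
Proof.
split; first exact: approximable0.
- by move=> A HA; rewrite setTD; exact: approximableC.
- exact: approximable_bigcup.
Qed.

End approximation.

Section comb_algebra.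
Context {R : realType}.
Implicit Types (J : seq (R * (nat -> option R))).

(** An algebra of sets: complement and intersection become [1 - W] and [W W'] on indicators, and
    combinations with signed coefficients are stable under both. *)
Definition comb_sets : set (set (Rinf R)) := [set B | exists n J,
  forall x : nat -> R, comb J n x = (`[< B x >])%:R].

Lemma comb_setsC B : comb_sets B -> comb_sets (~` B).
Proof.
move=> [n [J HJ]]; exists n, ((1, fun=> None) :: [seq (- j.1, j.2) | j <- J]) => x.
rewrite /comb big_cons /= big1 ?mulr1; last by [].
rewrite big_map; under eq_bigr do rewrite mulNr.
rewrite sumrN -/(comb J n x) HJ asbool_neg.
by case: asboolP => _ /=; rewrite ?subrr ?subr0.
Qed.

(** Coordinates from [n] on become unconstrained, so two combinations can be put over the same
    number of coordinates before being multiplied. *)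
Definition restrict n J : seq (R * (nat -> option R)) :=
  [seq (j.1, fun i => if (i < n)%N then j.2 i else None) | j <- J].

Lemma comb_restrict n m J x : (n <= m)%N -> comb (restrict n J) m x = comb J n x.
Proof.
move=> nm; rewrite /comb big_map; apply: eq_bigr => j _ /=; congr (_ * _).
rewrite -(big_mkord xpredT (fun i => below (if (i < n)%N then j.2 i else None) (x i))).
rewrite -(big_mkord xpredT (fun i => below (j.2 i) (x i))).
rewrite (big_cat_nat _ nm)//= [X in _ * X](_ : _ = 1) ?mulr1.
  by apply: eq_big_nat => i /andP[_ ->].
by rewrite big_nat_cond big1// => i /andP[/andP[ni _] _]; rewrite ltnNge ni.
Qed.

Definition minO (a b : option R) : option R :=
  match a, b with
  | Some a, Some b => Some (Num.min a b)
  | Some a, None => Some a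
  | None, b => b
  end.

Lemma below_minO a b y : below (minO a b) y = below a y * below b y.
Proof.
case: a b => [a|] [b|] //=; rewrite ?mulr1 ?mul1r//.
by rewrite le_min; case: (y <= a); case: (y <= b); rewrite ?mulr1 ?mulr0.
Qed.

Lemma comb_mul n J J' x : comb J n x * comb J' n x =
  comb [seq (j.1 * k.1, fun i => minO (j.2 i) (k.2 i)) | j <- J, k <- J'] n x.
Proof.
rewrite /comb big_allpairs_dep /= mulr_suml; apply: eq_bigr => j _.
rewrite mulr_sumr; apply: eq_bigr => k _ /=.
rewrite mulrACA -big_split /=; congr (_ * _).
by apply: eq_bigr => i _; rewrite below_minO.
Qed.

Lemma comb_setsI B B' : comb_sets B -> comb_sets B' -> comb_sets (B `&` B').
Proof.
move=> [n [J HJ]] [n' [J' HJ']].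
exists (maxn n n'), [seq (j.1 * k.1, fun i => minO (j.2 i) (k.2 i)) |
  j <- restrict n J, k <- restrict n' J'] => x.
rewrite -comb_mul !comb_restrict ?leq_maxl ?leq_maxr// HJ HJ' asbool_and.
by case: (`[< B x >]); case: (`[< B' x >]); rewrite ?mulr1 ?mulr0.
Qed.

Definition halfspace (i : nat) (a c : R) : R * (nat -> option R) :=
  (a, fun k => if k == i then Some c else None).

Lemma comb_halfspaces (s : seq (R * R)) i (x : nat -> R) :
  comb [seq halfspace i p.1 p.2 | p <- s] i.+1 x = \sum_(p <- s) p.1 * (x i <= p.2)%R%:R.
Proof.
rewrite /comb big_map; apply: eq_bigr => p _; rewrite big_ord_recr /= eqxx.
by rewrite big1 ?mul1r// => k _; rewrite ltn_eqF.
Qed.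

Lemma comb_sets_halfspace i c : comb_sets [set x : Rinf R | x i <= c].
Proof.
exists i.+1, [seq halfspace i p.1 p.2 | p <- [:: (1, c)]] => x.
rewrite comb_halfspaces big_seq1 mul1r /=.
by case: (boolP (x i <= c)) => h; [rewrite asboolT|rewrite asboolF//; exact/negP].
Qed.

Lemma comb_setsT : comb_sets setT.
Proof.
exists 0%N, [:: (1, fun=> None)] => x.
by rewrite /comb big_seq1 big_ord0 mulr1 asboolT.
Qed.

Lemma comb_sets01 n J (B : set (Rinf R)) : (forall x, comb J n x = (`[< B x >])%:R) ->
  forall x, 0 <= comb J n x <= 1.
Proof. by move=> H x; rewrite H; case: (`[< _ >]); rewrite /= ?lexx ?ler01. Qed.

Lemma measurable_comb_sets B : comb_sets B -> measurable B.
Proof.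
move=> [n [J HJ]].
have := @measurable_comb R J n measurableT [set 1] (measurable_set1 1).
rewrite setTI; congr measurable; apply/seteqP; split => x /=; rewrite HJ.
  by case: asboolP => //= _ /eqP; rewrite eq_sym oner_eq0.
by move=> Bx; rewrite asboolT.
Qed.

(** The open half-lines []c, +oo[] generate the Borel sets of each coordinate, and their preimages
    are complements of half-spaces. *)
Lemma measurable_sub_sigma (D : set (set (Rinf R))) : sigma_algebra setT D ->
  comb_sets `<=` D -> forall A : set (Rinf R), measurable A -> D A.
Proof.
move=> sD HD A; apply: smallest_sub => //.
move=> _ [i _ [C mC <-]]; rewrite setTI.
have [D0 DC DU] := sD.
pose E : set (set R) := [set C | D ((fun x : Rinf R => x i) @^-1` C)].
have sE : sigma_algebra setT E.
  split.
  - by rewrite /E /= preimage_set0.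
  - by move=> C' HC'; rewrite /E /= setTD preimage_setC -setTD; exact: DC.
  - by move=> F HF; rewrite /E /= preimage_bigcup; exact: DU.
suff : E C by [].
have {mC} : (@RGenOInfty.G R).-sigma.-measurable C by rewrite -RGenOInfty.measurableE.
apply: (smallest_sub sE) => _ [c ->]; rewrite /E /=.
rewrite (_ : _ @^-1` _ = setT `\` [set x : Rinf R | x i <= c]).
  by apply: DC; apply: HD; exact: comb_sets_halfspace.
apply/seteqP; split => x /=; rewrite in_itv/= andbT ltNge; first by move=> /negP.
by move=> [_ /negP].
Qed.

End comb_algebra.

(** With [al = e^2] and [q = e^(1 / e^2)], where [0 < e <= 1], both [q^al] and [sqrt al] equal [e],
    and [q <= e]; hence [m <= (2 + C) e]. *)
Lemma smallness_limit {R : realType} (m C : R) :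
  (forall al q : R, 0 < al <= 1 -> 0 < q <= 1 -> m <= q + q `^ al + C * Num.sqrt al) ->
  m <= 0.
Proof.
move=> H; rewrite leNgt; apply/negP => m0.
have B (e : R) : 0 < e <= 1 -> m <= (2 + C) * e.
  move=> /andP[e0 e1]; have ei : 1 <= e ^- 2 by rewrite invf_ge1 ?exprn_gt0// expr_le1// ltW.
  have q1 : e `^ (e ^- 2) <= e by rewrite ge1r_powR ?e0.
  have := H (e ^+ 2) (e `^ (e ^- 2)).
  rewrite -powRrM mulVf ?gt_eqF ?exprn_gt0// powRr1 ?(ltW e0)// sqrtr_sqr gtr0_norm//.
  rewrite powR_gt0// expr_le1 ?(ltW e0)// e1 (le_trans q1)// => /(_ isT isT); lra.
set K := 2 + `|C|.
have K0 : 0 < K by rewrite ltr_wpDr.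
(* Small enough that [(2 + C) e < m]. *)
have /B : 0 < m / (m + 2 * K) <= 1.
  by rewrite divr_gt0 ?ler_pdivrMr ?mul1r ?lerDl//; lra.
have KC : 2 + C <= K by rewrite lerD2l ler_norm.
have d0 : 0 < m + 2 * K by lra.
apply/negP; rewrite -ltNge mulrA ltr_pdivrMr//.
have : (2 + C) * m <= K * m by rewrite ler_pM2r.
have : 0 < K * m by rewrite mulr_gt0.
have : 0 < m * m by rewrite mulr_gt0.
lra.
Qed.

Lemma has_integral_indic d (T : measurableType d) (R : realType) (P : probability T R)
  (A : set T) : measurable A -> has_integral P (\1_A : T -> R) (fine (P A)).
Proof.
move=> mA; apply: has_integral_ge0 => //.
by rewrite integral_indic// setIT fineK// fin_num_measure.
Qed.

Lemma probability_symdiff d (T : measurableType d) (R : realType) (P : probability T R)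
  (A A' : set T) (e : R) : measurable A -> measurable A' ->
  (P (symdiff A A') < e%:E)%E -> `|fine (P A) - fine (P A')| < e.
Proof.
have sub (B B' : set T) : measurable B -> measurable B' ->
    (P (symdiff B B') < e%:E)%E -> fine (P B) - fine (P B') < e.
  move=> mB mB' H; have mS := measurable_symdiff mB mB'.
  rewrite ltrBlDr -lte_fin EFinD !fineK ?fin_num_measure//.
  apply: (@le_lt_trans _ _ (P (symdiff B B' `|` B'))).
    rewrite le_measure ?inE//; first exact: measurableU.
    by move=> x Bx; have [B'x|B'x] := pselect (B' x); [right|left; left].
  rewrite (le_lt_trans (measureU2 _ _ _))// lteD2rE// ?fin_num_measure//.
move=> mA mA' H; rewrite ltr_norml ltrNl opprB !sub//.
by rewrite /symdiff setUC.
Qed.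

Lemma gcomb_halfspaces {R : realType} (s : seq (R * R)) i :
  gcomb [seq halfspace i p.1 p.2 | p <- s] i.+1 = \sum_(p <- s) p.1 * Phi p.2.
Proof.
rewrite /gcomb big_map; apply: eq_bigr => p _; rewrite big_ord_recr /= eqxx.
by rewrite big1 ?mul1r// => k _; rewrite ltn_eqF.
Qed.

Lemma mehler_halfspaces {R : realType} (s : seq (R * R)) i th (x : Rinf R) :
  mehler [seq halfspace i p.1 p.2 | p <- s] th (@rowof R i.+1 x) =
  \sum_(p <- s) p.1 * PhiO (level (Some p.2) th (x i)).
Proof.
rewrite /mehler big_map; apply: eq_bigr => p _; rewrite big_ord_recr /= eqxx mxE.
by rewrite big1 ?mul1r// => k _; rewrite ltn_eqF.
Qed.

(** * Absolute continuity and comparison of the two measures on Borel sets *)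

Section transfer.
Context {R : realType} (gamma : probability (Rinf R) R).
Hypothesis hgamma : std_gaussian_power gamma.
Variables (v : Rinf R -> Rinf R) (mu : probability (Rinf R) R).
Hypotheses (hv_meas : measurable_fun setT v) (hv_l2 : forall x, in_l2 (v x)).
Hypothesis hv_L1 : mu.-integrable setT (fun x => (normH (v x))%:E).
Hypothesis hmu : forall (n : nat) (phi : Rinf R -> R), FC0 n phi ->
  (\int[mu]_x (drift_OU v n phi x)%:E = 0)%E.

Lemma has_integral_normH : exists V, has_integral mu (fun x => normH (v x)) V.
Proof.
exists (fine (\int[mu]_x (normH (v x))%:E)); split => //; rewrite fineK//.
exact: integrable_fin_num.
Qed.

Lemma measurable_hyperplane i (c : R) : measurable [set x : Rinf R | x i = c].
Proof.
by have := @measurable_coord R i measurableT [set c] (measurable_set1 c); rewrite setTI.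
Qed.

Lemma small_pihalf k : 0 < (small k : R) < pi / 2.
Proof. by rewrite small_gt0 small_lt_pihalf. Qed.

(** The test set is the slab of half-width [q / 8] about the hyperplane, of Gaussian measure at most
    [q / 4] since [Phi] is 1-Lipschitz. On the hyperplane the semigroup is constant in [x] and tends
    to 1 as the angle tends to 0; convergence on the faces of the slab, which would be circular, is
    never invoked. *)
Lemma hyperplane_null i (c : R) : mu [set x : Rinf R | x i = c] = 0%E.
Proof.
set A := [set x | _]; have mA : measurable A := measurable_hyperplane i c.
have [V HV] := has_integral_normH.
rewrite -[LHS]fineK ?fin_num_measure//; congr EFin; apply/eqP; rewrite eq_le fine_ge0// andbT.
apply: (@smallness_limit _ _ (pi / 2 * 5 * V)) => al q al01 /andP[q0 q1].
pose s := [:: (1, c + q / 8); (-1, c - q / 8)] : seq (R * R).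
set J := [seq halfspace i p.1 p.2 | p <- s].
have J01 (x : nat -> R) : 0 <= comb J i.+1 x <= 1.
  rewrite /J comb_halfspaces /s big_cons big_seq1 /= mul1r mulN1r.
  case: (lerP (x i) (c + q / 8)); case: (lerP (x i) (c - q / 8)) => /=; lra.
have gJ : gcomb J i.+1 <= q / 4.
  rewrite /J gcomb_halfspaces /s big_cons big_seq1 /= mul1r mulN1r.
  have ab : c - q / 8 < c + q / 8 by lra.
  have : - Phi (c - q / 8) - - Phi (c + q / 8) <= 1 * (c + q / 8 - (c - q / 8)).
    apply: (@MVT_lower R (fun t => - Phi t) 1 _ _ ab) => t _; exists (- normal_pdf 0 1 t); last by rewrite lerN2; have [/andP[]] := pdf_bounds t.
    by have := is_derive_Phi t => ?; apply: is_deriveN.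
  lra.
have HI k : fine (mu A) * (PhiO (level (Some (c + q / 8)) (small k) c) -
    PhiO (level (Some (c - q / 8)) (small k) c)) <= q `^ al + pi / 2 * 5 * V * Num.sqrt al.
  have [s0 c0] := sin_cos_gt0 (small_pihalf k).
  have [a Ha] : exists a, has_integral mu (fun x => @mehler R i.+1 J (small k) (rowof x)) a.
    apply: (@has_integral_bounded _ _ _ _ _ 1); first exact: measurable_mehler.
    by move=> x; have /andP[h0 h1] := mehler_row01 hgamma J01 x s0; rewrite ger0_norm.
  have HA := has_integralZ (PhiO (level (Some (c + q / 8)) (small k) c) -
    PhiO (level (Some (c - q / 8)) (small k) c)) (has_integral_indic mu mA).
  rewrite mulrC; apply: (@le_trans _ _ a).
    apply: (has_integral_le HA Ha) => x.
    have /andP[h0 h1] := mehler_row01 hgamma J01 x s0.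
    rewrite indicE; have [/set_mem Ax|_] := boolP (x \in A); last by rewrite mulr0.
    rewrite mulr1 /J mehler_halfspaces /s big_cons big_seq1 /= (Ax : x i = c); lra.
  have q2 : 0 < q / 2 <= 1 by apply/andP; split; lra.
  have := mehler_mean_le hgamma J01 hv_meas hv_l2 hv_L1 hmu al01 q2 HV (small_pihalf k).
  rewrite (_ : \int[mu]_x _ = a); last by case: Ha => _; rewrite /Rintegral => ->.
  have : (gcomb J i.+1 + q / 2) `^ al <= q `^ al.
    have g0 := gcomb_ge0 hgamma J01; have /andP[/ltW al0 _] := al01.
    by rewrite ge0_ler_powR// ?nnegrE; lra.
  lra.
have cw : fine (mu A) * (PhiO (level (Some (c + q / 8)) (small k) c) -
    PhiO (level (Some (c - q / 8)) (small k) c)) @[k --> \oo] --> fine (mu A).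
  have c1 : PhiO (level (Some (c + q / 8)) (small k) c) @[k --> \oo] --> below (Some (c + q / 8)) c.
    by apply: cvg_PhiO_0 => -[] E; lra.
  have c2 : PhiO (level (Some (c - q / 8)) (small k) c) @[k --> \oo] --> below (Some (c - q / 8)) c.
    by apply: cvg_PhiO_0 => -[] E; lra.
  have := cvgMr (a := fine (mu A)) (cvgB c1 c2).
  have -> : below (Some (c + q / 8)) c = 1 by rewrite /= lerDl divr_ge0// ltW.
  have -> : below (Some (c - q / 8)) c = 0 by rewrite /= lerBrDl gerDr leNgt divr_gt0.
  rewrite subr0 mulr1. by apply.
apply: (@le_trans _ _ (q `^ al + pi / 2 * 5 * V * Num.sqrt al)); last lra.
rewrite -(cvg_lim _ cw)//; apply: limr_le; first by apply/cvg_ex; eexists; exact: cw.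
by apply: nearW.
Qed.

Lemma set_approximation (A : set (Rinf R)) (e : R) : measurable A -> 0 < e ->
  exists n J, [/\ forall x : nat -> R, 0 <= comb J n x <= 1,
    `|fine (gamma A) - gcomb J n| < e &
    exists2 b, has_integral mu (fun x => comb J n x) b & `|fine (mu A) - b| < e].
Proof.
move=> mA e0.
have sD := sigma_algebra_approximable gamma mu comb_setsT comb_setsC comb_setsI measurable_comb_sets.
have [_ /(_ _ e0)[B [[n [J HJ]] PB QB]]] := measurable_sub_sigma sD
  (approximable_B gamma mu measurable_comb_sets) mA.
have mB : measurable B by apply: measurable_comb_sets; exists n, J.
have HB x : \1_B x = comb J n x by rewrite HJ indicE.
exists n, J; split.
- exact: comb_sets01 HJ.
- have -> : gcomb J n = fine (gamma B).
    apply: (has_integral_uniq (has_integral_comb hgamma J n)).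
    by apply: has_integral_ext (has_integral_indic gamma mB).
  exact: probability_symdiff.
- exists (fine (mu B)); last exact: probability_symdiff.
  by apply: has_integral_ext (has_integral_indic mu mB).
Qed.

(** The approximation error and [eps] are both [q / 2], so [gcomb J n + eps <= q], and [mu A] obeys
    the estimate of [smallness_limit]. *)
Lemma null_gaussian_null (A : set (Rinf R)) : measurable A -> gamma A = 0%E -> mu A = 0%E.
Proof.
move=> mA gA; have [V HV] := has_integral_normH.
rewrite -[LHS]fineK ?fin_num_measure//; congr EFin; apply/eqP; rewrite eq_le fine_ge0// andbT.
apply: (@smallness_limit _ _ (pi / 2 * 5 * V)) => al q al01 /andP[q0 q1].
have q20 : 0 < q / 2 by lra.
have [n [J [J01]]] := set_approximation mA q20.
rewrite gA /= sub0r normrN ltr_norml => /andP[_ gJ] [b Hb]; rewrite ltr_norml => /andP[_ Hq].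
have q2 : 0 < q / 2 <= 1 by apply/andP; split; lra.
have H k := mehler_mean_le hgamma J01 hv_meas hv_l2 hv_L1 hmu al01 q2 HV (small_pihalf k).
have cv := @cvg_mehler_mean0 _ _ hgamma n J J01 mu hyperplane_null.
have -> : fine (mu A) = fine (mu A) - b + \int[mu]_x comb J n x.
  by case: Hb => _; rewrite /Rintegral => ->; rewrite subrK.
have : \int[mu]_x comb J n x <= q `^ al + pi / 2 * 5 * V * Num.sqrt al.
  rewrite -(cvg_lim _ cv)//; apply: limr_le; first by apply/cvg_ex; eexists; exact: cv.
  apply: nearW => k; apply: (le_trans (H k)).
  have : (gcomb J n + q / 2) `^ al <= q `^ al.
    have g0 := gcomb_ge0 hgamma J01; have /andP[/ltW al0 _] := al01.
    by rewrite ge0_ler_powR// ?nnegrE; lra.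
  lra.
lra.
Qed.

(** [small k] is at once the approximation error and the shift [eps], hence the errors below
    [2 * small k]; continuity of [D] at the two positive measures gives the limit. *)
Lemma set_quant (D : R -> R) (lam kap : R) (A : set (Rinf R)) : 0 < lam ->
  drift_moment v mu lam kap ->
  (forall s : R, 0 < s <= 2 -> is_derive s (1 : R) D (- (s * (2 - ln s) `^ (2^-1 + kap))^-1)) ->
  measurable A -> 0 < fine (gamma A) -> 0 < fine (mu A) ->
  D (fine (gamma A)) - D (fine (mu A)) <= pi * lam.
Proof.
move=> lam0 HM HD mA gA0 mA0.
have cD (s : R) : 0 < s <= 2 -> {for s, continuous D}.
  move=> /HD h; apply: differentiable_continuous; apply/derivable1_diffP.
  by case: h.
have le1 (P : probability (Rinf R) R) : fine (P A) <= 1.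
  by rewrite -lee_fin fineK ?fin_num_measure// probability_le1.
have /choice[p Hp] : forall k, exists p : R * R,
    [/\ `|fine (gamma A) - p.1| < 2 * small k, `|fine (mu A) - p.2| < 2 * small k &
      D p.1 - D p.2 <= pi * lam].
  move=> k; have k0 := @small_gt0 R k.
  have k1 : small k <= 1 :> R by rewrite invf_le1 ?ler1n ?ltr0n.
  have [n [J [J01 gJ [b Hb mJ]]]] := set_approximation mA k0.
  have k01 : 0 < (small k : R) <= 1 by rewrite k0.
  have b0 : 0 <= b by apply: (has_integral_le (has_integral0 mu) Hb) => x; case/andP: (J01 x).
  have b1 : b <= 1 by apply: (has_integral_le Hb (has_integral_cst mu 1)) => x; case/andP: (J01 x).
  exists (gcomb J n + small k, b + small k) => /=; split.
  - by move: gJ; rewrite !ltr_norml; lra.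
  - by move: mJ; rewrite !ltr_norml; lra.
  have cv := @cvg_mehler_mean0 _ _ hgamma n J J01 mu hyperplane_null.
  have {}cv : D (gcomb J n + small k) - D (\int[mu]_x @mehler R n J (small l) (rowof x) + small k)
      @[l --> \oo] --> D (gcomb J n + small k) - D (b + small k).
    apply: cvgB; first exact: cvg_cst.
    have bs : 0 < b + small k <= 2 by apply/andP; split; lra.
    apply: (continuous_cvg _ (cD _ bs)); apply: cvgD; last exact: cvg_cst.
    have <- : \int[mu]_x comb J n x = b by case: Hb => _; rewrite /Rintegral => ->.
    exact: cv.
  rewrite -(cvg_lim _ cv)//; apply: limr_le; first by apply/cvg_ex; eexists; exact: cv.
  apply: nearW => l.
  exact: (mehler_mean_quant hgamma J01 hv_meas hv_l2 hv_L1 hmu lam0 HM HD k01 (small_pihalf l)).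
have cp (x : R) (q : nat -> R) : (forall k, `|x - q k| < 2 * small k) -> q k @[k --> \oo] --> x.
  move=> H; apply/cvgrPdist_lt => e e0; near=> k.
  apply: (lt_trans (H k)); rewrite -ltr_pdivlMl//; near: k.
  by apply: (cvgr_lt 0); [exact: cvg_small|rewrite mulr_gt0].
have cv : D (p k).1 - D (p k).2 @[k --> \oo] --> D (fine (gamma A)) - D (fine (mu A)).
  apply: cvgB; (apply: continuous_cvg; [apply: cD|apply: cp => k; by case: (Hp k)]).
    by rewrite gA0 (le_trans (le1 _))// ler1n.
  by rewrite mA0 (le_trans (le1 _))// ler1n.
rewrite -(cvg_lim _ cv)//; apply: limr_le; first by apply/cvg_ex; eexists; exact: cv.
by apply: nearW => k; case: (Hp k).
Unshelve. all: by end_near. Qed.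

End transfer.

(** * Drift moments under Orlicz bounds *)

Section has_integral_dominated.
Context d (T : measurableType d) (R : realType) (P : probability T R).
Implicit Types f g : T -> R.

Lemma has_integral_measurable f a : has_integral P f a -> measurable_fun setT f.
Proof. by move=> [/measurable_int/measurable_EFinP]. Qed.

Lemma has_integral_dominated f g b : measurable_fun setT f -> (forall x, 0 <= f x) ->
  (forall x, 0 <= g x) -> {ae P, forall x, f x <= g x} -> has_integral P g b ->
  exists2 a, has_integral P f a & a <= b.
Proof.
move=> mf f0 g0 fg Hg; have [gi gb] := Hg.
have le : (\int[P]_x (f x)%:E <= \int[P]_x (g x)%:E)%E.
  apply: ae_ge0_le_integral => //.
  - by move=> x _; rewrite lee_fin.
  - exact/measurable_EFinP.
  - by move=> x _; rewrite lee_fin.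
  - exact/measurable_EFinP/(has_integral_measurable Hg).
  - by apply: filterS fg => x fgx _; rewrite lee_fin.
have fin : (\int[P]_x (f x)%:E)%E \is a fin_num.
  rewrite ge0_fin_numE; last by apply: integral_ge0 => x _; rewrite lee_fin.
  by rewrite (le_lt_trans le)// gb ltry.
exists (fine (\int[P]_x (f x)%:E)); first by apply: has_integral_ge0 => //; rewrite fineK.
by rewrite -lee_fin fineK// -gb.
Qed.

Lemma has_integral_gt0 f a : (forall x, 0 < f x) -> has_integral P f a -> 0 < a.
Proof.
move=> f0 Hf; have a0 : 0 <= a by apply: (has_integral_le (has_integral0 P) Hf) => x; exact: ltW.
rewrite lt_neqAle a0 andbT; apply/negP => /eqP a0'.
have mf := has_integral_measurable Hf; case: Hf => _; rewrite -a0' => I0.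
have : ae_eq P setT (EFin \o f) (cst 0%E).
  apply/ae_eq_integral_abs => //; first exact/measurable_EFinP.
  by under eq_integral do rewrite /= gtr0_norm//.
move=> [N [mN PN sub]].
have : (P setT <= P N)%E.
  rewrite le_measure ?inE// => x _; apply: sub => /= /(_ I) [] E.
  by have := f0 x; rewrite E ltxx.
by rewrite PN [leLHS]probability_setT lee_fin ler10.
Qed.

End has_integral_dominated.

Section young.
Context {R : realType}.
Implicit Types (a b q s t g X L : R).

Lemma double_le_expR s : 2 * s <= expR s.
Proof.
have h := expR_ge1Dx (s - 1); have h1 := expR_ge1Dx (1 : R).
have -> : expR s = expR 1 * expR (s - 1) by rewrite -expRD; congr expR; lra.
have := expR_gt0 (s - 1); nra.
Qed.

(** A variational entropy inequality for [g] bounded by 2: the pointwise bound [g s <= e^s] at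
    [s = X - L] replaces the usual term [g ln g]. *)
Lemma entropy_young g X L : 0 < g <= 2 -> g * X <= g * L + expR (X - L).
Proof.
move=> /andP[g0 g2]; have h := double_le_expR (X - L).
have := expR_gt0 (X - L); case: (lerP 0 (X - L)) => ?; nra.
Qed.

(** Concavity of [s^q], with the tangent at 1, obtained from Young's inequality for [s^q] and 1 with
    exponents [1 / q] and [1 / (1 - q)]. *)
Lemma powR_le_affine s q : 0 <= s -> 0 <= q <= 1 -> s `^ q <= 1 + q * (s - 1).
Proof.
move=> s0 /andP[]; rewrite le_eqVlt => /predU1P[<-|q0]; first by rewrite powRr0 mul0r addr0.
rewrite le_eqVlt => /predU1P[->|q1]; first by rewrite powRr1// mul1r subrKC.
have := @conjugate_powR R (s `^ q) 1 q^-1 (1 - q)^-1 (powR_ge0 _ _) ler01.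
rewrite !invr_gt0 subr_gt0 q0 q1 !invrK subrKC => /(_ isT isT erefl).
rewrite -powRrM divff ?gt_eqF// powRr1// powR1 mulr1; lra.
Qed.

Lemma powR_le_scaled X L q : 0 <= X -> 0 < L -> 0 <= q <= 1 ->
  X `^ q <= L `^ q * (1 + X / L).
Proof.
move=> X0 L0 /andP[q0 q1]; have XL : 0 <= X / L by rewrite divr_ge0// ltW.
rewrite -{1}(divfK (lt0r_neq0 L0) X) powRM ?(ltW L0)// mulrC ler_pM2l ?powR_gt0//.
have q01 : 0 <= q <= 1 by rewrite q0.
by apply: (le_trans (powR_le_affine XL q01)); nra.
Qed.

End young.

Section drift_moments.
Context {R : realType} (v : Rinf R -> Rinf R) (mu : probability (Rinf R) R).
Hypothesis mv : measurable_fun setT (fun x => normH (v x)).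
Variable lam : R.
Hypothesis lam0 : 0 < lam.

(** With [X = (|v| / lam)^m], the entropy inequality at [L = 1 - ln u] bounds the integral of [g X]
    by [u (1 - ln u) + u Z / e <= u L'], as [Z <= 2 <= e]. Since [2 / m <= 1], the power in
    [|v|^2 = lam^2 X^(2/m)] is linearised at the scale [L'], and its two terms contribute at most
    [u] each. *)
Lemma drift_moment_exp (m Z : R) : 2 <= m ->
  has_integral mu (fun x => expR ((lam^-1 * normH (v x)) `^ m)) Z -> Z <= 2 ->
  drift_moment v mu lam m^-1.
Proof.
move=> m2 HZ Z2 g u mg g02 Hu.
have g0 x : 0 < g x by case/andP: (g02 x).
have u0 := has_integral_gt0 g0 Hu.
have u2 : u <= 2.
  by apply: (has_integral_le Hu (has_integral_cst mu 2)) => x; case/andP: (g02 x).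
set L := 1 - ln u; set L' := 2 - ln u.
have L0 : 0 < L' by have := ln_le_sub1 u0; rewrite /L'; lra.
pose X x := (lam^-1 * normH (v x)) `^ m.
have q01 : 0 <= 2 / m <= 1.
  have m0 : 0 < m by lra.
  by rewrite divr_ge0 ?(ltW m0)//= ler_pdivrMr// mul1r.
have nvX x : normH (v x) ^+ 2 = lam ^+ 2 * X x `^ (2 / m).
  have n0 : 0 <= lam^-1 * normH (v x) by rewrite mulr_ge0 ?normH_ge0// invr_ge0 ltW.
  rewrite /X -powRrM mulrCA mulfV ?mulr1; last by lra.
  by rewrite powR_mulrn// exprMn exprVn mulrA divff ?mul1r// expf_neq0// gt_eqF.
have mX : measurable_fun setT X.
  apply: (measurableT_comp (measurable_powR _)); exact: measurable_funM.
have HgX : exists2 b, has_integral mu (fun x => g x * X x) b & b <= u * L'.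
  have := has_integralD (has_integralZ L Hu) (has_integralZ (expR (- L)) HZ).
  move=> /(has_integral_dominated (f := fun x => g x * X x)) [].
  - exact: measurable_funM.
  - by move=> x; rewrite mulr_ge0 ?powR_ge0 ?(ltW (g0 x)).
  - move=> x; have := entropy_young (X x) L (g02 x); rewrite [g x * L]mulrC expRD [expR (X x) * _]mulrC.
    by apply: le_trans; rewrite mulr_ge0 ?powR_ge0 ?(ltW (g0 x)).
  - apply: aeW => x; have := entropy_young (X x) L (g02 x).
    by rewrite [g x * L]mulrC expRD [expR (X x) * _]mulrC.
  move=> b Hb bL; exists b => //; apply: (le_trans bL).
  rewrite /L /L' opprB expRD lnK ?posrE//.
  have e0 := expR_gt0 (-1 : R); have e1 : 2 * expR (-1) <= 1 :> R.
    by have := double_le_expR (1 : R); rewrite expRN ler_pdivrMr ?expR_gt0// mul1r mulr1.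
  have : u * expR (-1) * Z <= u * expR (-1) * 2 by rewrite ler_pM2l// mulr_gt0.
  nra.
have [b Hb bL] := HgX.
have HI := has_integralZ (lam ^+ 2 * L' `^ (2 / m)) (has_integralD Hu (has_integralZ L'^-1 Hb)).
have := has_integral_dominated (f := fun x => g x * normH (v x) ^+ 2) _ _ _ _ HI.
have pw x : g x * normH (v x) ^+ 2 <= lam ^+ 2 * L' `^ (2 / m) * (g x + L'^-1 * (g x * X x)).
  rewrite nvX (_ : _ * (g x + _) = g x * (lam ^+ 2 * (L' `^ (2 / m) * (1 + X x / L')))); last by ring.
  rewrite !ler_pM2l ?exprn_gt0//; exact: powR_le_scaled (powR_ge0 _ _) L0 q01.
have p0 x : 0 <= g x * normH (v x) ^+ 2 by rewrite mulr_ge0 ?sqr_ge0 ?(ltW (g0 x)).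
case => //.
- by apply: measurable_funM => //; exact: measurable_funX.
- by move=> x; apply: (le_trans (p0 x)).
- exact: aeW.
move=> I HI' IL; exists I => //; apply: (le_trans IL).
rewrite (_ : 2 * lam ^+ 2 * u * _ = lam ^+ 2 * L' `^ (2 / m) * (2 * u)); last by rewrite /L'; ring.
rewrite ler_pM2l ?mulr_gt0 ?exprn_gt0 ?powR_gt0//.
have : L'^-1 * b <= u by rewrite ler_pdivrMl// mulrC.
lra.
Qed.

Lemma drift_moment_bounded : {ae mu, forall x, normH (v x) <= lam} -> drift_moment v mu lam 0.
Proof.
move=> H g u mg g02 Hu.
have g0 x : 0 < g x by case/andP: (g02 x).
have := has_integral_dominated (f := fun x => g x * normH (v x) ^+ 2) _ _ _ _
  (has_integralZ (lam ^+ 2) Hu).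
case => //.
- by apply: measurable_funM => //; exact: measurable_funX.
- by move=> x; rewrite mulr_ge0 ?sqr_ge0 ?(ltW (g0 x)).
- by move=> x; rewrite mulr_ge0 ?sqr_ge0 ?(ltW (g0 x)).
- apply: filterS H => x Hx; rewrite mulrC ler_pM2r//.
  by rewrite lerXn2r ?nnegrE ?normH_ge0 ?(ltW lam0).
move=> I HI IL; exists I => //; apply: (le_trans IL); rewrite mulr0 powRr0 mulr1.
have u0 := has_integral_gt0 g0 Hu; rewrite ler_pM2r//.
have := exprn_ge0 2 (ltW lam0); lra.
Qed.

End drift_moments.

Section entropy_scale.
Context {R : realType}.
Implicit Types (s q : R).

Lemma two_sub_ln_gt0 s : 0 < s <= 2 -> 0 < 2 - ln s.
Proof. by move=> /andP[s0 s2]; have := ln_le_sub1 s0; lra. Qed.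

Lemma is_derive_two_sub_ln s : 0 < s -> is_derive s (1 : R) (fun x => 2 - ln x) (- s^-1).
Proof.
move=> s0; have h := is_derive1_ln s0.
by rewrite -[- s^-1]add0r; apply: is_deriveB.
Qed.

Lemma is_derive_lnln s : 0 < s <= 2 -> is_derive s (1 : R) (fun x => ln (2 - ln x))
  (- (s * (2 - ln s) `^ (2^-1 + 2^-1))^-1).
Proof.
move=> s02; have L0 := two_sub_ln_gt0 s02; have /andP[s0 _] := s02.
have -> : 2^-1 + 2^-1 = 1 :> R by field.
rewrite powRr1 ?(ltW L0)// (_ : - _ = (2 - ln s)^-1 * - s^-1); last first.
  by field; rewrite !gt_eqF.
apply: (is_derive_comp1 (b := @ln R)); first exact: is_derive1_ln.
exact: is_derive_two_sub_ln.
Qed.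

(** Here [kap = 1/2 - q], with [q = 1/2 - 1/m] under a [psi_m] bound and [q = 1/2] for bounded
    drift. At [q = 0] the primitive becomes the iterated logarithm of [is_derive_lnln]. *)
Lemma is_derive_powln q s : 0 < q -> 0 < s <= 2 ->
  is_derive s (1 : R) (fun x => q^-1 * (2 - ln x) `^ q)
    (- (s * (2 - ln s) `^ (2^-1 + (2^-1 - q)))^-1).
Proof.
move=> q0 s02; have L0 := two_sub_ln_gt0 s02; have /andP[s0 _] := s02.
have -> : 2^-1 + (2^-1 - q) = 1 - q by field.
rewrite (_ : - _ = q^-1 * (q * (2 - ln s) `^ (q - 1) * - s^-1)).
  apply: is_derive_scalef; apply: (is_derive_comp1 (b := fun x => x `^ q)).
    exact: is_derive1_powR.
  exact: is_derive_two_sub_ln.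
rewrite -[q - 1]opprB powRN; field; rewrite !gt_eqF ?powR_gt0//.
Qed.

(** Concavity: the tangent to [x^q] at [a], obtained by scaling the one at 1. *)
Lemma powR_diff_ge a b q : 0 < a -> 0 <= b -> 0 <= q <= 1 ->
  q * a `^ (q - 1) * (a - b) <= a `^ q - b `^ q.
Proof.
move=> a0 b0 q01; have := powR_le_affine (divr_ge0 b0 (ltW a0)) q01.
have E : b `^ q = (b / a) `^ q * a `^ q.
  by rewrite -powRM ?(divr_ge0 b0) ?(ltW a0)// divfK// gt_eqF.
have E1 : a `^ q = a * a `^ (q - 1).
  by rewrite -{2}[a]powRr1 ?(ltW a0)// -powRD ?(gt_eqF a0) ?implybT// subrKC.
rewrite E -(ler_pM2r (powR_gt0 q a0)) => h.
have -> : q * a `^ (q - 1) * (a - b) = q * (1 - b / a) * a `^ q.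
  by rewrite E1; field; rewrite gt_eqF.
nra.
Qed.

End entropy_scale.

(** Unit layers: [e^(eps Y)] is at most the sum over [k <= Y] of [e^(eps (k + 1))], and the tail
    bound turns the integral into a geometric series of ratio [e^(eps - s)]. *)
Lemma exp_tail_integrable d (T : measurableType d) (R : realType) (P : probability T R)
    (Y : T -> R) (C s eps : R) : measurable_fun setT Y -> (forall x, 0 <= Y x) -> 1 <= C ->
  (forall y, 0 < y -> (P [set x | (y <= Y x)%R] <= (C * expR (- (s * y)))%:E)%E) ->
  eps < s -> P.-integrable setT (fun x => (expR (eps * Y x))%:E).
Proof.
move=> mY Y0 C1 tail es.
have mE : measurable_fun setT (fun x => expR (eps * Y x)).
  by apply: measurableT_comp => //; exact: measurable_funM.
have [e0|e0] := lerP eps 0.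
  have [|a []//] := @has_integral_bounded _ _ _ P _ 1 mE.
  by move=> x; rewrite gtr0_norm ?expR_gt0// expR_le1 mulr_le0_ge0.
have mA k : measurable [set x | k%:R <= Y x].
  rewrite (_ : [set _ | _] = setT `&` Y @^-1` `[k%:R, +oo[); first exact: mY.
  by apply/seteqP; split => x /=; rewrite in_itv/= andbT// => -[].
(* [C >= 1] covers the layer [k = 0], to which the tail hypothesis does not extend. *)
have tail0 k : (P [set x | (k%:R <= Y x)%R] <= (C * expR (- (s * k%:R)))%:E)%E.
  case: k => [|k]; last by apply: tail; rewrite ltr0n.
  by rewrite mulr0 oppr0 expR0 mulr1 (le_trans (probability_le1 P _))// lee_fin.
pose z := expR (eps - s); pose u k := (expR (eps * k.+1%:R))%:E%E.
pose g k x := (u k * (\1_[set x | (k%:R <= Y x)%R] x)%:E)%E.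
have u0 k : (0 <= u k)%E by rewrite lee_fin expR_ge0.
have g0 k x : (0 <= g k x)%E by rewrite mule_ge0// lee_fin indicE.
have mg k : measurable_fun setT (g k).
  by apply: emeasurable_funM; [exact: measurable_cst|apply/measurable_EFinP; exact: measurable_indic].
have z01 : 0 < z < 1 by rewrite expR_gt0 expR_lt1 subr_lt0.
have /andP[z0 z1] := z01.
have Ig k : (\int[P]_x g k x <= (geometric (C * expR eps) z k)%:E)%E.
  rewrite ge0_integralZl//=; last by apply/measurable_EFinP; exact: measurable_indic.
  rewrite integral_indic// setIT.
  apply: (le_trans (lee_wpmul2l (u0 k) (tail0 k))).
  rewrite -EFinM lee_fin /geometric /= mulrCA -mulrA ler_pM2l ?(lt_le_trans ltr01)//.
  rewrite -expRM_natl -!expRD ler_expR -natr1; lra.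
have M0 : (\sum_(k <oo) \int[P]_x g k x <= (C * expR eps * (1 - z)^-1)%:E)%E.
  apply: lime_le.
    by apply: is_cvg_nneseries => k _ _; apply: integral_ge0.
  apply: nearW => n; apply: (@le_trans _ _ (\sum_(0 <= k < n) (geometric (C * expR eps) z k)%:E)%E).
    by apply: lee_sum => k _; exact: Ig.
  rewrite sumEFin lee_fin.
  rewrite -/(series _ n) geometric_le_lim//; last by rewrite gtr0_norm.
  by rewrite mulr_ge0 ?expR_ge0// (le_trans ler01).
apply/integrableP; split; first exact/measurable_EFinP.
apply: (@le_lt_trans _ _ (\int[P]_x (\sum_(k <oo) g k x))%E).
  apply: ge0_le_integral => //.
  - by apply: measurableT_comp => //; exact/measurable_EFinP.
  - by apply: ge0_emeasurable_sum.
  - move=> x _; rewrite /= gtr0_norm ?expR_gt0//.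
    have [k1 k2] : (Num.truncn (Y x))%:R <= Y x /\ Y x < (Num.truncn (Y x)).+1%:R.
      by have /andP[] := truncn_itv (Y0 x).
    set k := Num.truncn (Y x) in k1 k2.
    apply: (@le_trans _ _ (\sum_(0 <= i < k.+1) g i x)%E); last first.
      by apply: (@nneseries_lim_ge _ (fun i => g i x) xpredT 0).
    rewrite big_nat_recr//= (@le_trans _ _ (g k x))//; last first.
      by rewrite leeDr// sume_ge0.
    by rewrite /g indicE mem_set//= mule1 lee_fin ler_expR ler_pM2l// ltW.
by rewrite integral_nneseries// (le_lt_trans M0)// ltry.
Qed.

(** * Orlicz norms *)

Section orlicz.
Context d (T : measurableType d) (R : realType) (P : probability T R).

Lemma psi_ge0 (m t : R) : 0 <= psi m t.
Proof. by rewrite subr_ge0 -expR0 ler_expR powR_ge0. Qed.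

Lemma measurable_psi (m l : R) (w : T -> R) : measurable_fun setT w ->
  measurable_fun setT (fun x => psi m (l * `|w x|)).
Proof.
move=> mw; apply: measurable_funB => //; apply: measurableT_comp => //.
apply: (measurableT_comp (measurable_powR _)); apply: measurable_funM => //.
exact: measurableT_comp.
Qed.

(** Concavity of [x^(1/C)] at [x = e^(t^m)]: rescaling by [C^(1/m)] brings a finite Orlicz integral
    below 1. *)
Lemma psi_shrink (m t C : R) : 0 < m -> 0 <= t -> 1 <= C -> psi m (C `^ (- m^-1) * t) <= C^-1 * psi m t.
Proof.
move=> m0 t0 C1; have C0 : 0 < C by exact: lt_le_trans C1.
rewrite /psi powRM ?powR_ge0// -powRrM mulNr mulVf ?gt_eqF// powR_inv1 ?(ltW C0)//.
have C01 : 0 <= C^-1 <= 1 by rewrite invr_ge0 (ltW C0) invf_le1.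
have := powR_le_affine (expR_ge0 (t `^ m)) C01.
rewrite -expRM [t `^ m * _]mulrC; lra.
Qed.

(** Membership only makes some integral finite. After rescaling it is at most 1, so the infimum runs
    over a nonempty set and can be approached. *)
Lemma Lpsi_norm_approx (m : R) (w : T -> R) : 0 < m -> in_Lpsi P m w ->
  0 <= Lpsi_norm P m w /\ forall e, 0 < e -> exists l,
    [/\ 0 < l, l < Lpsi_norm P m w + e & (\int[P]_x (psi m (l^-1 * `|w x|))%:E <= 1)%E].
Proof.
move=> m0 [mw [l0 l00 Hl0]]; rewrite /Lpsi_norm; set S := [set l | _].
have lbS : lbound S 0 by move=> l [/ltW].
have I0 : (0 <= \int[P]_x (psi m (l0^-1 * `|w x|))%:E)%E.
  by apply: integral_ge0 => x _; rewrite lee_fin psi_ge0.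
have [K HK] : exists K, (\int[P]_x (psi m (l0^-1 * `|w x|))%:E)%E = K%:E.
  by exists (fine (\int[P]_x (psi m (l0^-1 * `|w x|))%:E)%E); rewrite fineK// ge0_fin_numE.
have K0 : 0 <= K by rewrite -lee_fin -HK.
have C1 : 1 <= K + 1 by rewrite lerDr.
have C0 : 0 < K + 1 by exact: lt_le_trans C1.
have Sn0 : S !=set0.
  exists (l0 * (K + 1) `^ (m^-1)); split; first by rewrite mulr_gt0// powR_gt0.
  apply: (@le_trans _ _ (\int[P]_x (((K + 1)^-1)%:E * (psi m (l0^-1 * `|w x|))%:E))%E).
    apply: ge0_le_integral => //.
    - by move=> x _; rewrite lee_fin psi_ge0.
    - by apply/measurable_EFinP; exact: measurable_psi.
    - by apply/measurable_EFinP; apply: measurable_funM => //; exact: measurable_psi.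
    - move=> x _; rewrite -EFinM lee_fin.
      have t0 : 0 <= l0^-1 * `|w x| by rewrite mulr_ge0// invr_ge0 ltW.
      rewrite (_ : _ * `|w x| = (K + 1) `^ (- m^-1) * (l0^-1 * `|w x|)); first exact: psi_shrink.
      by rewrite powRN invfM; ring.
  rewrite ge0_integralZl//=.
  - by rewrite HK -EFinM lee_fin mulrC ler_pdivrMr// mul1r lerDl.
  - by apply/measurable_EFinP; exact: measurable_psi.
  - by move=> x _; rewrite lee_fin psi_ge0.
  - by rewrite lee_fin invr_ge0 ltW.
have hS : has_inf S by split => //; exists 0.
split; first exact: lb_le_inf.
by move=> e e0; have [l [l1 l2] l3] := inf_adherent e0 hS; exists l.
Qed.

End orlicz.

(** * Level sets of the density *)

Section density.
Context {R : realType} (gamma : probability (Rinf R) R).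
Hypothesis hgamma : std_gaussian_power gamma.
Variables (v : Rinf R -> Rinf R) (mu : probability (Rinf R) R).
Hypotheses (hv_meas : measurable_fun setT v) (hv_l2 : forall x, in_l2 (v x)).
Hypothesis hv_L1 : mu.-integrable setT (fun x => (normH (v x))%:E).
Hypothesis hmu : forall (n : nat) (phi : Rinf R -> R), FC0 n phi ->
  (\int[mu]_x (drift_OU v n phi x)%:E = 0)%E.
Local Notation nv := (fun x : Rinf R => normH (v x)).

Lemma measurable_normH : measurable_fun setT nv.
Proof. by have := measurable_int mu hv_L1; move=> /measurable_EFinP. Qed.

Lemma Lpsi_drift_moment (m : R) : 2 <= m -> in_Lpsi mu m nv ->
  0 <= Lpsi_norm mu m nv /\ forall e, 0 < e -> exists lam,
    [/\ 0 < lam, lam < Lpsi_norm mu m nv + e & drift_moment v mu lam m^-1].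
Proof.
move=> m2 Hm; have m0 : 0 < m by lra.
have [N0 HN] := Lpsi_norm_approx m0 Hm; split => // e e0.
have [l [l0 le Hl]] := HN e e0; exists l; split => //.
have mp := measurable_psi m l^-1 measurable_normH.
have [Z HZ Z1] : exists2 Z, has_integral mu (fun x => psi m (l^-1 * `|nv x|)) Z & Z <= 1.
  have I0 : (0 <= \int[mu]_x (psi m (l^-1 * `|nv x|))%:E)%E.
    by apply: integral_ge0 => x _; rewrite lee_fin psi_ge0.
  exists (fine (\int[mu]_x (psi m (l^-1 * `|nv x|))%:E)).
    apply: has_integral_ge0 => //; first by move=> x; exact: psi_ge0.
    by rewrite fineK// ge0_fin_numE// (le_lt_trans Hl)// ltry.
  by rewrite -lee_fin fineK// ge0_fin_numE// (le_lt_trans Hl)// ltry.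
have := has_integralD HZ (has_integral_cst mu 1).
move=> /(has_integral_ext (g := fun x => expR ((l^-1 * normH (v x)) `^ m))) H.
apply: (drift_moment_exp measurable_normH l0 m2 (H _)); last lra.
by move=> x; rewrite /psi subrK ger0_norm// normH_ge0.
Qed.

Variable f : Rinf R -> R.
Hypotheses (f0 : forall x, 0 <= f x) (mf : measurable_fun setT f).
Hypothesis muf : forall A, measurable A -> (mu A = \int[gamma]_(x in A) (f x)%:E)%E.

Lemma measurable_level t : measurable [set x | t <= f x].
Proof.
rewrite (_ : [set _ | _] = setT `&` f @^-1` `[t, +oo[); first exact: mf.
by apply/seteqP; split => x /=; rewrite in_itv/= andbT// => -[].
Qed.

Lemma level_mass t : 0 <= t ->
  t * fine (gamma [set x | t <= f x]) <= fine (mu [set x | t <= f x]).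
Proof.
move=> t0; have mA := measurable_level t; set A := [set x | _] in mA *.
rewrite -lee_fin EFinM !fineK ?fin_num_measure// muf// -integral_cst//.
apply: ge0_le_integral => //.
by apply/measurable_EFinP; exact: measurable_funTS.
Qed.

(** The inequality [t * gamma A <= mu A] in logarithms, written through [2 - ln] because [D] acts on
    that scale. *)
Lemma level_log t (A := [set x | t <= f x]) : 0 < t -> 0 < fine (gamma A) ->
  [/\ 0 < fine (mu A) <= 2, 0 < fine (gamma A) <= 2 &
    ln t <= (2 - ln (fine (gamma A))) - (2 - ln (fine (mu A)))].
Proof.
move=> t0 gA0; have mA := measurable_level t; have H := level_mass (ltW t0).
have le1 (P : probability (Rinf R) R) : fine (P A) <= 1.
  by rewrite -lee_fin fineK ?fin_num_measure// probability_le1.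
have mA0 : 0 < fine (mu A) by apply: lt_le_trans H; exact: mulr_gt0.
split.
- by rewrite mA0 (le_trans (le1 _))// ler1n.
- by rewrite gA0 (le_trans (le1 _))// ler1n.
- have : ln (t * fine (gamma A)) <= ln (fine (mu A)) by rewrite ler_ln ?posrE ?mulr_gt0.
  by rewrite lnM ?posrE//; lra.
Qed.

(** [ln a - ln b <= pi lam] reads [b >= a e^(- pi lam)], and [ln t <= a - b]. *)
Lemma level_bound_half (lam t : R) : 0 < lam -> drift_moment v mu lam 2^-1 -> 0 < t ->
  0 < fine (gamma [set x | t <= f x]) ->
  ln t <= (2 - ln (fine (gamma [set x | t <= f x]))) * (1 - expR (- (pi * lam))).
Proof.
move=> lam0 HM t0 gA0; have [mA2 gA2 Hln] := level_log t0 gA0.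
have := set_quant hgamma hv_meas hv_l2 hv_L1 hmu lam0 HM (@is_derive_lnln R)
  (measurable_level t) gA0 (andP mA2).1.
have a0 := two_sub_ln_gt0 gA2; have b0 := two_sub_ln_gt0 mA2.
set a := 2 - _ in a0 Hln *; set b := 2 - _ in b0 Hln * => H.
apply: (le_trans Hln); rewrite mulrBr mulr1 lerD2l lerN2.
rewrite -[a in leLHS]lnK ?posrE// -expRD -[leRHS]lnK ?posrE// ler_expR; lra.
Qed.

(** Here [a^q - b^q <= q pi lam], which the tangent at [a] turns into
    [a - b <= pi lam a^(1 - q)]. *)
Lemma level_bound_pow (lam q t : R) : 0 < lam -> 0 < q <= 1 -> drift_moment v mu lam (2^-1 - q) ->
  0 < t -> 0 < fine (gamma [set x | t <= f x]) ->
  ln t <= pi * lam * (2 - ln (fine (gamma [set x | t <= f x]))) `^ (1 - q).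
Proof.
move=> lam0 /andP[q0 q1] HM t0 gA0; have [mA2 gA2 Hln] := level_log t0 gA0.
have := set_quant hgamma hv_meas hv_l2 hv_L1 hmu lam0 HM
  (fun s => @is_derive_powln R q s q0) (measurable_level t) gA0 (andP mA2).1.
have a0 := two_sub_ln_gt0 gA2; have b0 := two_sub_ln_gt0 mA2.
set a := 2 - _ in a0 Hln *; set b := 2 - _ in b0 Hln *.
have q01 : 0 <= q <= 1 by rewrite ltW.
rewrite -mulrBr ler_pdivrMl// => H; have {}H := le_trans (powR_diff_ge a0 (ltW b0) q01) H.
move: H; rewrite -mulrA ler_pM2l// -opprB powRN mulrC ler_pdivrMr ?powR_gt0// opprB -[ln _ - 2]opprB -/b.
exact: le_trans.
Qed.

(** The constant [e^2] comes from the 2 in [2 - ln]. The value [S = +oo] is compatible only with a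
    null set, which is treated apart. *)
Lemma measure_exp_bound (A : set (Rinf R)) (S : \bar R) : measurable A ->
  (0 < fine (gamma A) -> (S <= (2 - ln (fine (gamma A)))%:E)%E) ->
  (gamma A <= (expR 2)%:E * expeR (- S))%E.
Proof.
move=> mA HS; have gA0 : 0 <= fine (gamma A) by rewrite fine_ge0.
move: gA0; rewrite le_eqVlt => /predU1P[g0|g0].
  by rewrite -[leLHS]fineK ?fin_num_measure// -g0 mule_ge0 ?expeR_ge0// lee_fin expR_ge0.
have := HS g0; case: S {HS} => [s|//|_] /=; last by rewrite mulry gtr0_sg ?expR_gt0// mul1e leey.
rewrite lee_fin => Hs.
  rewrite -[leLHS]fineK ?fin_num_measure// -EFinM lee_fin -expRD.
  by rewrite -[leLHS]lnK ?posrE// ler_expR; lra.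
Qed.

End density.

Section real_facts.
Context {R : realType}.
Implicit Types x y L C d eps : R.

Lemma le0_of_le_scaled L C : (forall e, 0 < e -> L <= e * C) -> L <= 0.
Proof.
move=> H; rewrite leNgt; apply/negP => L0.
have C1 : 0 < 1 + `|C| by rewrite ltr_pwDl.
have := H _ (divr_gt0 L0 C1); rewrite mulrAC ler_pdivlMr// ler_pM2l//.
have := ler_norm C; lra.
Qed.

Lemma ereal_real_between eps (S : \bar R) : (eps%:E < S)%E ->
  exists2 s, eps < s & (s%:E <= S)%E.
Proof.
case: S => [r|_|//]; first by rewrite lte_fin => h; exists r.
by exists (eps + 1); rewrite ?leey// ltrDl.
Qed.

Lemma le_ln_max1 c x : 0 < c -> (c <= ln (Num.max x 1)) = (expR c <= x).
Proof.
move=> c0; rewrite -[LHS]ler_expR (@lnK R) ?posrE ?lt_max ?ltr01 ?orbT// le_max.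
by rewrite [X in _ || X]leNgt expR_gt1 c0 orbF.
Qed.

Lemma ln_max1_ge0 x : 0 <= ln (Num.max x 1).
Proof. by rewrite ln_ge0// le_max lexx orbT. Qed.

(* With [d = 1 - 2 / m], the constant [sigma_m] is at most
   [(2 * pi * N) `^ - qexp m]; since [y * e^(1 - y) <= 1] for [y = 1 / (2 - d)]. *)
Lemma sigma_factor_le1 d : 0 < d < 1 -> d / (2 - d) * (d `^ (2 / (2 - d)))^-1 <= 1.
Proof.
move=> /andP[d0 d1]; have e0 : 0 < 2 - d by lra.
have ei : 0 < (2 - d)^-1 by rewrite invr_gt0.
have di : 0 < d^-1 by rewrite invr_gt0.
rewrite -ler_ln ?posrE ?mulr_gt0 ?invr_gt0 ?powR_gt0// ln1.
rewrite lnM ?posrE ?divr_gt0 ?invr_gt0 ?powR_gt0// ln_div ?posrE// lnV ?posrE ?powR_gt0// ln_powR.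
have := ln_le_sub1 ei; have := ln_le_sub1 di; rewrite !lnV ?posrE// => h1 h2.
have h3 : d / (2 - d) * - ln d <= d / (2 - d) * (d^-1 - 1) by rewrite ler_pM2l ?divr_gt0.
have E : d / (2 - d) * (d^-1 - 1) = 1 - (2 - d)^-1 by field; rewrite !gt_eqF.
have E2 : 2 / (2 - d) * ln d = ln d + d / (2 - d) * ln d by field; rewrite gt_eqF.
lra.
Qed.

End real_facts.

(** * Tail exponents in the three cases *)

Section exponents.
Context {R : realType} (gamma : probability (Rinf R) R).
Hypothesis hgamma : std_gaussian_power gamma.
Variables (v : Rinf R -> Rinf R) (mu : probability (Rinf R) R).
Hypotheses (hv_meas : measurable_fun setT v) (hv_l2 : forall x, in_l2 (v x)).
Hypothesis hv_L1 : mu.-integrable setT (fun x => (normH (v x))%:E).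
Hypothesis hmu : forall (n : nat) (phi : Rinf R -> R), FC0 n phi ->
  (\int[mu]_x (drift_OU v n phi x)%:E = 0)%E.
Local Notation nv := (fun x : Rinf R => normH (v x)).
Variable f : Rinf R -> R.
Hypotheses (f0 : forall x, 0 <= f x) (mf : measurable_fun setT f).
Hypothesis muf : forall A, measurable A -> (mu A = \int[gamma]_(x in A) (f x)%:E)%E.
Local Notation level t := [set x : Rinf R | t <= f x].
Local Notation a t := (2 - ln (fine (gamma (level t)))).

Lemma exponent_gt0 t : 0 < t -> 0 < fine (gamma (level t)) -> 0 < a t.
Proof.
move=> t0 g0; have [_ g2 _] := level_log mf muf t0 g0; exact: two_sub_ln_gt0 g2.
Qed.

Lemma exponent_psi2 t (S := ((1 - sigma2 (Lpsi_norm mu 2 nv))%:E^-1)%E) :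
  in_Lpsi mu 2 nv -> 0 < t -> 0 < fine (gamma (level t)) ->
  (S * (ln t)%:E <= (a t)%:E)%E.
Proof.
move=> H2 t0 g0; have a0 := exponent_gt0 t0 g0.
have [N0 HN] := Lpsi_drift_moment hv_L1 (lexx 2) H2.
have pi0 := @pi_gt0 R.
have HL lam : 0 < lam -> drift_moment v mu lam 2^-1 -> ln t <= a t * (1 - expR (- (pi * lam))).
  by move=> l0 HM; exact: (level_bound_half hgamma hv_meas hv_l2 hv_L1 hmu mf muf l0 HM t0 g0).
rewrite {}/S /sigma2; move: N0; rewrite le_eqVlt => /predU1P[N0|N0].
  (* Norm 0: arbitrarily small [lam] are admissible, so a level of positive measure has [t <= 1], in
     accordance with an infinite exponent. *)
  have L0 : ln t <= 0.
    apply: (@le0_of_le_scaled _ _ (a t * pi)) => e e0; have [lam [l0 le HM]] := HN e e0.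
    apply: (le_trans (HL lam l0 HM)); rewrite [leRHS]mulrC -mulrA ler_pM2l//.
    have := expR_ge1Dx (- (pi * lam)); have : pi * lam <= pi * e.
      by rewrite ler_pM2l// ltW// -[e]add0r N0.
    lra.
  rewrite -N0 mulr0 oppr0 expR0 subrr inve0.
  move: L0; rewrite le_eqVlt => /predU1P[->|L0]; first by rewrite mule0 lee_fin ltW.
  by rewrite mulyr ltr0_sg// mulN1e leNye.
(* The tolerance is the norm itself, so [lam] is below twice the norm and [pi * lam] below the
   exponent in [sigma2]. *)
have [lam [l0 le HM]] := HN _ N0.
have s0 : 0 < 1 - expR (- (2 * pi * Lpsi_norm mu 2 nv)).
  by rewrite subr_gt0 expR_lt1 oppr_lt0 !mulr_gt0.
rewrite inver gt_eqF// -EFinM lee_fin ler_pdivrMl//.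
apply: (le_trans (HL lam l0 HM)); rewrite mulrC ler_pM2r// lerD2l lerN2 ler_expR lerN2.
rewrite [2 * pi]mulrC -mulrA ler_pM2l//; lra.
Qed.

Lemma exponent_psi m t : 2 < m -> in_Lpsi mu m nv -> 1 < t ->
  0 < fine (gamma (level t)) ->
  (sigma m (Lpsi_norm mu m nv) * (ln t `^ qexp m)%:E <= (a t)%:E)%E.
Proof.
move=> m2 Hm t1 g0; have t0 : 0 < t by lra.
have a0 := exponent_gt0 t0 g0; have L0 : 0 < ln t by rewrite ln_gt0.
have [N0 HN] := Lpsi_drift_moment hv_L1 (ltW m2) Hm.
have pi0 := @pi_gt0 R; have m0 : 0 < m by lra.
have mi : 0 < m^-1 < 2^-1 by rewrite invr_gt0 m0 ltf_pV2// posrE.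
pose q := 2^-1 - m^-1; have q01 : 0 < q <= 1 by rewrite /q; apply/andP; split; lra.
have HL lam : 0 < lam -> drift_moment v mu lam m^-1 -> ln t <= pi * lam * a t `^ (1 - q).
  rewrite (_ : m^-1 = 2^-1 - q); last by rewrite /q; ring.
  by move=> l0 HM; exact: (level_bound_pow hgamma hv_meas hv_l2 hv_L1 hmu mf muf l0 q01 HM t0 g0).
move: N0; rewrite le_eqVlt => /predU1P[N0|N0].
  (* Norm 0 cannot occur with [t > 1]: arbitrarily small [lam] would force [ln t <= 0]. *)
  exfalso; suff : ln t <= 0 by lra.
  apply: (@le0_of_le_scaled _ _ (pi * a t `^ (1 - q))) => e e0; have [lam [l0 le HM]] := HN e e0.
  apply: (le_trans (HL lam l0 HM)); rewrite [pi * lam]mulrC -mulrA ler_pM2r ?mulr_gt0 ?powR_gt0//.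
  by rewrite ltW// -[e]add0r N0.
have [lam [l0 le HM]] := HN _ N0; set N := Lpsi_norm _ _ _ in N0 le *.
set d := 1 - 2 / m; have d01 : 0 < d < 1 by rewrite /d; apply/andP; split; lra.
have [d0 d1] := andP d01.
have d2 : 1 + 2 / m = 2 - d by rewrite /d; ring.
have r0 : 0 < qexp m by rewrite /qexp d2 divr_gt0//; lra.
rewrite /sigma -/d d2 inver gt_eqF ?powR_gt0 ?mulr_gt0//= -!EFinM lee_fin.
rewrite powRM ?(ltW d0) ?mulr_ge0 ?(ltW N0) ?(ltW pi0)//.
have HLN : ln t <= 2 * pi * N * a t `^ (1 - q).
  apply: (le_trans (HL lam l0 HM)); rewrite ler_pM2r ?powR_gt0// [2 * pi]mulrC -mulrA ler_pM2l//; lra.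
have {}HLN : ln t `^ qexp m <= (2 * pi * N) `^ qexp m * a t.
  have := ge0_ler_powR (ltW r0) _ _ HLN; rewrite !nnegrE (ltW L0) !mulr_ge0 ?powR_ge0 ?(ltW N0) ?(ltW pi0)//.
  move=> /(_ isT isT) /le_trans; apply.
  rewrite powRM ?powR_ge0 ?mulr_ge0 ?(ltW N0) ?(ltW pi0)// -powRrM.
  (* [1 - q = (1 + 2 / m) / 2] is the inverse of [qexp m]. *)
  rewrite (_ : (1 - q) * qexp m = 1) ?powRr1 ?(ltW a0)//.
  by rewrite /qexp /q; field; apply/andP; split; rewrite gt_eqF//; lra.
have := sigma_factor_le1 d01; rewrite -d2 -/(qexp m) d2.
have p0 : 0 < (2 * pi * N) `^ qexp m by rewrite powR_gt0 ?mulr_gt0.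
rewrite invfM; set P := _ `^ _ in p0 HLN *; set D := (d `^ _)^-1; set c := d / _ => cD.
have c0 : 0 <= c * D by rewrite mulr_ge0 ?invr_ge0 ?powR_ge0 ?divr_ge0 ?(ltW d0)//; lra.
apply: (@le_trans _ _ (c * D * a t)); last by rewrite ler_piMl// ltW.
rewrite (_ : c * (P^-1 * D) * _ = c * D * (P^-1 * ln t `^ qexp m)); last by ring.
by rewrite ler_wpM2l// ler_pdivrMl.
Qed.

Lemma exponent_bounded t : finite_norm mu +oo nv -> 1 < t -> 0 < fine (gamma (level t)) ->
  (sigma_oo (fine ('N[mu]_+oo[EFin \o nv])) * (ln t ^+ 2)%:E <= (a t)%:E)%E.
Proof.
move=> Hb t1 g0; have t0 : 0 < t by lra.
have a0 := exponent_gt0 t0 g0; have L0 : 0 < ln t by rewrite ln_gt0.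
have pi0 := @pi_gt0 R.
have NE : ('N[mu]_+oo[EFin \o nv])%E = ess_sup mu (abse \o (EFin \o nv)).
  by rewrite unlock /Lnorm ifT// [X in (_ < X)%E]probability_setT lte01.
have N0' := Lnorm_ge0 mu +oo%E (EFin \o nv).
have Nf : ('N[mu]_+oo[EFin \o nv])%E \is a fin_num by rewrite ge0_fin_numE.
set N := fine _; have N0 : 0 <= N by rewrite fine_ge0.
(* The essential supremum is itself an almost sure bound, so [lam = N] is admissible as soon as [N]
   is positive. *)
have HM lam : 0 < lam -> N <= lam -> drift_moment v mu lam (2^-1 - 2^-1).
  move=> l0 Nl; rewrite subrr; apply: drift_moment_bounded => //; first exact: (measurable_normH hv_L1).
  have := ess_sup_ge mu (abse \o (EFin \o nv)); apply: filterS => x; rewrite -NE -[X in (_ <= X)%E]fineK//.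
  by rewrite /= lee_fin ger0_norm ?normH_ge0// => /le_trans; apply.
have q01 : 0 < (2^-1 : R) <= 1 by apply/andP; split; lra.
have HL lam : 0 < lam -> N <= lam -> ln t <= pi * lam * a t `^ (1 - 2^-1).
  by move=> l0 Nl; exact: (level_bound_pow hgamma hv_meas hv_l2 hv_L1 hmu mf muf l0 q01 (HM lam l0 Nl) t0 g0).
move: N0; rewrite le_eqVlt => /predU1P[N0|N0].
  exfalso; suff : ln t <= 0 by lra.
  apply: (@le0_of_le_scaled _ _ (pi * a t `^ (1 - 2^-1))) => e e0.
  by have := HL e e0; rewrite -N0 ltW// [pi * e]mulrC -mulrA => /(_ isT).
have h2 : 1 - 2^-1 = 2^-1 :> R by lra.
have := HL N N0 (lexx _); rewrite h2 => {}HL.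
rewrite /sigma_oo inver gt_eqF ?exprn_gt0 ?mulr_gt0// -EFinM lee_fin ler_pdivrMl ?exprn_gt0 ?mulr_gt0//.
have : ln t ^+ 2 <= (pi * N * a t `^ 2^-1) ^+ 2.
  by rewrite lerXn2r ?nnegrE ?(ltW L0)// !mulr_ge0 ?powR_ge0 ?(ltW pi0) ?(ltW N0).
move=> /le_trans; apply; rewrite exprMn -[a t `^ _ ^+ 2]powR_mulrn ?powR_ge0// -powRrM mulVf ?pnatr_eq0// powRr1 ?(ltW a0)//.
rewrite ler_pM2r// -mulrA [leRHS]exprMn ler_peMl ?exprn_ge0 ?mulr_ge0 ?(ltW pi0) ?(ltW N0)//.
by rewrite expr2; lra.
Qed.

(** [th y] is the level of [f] at which [Y] reaches [y], so tails of [Y] are level estimates for [f]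
    with an exponent linear in [y]. A real [s] is inserted between [eps] and the possibly infinite
    [S]. *)
Lemma integrable_level_exp (Y : Rinf R -> R) (th : R -> R) (S : \bar R) (eps : R) :
  measurable_fun setT Y -> (forall x, 0 <= Y x) ->
  (forall y x, 0 < y -> (y <= Y x) = (th y <= f x)) ->
  (forall y, 0 < y -> 0 < fine (gamma (level (th y))) -> (S * y%:E <= (a (th y))%:E)%E) ->
  (eps%:E < S)%E -> gamma.-integrable setT (fun x => (expR (eps * Y x))%:E).
Proof.
move=> mY Y0 Yth HS /ereal_real_between[s es sS].
apply: (@exp_tail_integrable _ _ _ gamma Y (expR 2) s) => //.
  by rewrite -expR0 ler_expR.
move=> y y0; rewrite (_ : [set _ | _] = level (th y)); last first.
  by apply/seteqP; split => x /=; rewrite Yth.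
apply: (le_trans (@measure_exp_bound _ gamma _ (s * y)%:E (measurable_level mf _) _)) => //.
move=> g0; apply: le_trans (HS y y0 g0).
by rewrite EFinM lee_wpmul2r// lee_fin ltW.
Qed.

Lemma measurable_ln_max1 : measurable_fun setT (fun x => ln (Num.max (f x) 1)).
Proof. by apply: measurableT_comp => //; exact: measurable_maxr. Qed.

End exponents.

Lemma integrable_dominated d (T : measurableType d) (R : realType)
    (P : {measure set T -> \bar R}) (f g : T -> R) : measurable_fun setT f ->
  (forall x, 0 <= f x <= g x) -> P.-integrable setT (fun x => (g x)%:E) ->
  P.-integrable setT (fun x => (f x)%:E).
Proof.
move=> mf fg; apply: le_integrable => //; first exact/measurable_EFinP.
move=> x _; rewrite !abse_EFin lee_fin; have /andP[f0 fgx] := fg x.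
by rewrite !ger0_norm// (le_trans f0).
Qed.

Lemma le_powR_inv {R : realType} (y L r : R) : 0 < r -> 0 <= y -> 0 <= L ->
  (y <= L `^ r) = (y `^ r^-1 <= L).
Proof.
move=> r0 y0 L0; apply/idP/idP => h.
  have ri : 0 <= r^-1 by rewrite invr_ge0 ltW.
  have := ge0_ler_powR ri _ _ h; rewrite -powRrM divff ?gt_eqF// powRr1//.
  by apply; rewrite nnegrE ?powR_ge0.
have := ge0_ler_powR (ltW r0) _ _ h; rewrite -powRrM mulVf ?gt_eqF// powRr1//.
by apply; rewrite nnegrE ?powR_ge0.
Qed.

Lemma le_sqr_sqrt {R : realType} (y L : R) : 0 <= y -> 0 <= L ->
  (y <= L ^+ 2) = (Num.sqrt y <= L).
Proof.
by move=> y0 L0; rewrite -[RHS](ler_pXn2r (n := 2)) ?nnegrE ?sqrtr_ge0// sqr_sqrtr.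
Qed.

Unset Implicit Arguments.

Theorem corollary3p2 (R : realType) (gamma : probability (Rinf R) R)
    (hgamma : std_gaussian_power gamma)
    (v : Rinf R -> Rinf R)
    (hv_meas : measurable_fun setT v)
    (hv_l2 : forall x, in_l2 (v x))
    (mu : probability (Rinf R) R)
    (hv_L1 : mu.-integrable setT (fun x => (normH (v x))%:E))
    (hmu : forall (n : nat) (phi : Rinf R -> R), FC0 n phi ->
       (\int[mu]_x (drift_OU v n phi x)%:E = 0)%E) :
  let nv := fun x : Rinf R => normH (v x) in
  exists f : Rinf R -> R,
    [/\ gamma.-integrable setT (fun x => (f x)%:E),
        (forall A, measurable A -> mu A = \int[gamma]_(x in A) (f x)%:E)%E,
        in_Lpsi mu 2 nv ->
          let s2 := sigma2 (Lpsi_norm mu 2 nv) in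
          (forall t : R, 0 < t ->
             (gamma [set x | (t <= f x)%R]
               <= (expR 2)%:E * epow t (- ((1 - s2)%R%:E^-1)))%E) /\
          (forall p : R, 0 < p -> (p%:E < (1 - s2)%R%:E^-1)%E ->
             f \in Lfun gamma p%:E),
        forall m : R, 2 < m -> in_Lpsi mu m nv ->
          let sm := sigma m (Lpsi_norm mu m nv) in
          (forall t : R, 1 < t ->
             (gamma [set x | (t <= f x)%R]
               <= (expR 2)%:E * expeR (- (sm * (ln t `^ qexp m)%:E)))%E) /\
          (forall eps : R, (eps%:E < sm)%E ->
             gamma.-integrable setT
               (fun x => (expR (eps * ln (Num.max (f x) 1) `^ qexp m))%:E))
      & finite_norm mu +oo nv ->
          let soo := sigma_oo (fine ('N[mu]_+oo[EFin \o nv])%E) in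
          (forall t : R, 1 < t ->
             (gamma [set x | (t <= f x)%R]
               <= (expR 2)%:E * expeR (- (soo * (ln t ^+ 2)%:E)))%E) /\
          (forall eps : R, (eps%:E < soo)%E ->
             mu.-integrable setT
               (fun x => (expR (eps * ln (Num.max (f x) 1) ^+ 2))%:E))].
Proof.
move=> nv.
have dom : mu `<< gamma.
  apply/null_content_dominatesP => A mA.
  exact: (null_gaussian_null hgamma hv_meas hv_l2 hv_L1 hmu mA).
pose F := Radon_Nikodym_SigmaFinite.f mu gamma.
pose f x := fine (F x).
have fE x : (f x)%:E = F x by rewrite fineK//; exact: Radon_Nikodym_SigmaFinite.f_fin_num.
have f0 x : 0 <= f x by rewrite fine_ge0//; exact: Radon_Nikodym_SigmaFinite.f_ge0.
have fi : gamma.-integrable setT (fun x => (f x)%:E).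
  have -> : (fun x => (f x)%:E) = F by exact/funext.
  exact: Radon_Nikodym_SigmaFinite.f_integrable.
have mf : measurable_fun setT f by have /measurable_int/measurable_EFinP := fi.
have muf A : measurable A -> (mu A = \int[gamma]_(x in A) (f x)%:E)%E.
  by move=> mA; under eq_integral do rewrite fE; exact: Radon_Nikodym_SigmaFinite.f_integral.
have mln := measurable_ln_max1 mf.
have bound (t : R) (S : \bar R) :
    (0 < fine (gamma [set x | t <= f x]) ->
      (S <= (2 - ln (fine (gamma [set x | t <= f x])))%:E)%E) ->
    (gamma [set x | (t <= f x)%R] <= (expR 2)%:E * expeR (- S))%E.
  exact: measure_exp_bound (measurable_level mf t).
exists f; split => //.
- move=> H2 s2; split=> [t t0|p p0 pS].
    rewrite /epow mulNe.
    by apply: bound; exact: (exponent_psi2 hgamma hv_meas hv_l2 hv_L1 hmu mf muf).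
  (* [f^p] is at most [e^(p ln (max f 1))], whose tail at [y] is the level estimate at [t = e^y]. *)
  have Ip : gamma.-integrable setT (fun x => (expR (p * ln (Num.max (f x) 1)))%:E).
    apply: (integrable_level_exp mf (th := expR) mln _ _ _ pS).
    - by move=> x; exact: ln_max1_ge0.
    - by move=> y x y0; rewrite le_ln_max1.
    - move=> y y0 g0; rewrite -[y in (_ * y%:E)%E](@expRK R).
      by apply: (exponent_psi2 hgamma hv_meas hv_l2 hv_L1 hmu mf muf) => //; exact: expR_gt0.
  have If : gamma.-integrable setT (fun x => (f x `^ p)%:E).
    apply: (integrable_dominated _ _ Ip); first exact: measurableT_comp (measurable_powR _) mf.
    move=> x; rewrite powR_ge0/= mulrC expRM lnK ?posrE ?lt_max ?ltr01 ?orbT//.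
    by rewrite ge0_ler_powR ?(ltW p0) ?nnegrE// le_max ?f0 ?lexx.
  apply/andP; split; first by rewrite inE.
  rewrite inE /= /finite_norm unlock /Lnorm; apply: poweR_lty.
  under eq_integral do rewrite /= ger0_norm//.
  by rewrite ltey_eq (integrable_fin_num _ If).
- move=> m m2 Hm sm; split=> [t t1|eps epsS].
    by apply: bound; exact: (exponent_psi hgamma hv_meas hv_l2 hv_L1 hmu mf muf).
  have r0 : 0 < qexp m by rewrite /qexp divr_gt0// addr_gt0// divr_gt0//; lra.
  apply: (integrable_level_exp mf (Y := fun x => ln (Num.max (f x) 1) `^ qexp m)
    (th := fun y => expR (y `^ (qexp m)^-1)) _ _ _ _ epsS).
  + exact: measurableT_comp (measurable_powR _) mln.
  + by move=> x; exact: powR_ge0.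
  + move=> y x y0; rewrite -le_ln_max1 ?powR_gt0//.
    by rewrite le_powR_inv ?ln_max1_ge0// ltW.
  + move=> y y0 g0; set t := expR _ in g0 *.
    have -> : y = ln t `^ qexp m by rewrite expRK -powRrM mulVf ?gt_eqF// powRr1// ltW.
    apply: (exponent_psi hgamma hv_meas hv_l2 hv_L1 hmu mf muf) => //.
    by rewrite expR_gt1 powR_gt0.
- move=> Hb soo; split=> [t t1|eps epsS].
    by apply: bound; exact: (exponent_bounded hgamma hv_meas hv_l2 hv_L1 hmu mf muf).
  (* With [L = ln (max f 1)], integration against [mu] costs a further factor [f <= e^L]; half of
     the gap [s - eps] pays for it through [L <= de L^2 + 1 / (4 de)]. *)
  have [s es sS] := ereal_real_between epsS; pose de := (s - eps) / 2.
  have de0 : 0 < de by rewrite divr_gt0 ?subr_gt0.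
  pose Y x := ln (Num.max (f x) 1) ^+ 2.
  have mY : measurable_fun setT Y by exact: measurable_funX.
  have IY : gamma.-integrable setT (fun x => (expR ((eps + de) * Y x))%:E).
    apply: (integrable_level_exp mf (th := fun y => expR (Num.sqrt y)) (S := soo) mY).
    - by move=> x; exact: sqr_ge0.
    - move=> y x y0; rewrite -le_ln_max1 ?sqrtr_gt0//.
      by rewrite le_sqr_sqrt ?ln_max1_ge0// ltW.
    - move=> y y0 g0; set t := expR _ in g0 *.
      have -> : y = ln t ^+ 2 by rewrite expRK sqr_sqrtr// ltW.
      apply: (exponent_bounded hgamma hv_meas hv_l2 hv_L1 hmu mf muf) => //.
      by rewrite expR_gt1 sqrtr_gt0.
    - by apply: lt_le_trans sS; rewrite lte_fin /de; lra.
  have mE : measurable_fun setT (fun x => expR (eps * Y x)).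
    by apply: measurableT_comp => //; exact: measurable_funM.
  have If : gamma.-integrable setT (fun x => (expR (eps * Y x) * f x)%:E).
    have IY' : gamma.-integrable setT (fun x => (expR (4 * de)^-1 * expR ((eps + de) * Y x))%:E).
      rewrite (_ : (fun x => _) = (fun x => (expR (4 * de)^-1)%:E * (expR ((eps + de) * Y x))%:E)%E)//.
      exact: integrableZl.
    apply: (integrable_dominated _ _ IY'); first exact: measurable_funM.
    move=> x; rewrite mulr_ge0 ?expR_ge0//=.
    set L := ln (Num.max (f x) 1).
    have fL : f x <= expR L.
      by rewrite lnK ?posrE ?lt_max ?ltr01 ?orbT// le_max lexx.
    apply: (@le_trans _ _ (expR (eps * Y x) * expR L)); first by rewrite ler_pM2l ?expR_gt0.
    rewrite -!expRD ler_expR /Y -/L.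
    have : 0 <= (2 * de * L - 1) ^+ 2 / (4 * de) by rewrite divr_ge0 ?sqr_ge0// mulr_ge0// ltW.
    rewrite (_ : _ / _ = de * L ^+ 2 - L + (4 * de)^-1); first lra.
    by field; rewrite gt_eqF.
  apply/integrableP; split; first exact/measurable_EFinP.
  under eq_integral do rewrite /= gtr0_norm ?expR_gt0//.
  rewrite -(Radon_Nikodym_SigmaFinite.change_of_variables dom)//=; last exact/measurable_EFinP.
  under eq_integral do rewrite -/F -fE -EFinM.
  by rewrite ltey_eq (integrable_fin_num _ If).
Qed.
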